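(* Let $n\ge 2$, let $\lambda=(\lambda_1\ge\cdots\ge\lambda_n\ge 0)$ be a Ferrers shape contained in the $n\times n$ square (set $\lambda_{n+1}:=0$), and let $1\le r<n$. Let $w$ be a biword on $[n]$ consisting of a multiset of cells of $\lambda$ which contains the cell $(r+1,\lambda_{r+1})$ (i.e. the biletter $\binom{\lambda_{r+1}}{r+1}$) with multiplicity at least one. Let $\Phi(w)=(F,G)$, $\nu=sh(F)$, $\beta=sh(G)$. Then: (a) If $\nu_r<\nu_{r+1}$, then $sh(\Upsilon_r F)=s_r\nu$. (b) $\Phi(\Upsilon_r w)=(\Upsilon_r F,G)$ and $\Phi(\Upsilon_r\overline w)=(\Upsilon_r G,F)$. (c) If $\lambda_r=\lambda_{r+1}>\lambda_{r+2}\ge 0$, then $\nu_r<\nu_{r+1}$ and $sh(\Upsilon_rF)=s_r\nu$; moreover $\Upsilon_r w$ consists of a multiset of cells of the Ferrers shape $\lambda$ with the cell $(r+1,\lambda_{r+1})$ deleted. (d) If $\mu$ is the transpose (conjugate) of $\lambda$ and $\mu_r=\mu_{r+1}>\mu_{r+2}\ge 0$, then $\beta_r<\beta_{r+1}$ and $sh(\Upsilon_r G)=s_r\beta$; moreover the biletters of $\Upsilon_r\overline w$, where a biletter $\binom{a}{b}$ of $\Upsilon_r\overline w$ is identified with the cell (row $a$, column $b$) of $\lambda$, form a multiset of cells of $\lambda$ with the cell $(\mu_{r+1},r+1)$ deleted.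
   Context: Notation: $[n]=\{1,\dots,n\}$. Cells $(i,j)$ are in French convention: $i$ is the row index counted from the bottom, $j$ the column index counted from the left. A Ferrers shape $\lambda$ is the set of cells $\{(i,j):1\le j\le\lambda_i\}$. Biwords. A biword on $[n]$ is a two-row array $w=\binom{j_1\,\cdots\, j_l}{i_1\,\cdots\, i_l}$ with entries in $[n]$, in lexicographic order with respect to the first row ($j_s\le j_{s+1}$, and $i_s\le i_{s+1}$ when $j_s=j_{s+1}$). A biletter $\binom{j}{i}$ is identified with the cell $(i,j)$; $w$ ''consists of a multiset of cells of a set $D$'' if the cell of every biletter of $w$ lies in $D$. $\overline w$ denotes the biword obtained by interchanging the two rows of $w$ and reordering lexicographically with respect to the new first row. Crystal operators. For a word $v$ on $[n]$ and $1\le r<n$, consider the subword of letters $r,r+1$ and repeatedly match (and remove) pairs formed by a letter $r+1$ followed immediately (in the current subword) by a letter $r$; the unmatched letters form $r^a(r+1)^b$. $e_r$ changes the leftmost unmatched $r+1$ into $r$. For $w=\binom{\mathbf u}{\mathbf v}$ (lexicographic w.r.t. first row), $\Upsilon_r w:=\binom{\mathbf u}{e_r^{\,b}\mathbf v}$, i.e. all unmatched letters $r+1$ of the second row are changed into $r$. SSAFs. For a reverse semistandard Young tableau $\widetilde P$ (French convention; rows weakly decreasing left to right, columns strictly decreasing bottom to top) with entries in $[n]$, $\varrho(\widetilde P)$ is built as follows: start with a basement row $0$ containing $1,\dots,n$ in columns $1,\dots,n$; place each entry of the first column of $\widetilde P$ on top of the basement entry equal to it; then for $i\ge1$, insert the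 entries of column $i+1$ of $\widetilde P$ in decreasing order, placing each entry $a$ in row $i+1$ on top of the leftmost entry $b$ of row $i$ with $b\ge a$ and with the cell above $b$ still empty. The result is a semi-skyline augmented filling (SSAF); its shape $sh(F)\in\mathbb N^n$ is the vector of column heights (basement excluded). For an SSYT $P$ on $[n]$, let $\widetilde P$ be the reverse SSYT obtained by reverse Schensted insertion of the column word of $P$ (column word: entries of each column read top to bottom, columns left to right; reverse insertion of $b_1\cdots b_m$ = Schensted insertion of $(n-b_m+1)\cdots(n-b_1+1)$ followed by replacing each entry $a$ by $n-a+1$), and set $\Psi(P):=\varrho(\widetilde P)$; $\Psi$ is a bijection from SSYTs on $[n]$ to SSAFs on $[n]$. For an SSAF $F=\Psi(P)$, $\Upsilon_r F:=\Psi(P')$ where $P'$ is the SSYT obtained from $P$ by changing all unmatched letters $r+1$ of its column word into $r$. The map $\Phi$: for a biword $w$, apply RSK to $w^*=\binom{n-j_l+1\,\cdots\, n-j_1+1}{n-i_l+1\,\cdots\, n-i_1+1}$ to get $(P,Q)$ and replace every entry $a$ by $n-a+1$ to get reverse SSYTs $(\widetilde P,\widetilde Q)$ (reverse RSK); then $\Phi(w):=(\varrho(\widetilde P),\varrho(\widetilde Q))$. $\mathfrak S_n$ acts on $\mathbb N^n$ by permuting positions; $s_r$ swaps entries $r$ and $r+1$.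
   Formalization: In (d), the claims β_r<β_{r+1} and sh(Υ_r G)=s_rβ are proved for w containing the cell (μ_{r+1},r+1) instead of (r+1,λ_{r+1}); as written they fail for n=3, λ=(3,3,2), r=1, w the single cell (2,3), where β=(0,0,1). *)

(* Defs.v *)
From mathcomp Require Import all_boot.
From mathcomp Require Import classical_sets.

Set Implicit Arguments.
Unset Strict Implicit.
Unset Printing Implicit Defensive.

(* Letters, rows and columns are numbered from 1, so vectors, words and shapes
   (sequences, 0-indexed) are read through [entry], which is 0 beyond the end:
   for [size lam = n], [entry lam n.+1 = 0]. *)
Definition entry (s : seq nat) (i : nat) : nat := nth 0 s i.-1.

Definition letter (n a : nat) : bool := (0 < a) && (a <= n).

(* A Ferrers shape in the n x n square: exactly n parts, trailing zeros kept. *)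
Definition ferrers (n : nat) (lam : seq nat) : bool :=
  [&& size lam == n, sorted geq lam & all (fun x => x <= n) lam].

(* Cells are pairs (row, column). *)
Definition cells (lam : seq nat) : pred (nat * nat) :=
  fun c => [&& 0 < c.1, 0 < c.2 & c.2 <= entry lam c.1].

Definition conj_shape (n : nat) (lam : seq nat) : seq nat :=
  [seq count (fun x => j <= x) lam | j <- iota 1 n].

Definition s_swap (r : nat) (s : seq nat) : seq nat :=
  set_nth 0 (set_nth 0 s r.-1 (entry s r.+1)) r (entry s r).

(* The biletter with upper entry j and lower entry i is the pair (j, i);
   its cell is (i, j). *)
Definition biletter_le : rel (nat * nat) :=
  fun b c => (b.1 < c.1) || ((b.1 == c.1) && (b.2 <= c.2)).

Definition is_biword (n : nat) (w : seq (nat * nat)) : bool :=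
  sorted biletter_le w && all (fun b => letter n b.1 && letter n b.2) w.

Definition cell_of (b : nat * nat) : nat * nat := (b.2, b.1).

Definition bar (w : seq (nat * nat)) : seq (nat * nat) :=
  sort biletter_le [seq (b.2, b.1) | b <- w].

(* Bracket matching, r+1 opening and r closing. [stack] holds the positions of
   the letters r+1 still unmatched, the most recent first; p is the position of
   the first letter of v. The result lists the positions of the unmatched
   letters r+1, from left to right. *)
Fixpoint unmatched_from (r : nat) (stack : seq nat) (p : nat) (v : seq nat) :
    seq nat :=
  if v is x :: v' then
    if x == r.+1 then unmatched_from r (p :: stack) p.+1 v'
    else if x == r then unmatched_from r (behead stack) p.+1 v'
    else unmatched_from r stack p.+1 v'
  else rev stack.

Definition unmatched (r : nat) (v : seq nat) : seq nat :=
  unmatched_from r [::] 0 v.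

(* e_r, made total by fixing the words with no unmatched r+1. *)
Definition e_op (r : nat) (v : seq nat) : seq nat :=
  if unmatched r v is p :: _ then set_nth 0 v p r else v.

Definition Upsilon_biword (r : nat) (w : seq (nat * nat)) : seq (nat * nat) :=
  let v := unzip2 w in
  zip (unzip1 w) (iter (size (unmatched r v)) (e_op r) v).

Definition change_unmatched (r : nat) (v : seq nat) : seq nat :=
  foldl (fun u p => set_nth 0 u p r) v (unmatched r v).

(* Tableaux are lists of nonempty rows, bottom row first. [transpose T] is the list of
   columns, each from bottom to top; on lists of lists of partition shape it is an
   involution. *)
Definition transpose (T : seq (seq nat)) : seq (seq nat) :=
  [seq [seq nth 0 row j | row <- T & j < size row]
     | j <- iota 0 (size (head [::] T))].

Definition is_ssyt (n : nat) (T : seq (seq nat)) : bool :=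
  [&& all (fun row => row != [::]) T, sorted geq (map size T),
      all (sorted leq) T, all (sorted ltn) (transpose T) & all (all (letter n)) T].

Definition column_word (T : seq (seq nat)) : seq nat :=
  flatten (map rev (transpose T)).

(* The tableau of the shape of T whose column word is obtained from that of T
   by changing all unmatched r+1 into r. *)
Definition Upsilon_tableau (r : nat) (T : seq (seq nat)) : seq (seq nat) :=
  let v := change_unmatched r (column_word T) in
  transpose (map rev (reshape (map size (transpose T)) v)).

(* x bumps the leftmost letter > x, or is appended when there is none (then p is
   [size row]). *)
Fixpoint insert (T : seq (seq nat)) (x : nat) : seq (seq nat) :=
  if T is row :: T' then
    let p := find (fun y => x < y) row in
    set_nth 0 row p x ::
      (if p < size row then insert T' (nth 0 row p) else T')
  else [:: [:: x]].

(* The (0-based) row in which [insert T x] creates its new cell. *)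
Fixpoint new_row (T : seq (seq nat)) (x : nat) : nat :=
  if T is row :: T' then
    let p := find (fun y => x < y) row in
    if p < size row then (new_row T' (nth 0 row p)).+1 else 0
  else 0.

Definition schensted (v : seq nat) : seq (seq nat) := foldl insert [::] v.

Definition RSK_step (PQ : seq (seq nat) * seq (seq nat)) (b : nat * nat) :=
  let k := new_row PQ.1 b.2 in
  (insert PQ.1 b.2, set_nth [::] PQ.2 k (rcons (nth [::] PQ.2 k) b.1)).

Definition RSK (w : seq (nat * nat)) : seq (seq nat) * seq (seq nat) :=
  foldl RSK_step ([::], [::]) w.

Definition compl (n a : nat) : nat := n.+1 - a.

Definition reverse_schensted (n : nat) (v : seq nat) : seq (seq nat) :=
  map (map (compl n)) (schensted (rev (map (compl n) v))).

Definition star (n : nat) (w : seq (nat * nat)) : seq (nat * nat) :=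
  rev [seq (compl n b.1, compl n b.2) | b <- w].

Definition reverse_RSK (n : nat) (w : seq (nat * nat)) :
    seq (seq nat) * seq (seq nat) :=
  let PQ := RSK (star n w) in
  (map (map (compl n)) PQ.1, map (map (compl n)) PQ.2).

(* A semi-skyline augmented filling is the list of its n columns, each from bottom
   to top and starting with its basement entry. *)
Definition basement (n : nat) : seq (seq nat) := [seq [:: j] | j <- iota 1 n].

(* Places a in row i+1, on top of the leftmost admissible entry of row i. A column
   has a free place above its row i exactly when its size is i+1. If no entry is
   admissible (which cannot happen for reverse tableaux) nothing is done. *)
Definition place (i : nat) (F : seq (seq nat)) (a : nat) : seq (seq nat) :=
  let p := find (fun c : seq nat => (size c == i.+1) &&
             (if i == 0 then last 0 c == a else a <= last 0 c)) F in
  if p < size F then set_nth [::] F p (rcons (nth [::] F p) a) else F.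

Definition rho (n : nat) (T : seq (seq nat)) : seq (seq nat) :=
  foldl (fun F ic => foldl (place ic.1) F (sort geq ic.2)) (basement n)
    (zip (iota 0 (size (transpose T))) (transpose T)).

Definition sh (F : seq (seq nat)) : seq nat := [seq (size c).-1 | c <- F].

Definition Psi (n : nat) (P : seq (seq nat)) : seq (seq nat) :=
  rho n (reverse_schensted n (column_word P)).

(* The inverse of the bijection Psi from SSYTs on [n] to SSAFs on [n]; the
   default value is used only outside the image of Psi. *)
Definition Psi_inv (n : nat) (F : seq (seq nat)) : seq (seq nat) :=
  xget [::] (fun P => is_ssyt n P /\ Psi n P = F).

Definition Upsilon_SSAF (n r : nat) (F : seq (seq nat)) : seq (seq nat) :=
  Psi n (Upsilon_tableau r (Psi_inv n F)).

Definition Phi (n : nat) (w : seq (nat * nat)) :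
    seq (seq nat) * seq (seq nat) :=
  let PQ := reverse_RSK n w in (rho n PQ.1, rho n PQ.2).

(* A biword in the cells of (3,3,2), whose conjugate is (3,3,2), containing the
   cell (2,3) but not its transpose (3,2): here sh(G) = (0,0,1), so for r = 1 the
   inequality sh(G)_r < sh(G)_(r+1) requires the presence of the transposed
   corner cell (3,2). *)
Example transposed_corner_needed :
  conj_shape 3 [:: 3; 3; 2] = [:: 3; 3; 2] /\
  all (fun b => cells [:: 3; 3; 2] (cell_of b)) [:: (3, 2)] /\
  sh (Phi 3 [:: (3, 2)]).2 = [:: 0; 0; 1].
Proof. by []. Qed.

(* Main.v *)
Require Import Defs.
From mathcomp Require Import all_boot.
From mathcomp Require Import zify.
From mathcomp Require classical_sets.

(** With P~(v) the reverse tableau of a word v, the filling of v is read as a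
    sequence of rows: row i+1 carries the entries of column i+1 of P~(v), and it
    is the unique filling of these entries above row i in which no entry could
    have been placed further to the left (it is "greedy").  Existence of these
    greedy chains comes from Mason's insertion: left multiplication of v by a
    letter sends a letter down the rows, each row passing on one letter; on the
    tableau side row insertion does the same with columns, and both processes
    pass on the same letter because it is the largest t for which the upper
    column, with the incoming letter, has more entries >= t than the lower one.
    Following the letter also shows that sh_r < sh_(r+1) persists under left
    multiplication, which gives (c): by the shape condition the letters after
    the corner are equal to r+1 or smaller than r, so the inequality holds from
    the corner on.

    Changing the unmatched r+1 preserves Knuth equivalence, hence changes P~(v)
    columnwise and keeps its shape; applied to all suffixes of v this shows that
    the recording tableau is unchanged.  Comparing the two greedy chains row by
    row, each row of the second is the corresponding row of the first up to
    exchanging the columns r, r+1 and exchanging the values r, r+1, and when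
    sh_r < sh_(r+1) the columns are exchanged where exactly one of them is
    occupied; this is (a).  The symmetry of RSK under exchanging the two rows,
    proved by deleting the last biletter, reduces the statements on G to those
    on F. *)

(** [Psi_inv] is a choice function, so it is accessible only through injectivity: equal fillings
    come from Knuth equivalent words. For this reason the operators on fillings are carried over to
    words. As [star] reverses a word, its tableau is built from the last letter to the first; hence
    left multiplication, a matching that is counted from the right end, and suffixes in the place
    where recording tableaux require prefixes. Fillings are functions of row and column with 0 for
    an empty place, which avoids moving list positions and turns most arguments into inequalities.
    The comparison of the two chains cannot follow one uniform rule, since the basement is common to
    both. The chains coincide as long as r and r+1 both stand on their own basement letters; an
    exchange of columns can begin only at a row with r+1 and without r, and once it has ended it
    does not resume. Exchanging the values r and r+1 serves as an intermediate row: it changes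
    neither the occupied places nor any comparison with a threshold other than r+1. *)

Set Implicit Arguments.
Unset Strict Implicit.
Unset Printing Implicit Defensive.

(** * Unmatched letters *)

(* The number of unmatched r in v, when v is followed by a word with k unmatched
   r; likewise for the word obtained by changing the unmatched r+1. *)
Fixpoint closers_above (r k : nat) (v : seq nat) : nat :=
  if v is x :: v' then
    let k' := closers_above r k v' in
    if x == r.+1 then k'.-1 else if x == r then k'.+1 else k'
  else k.

Fixpoint ups_above (r k : nat) (v : seq nat) : seq nat :=
  if v is x :: v' then
    (if (x == r.+1) && (closers_above r k v' == 0) then r else x)
      :: ups_above r k v'
  else [::].

Notation closers r v := (closers_above r 0 v).
Notation ups r v := (ups_above r 0 v).

Lemma closers_cat r k u v :
  closers_above r k (u ++ v) = closers_above r (closers_above r k v) u.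
Proof. by elim: u => //= x u ->. Qed.

Lemma ups_cat r k u v :
  ups_above r k (u ++ v) =
  ups_above r (closers_above r k v) u ++ ups_above r k v.
Proof. by elim: u => //= x u ->; rewrite closers_cat. Qed.

Lemma size_ups r k v : size (ups_above r k v) = size v.
Proof. by elim: v => //= x v ->. Qed.

Lemma drop_ups r k m v : drop m (ups_above r k v) = ups_above r k (drop m v).
Proof. by elim: v m => [|x v IH] [|m] //=. Qed.

Lemma mem_ups r k v y : y \in ups_above r k v -> y \in v \/ (y = r /\ r.+1 \in v).
Proof.
elim: v => //= x v IH; rewrite !inE => /orP[/eqP->|/IH[->|[-> ->]]]; first last.
- by right; rewrite orbT.
- by left; rewrite orbT.
by case: ifP => [/andP[/eqP-> _]|_]; [right; rewrite eqxx | left; rewrite eqxx].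
Qed.

Lemma closers_gt0 r v : 0 < closers r v -> r \in v.
Proof.
elim: v => //= x v IH; rewrite inE.
case: eqP => [_ h|_]; first by rewrite IH ?orbT //; lia.
by case: eqP => [->|_ /IH->]; rewrite ?eqxx ?orbT.
Qed.

(** The positions found by [unmatched], but from the right end: an r+1 is unmatched when the word
    after it leaves no r unmatched. Unlike the stack, this description restricts to suffixes. *)
Fixpoint unmatched_pos (r p : nat) (v : seq nat) : seq nat :=
  if v is x :: v' then
    if (x == r.+1) && (closers r v' == 0) then p :: unmatched_pos r p.+1 v'
    else unmatched_pos r p.+1 v'
  else [::].

(** The unmatched r of [v] close the most recent open positions, so that many are dropped from the
    top of the stack; the survivors precede the unmatched positions of [v] itself. *)
Lemma unmatched_fromE r st p v :
  unmatched_from r st p v = rev (drop (closers r v) st) ++ unmatched_pos r p v.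
Proof.
elim: v st p => [|x v IH] st p /=; first by rewrite drop0 cats0.
case: eqP => [_|xs] /=.
  rewrite IH; case: (closers_above r 0 v) => [|k] //=.
  by rewrite drop0 rev_cons cat_rcons.
case: eqP => [_|xr] //; rewrite IH; congr (rev _ ++ _).
by rewrite -drop1 drop_drop addn1.
Qed.

Lemma unmatchedE r v : unmatched r v = unmatched_pos r 0 v.
Proof. by rewrite /unmatched unmatched_fromE. Qed.

Lemma unmatched_posS r p v :
  unmatched_pos r p.+1 v = [seq i.+1 | i <- unmatched_pos r p v].
Proof.
elim: v p => [|x v IH] p //=.
by case: ifP => _; rewrite IH.
Qed.

Lemma foldl_set_nthS r x (u : seq nat) ps :
  foldl (fun u p => set_nth 0 u p r) (x :: u) [seq i.+1 | i <- ps] =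
  x :: foldl (fun u p => set_nth 0 u p r) u ps.
Proof. by elim: ps u => //= p ps IH u; rewrite IH. Qed.

Lemma change_unmatchedE r v : change_unmatched r v = ups r v.
Proof.
rewrite /change_unmatched unmatchedE.
elim: v => //= x v IH.
by case: ifP => _ /=; rewrite unmatched_posS foldl_set_nthS IH.
Qed.

(** The new r can only raise the number of unmatched r seen from an earlier letter, and every r+1
    before the leftmost unmatched one is matched already; so only the position [p] leaves the
    list. *)
Lemma unmatched_e_op r v p ps :
  unmatched_pos r 0 v = p :: ps -> unmatched_pos r 0 (set_nth 0 v p r) = ps.
Proof.
elim: v p ps => //= x v IH p ps.
case: ifP => [/andP[/eqP-> /eqP c0] [<- <-] /=|xu].
  by rewrite ltn_eqF.
rewrite unmatched_posS; case e: (unmatched_pos r 0 v) => [|q qs] //= [<- <-].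
rewrite /= unmatched_posS (IH _ _ e).
case: (boolP (_ && _)) => // /andP[/eqP xs /eqP c0]; exfalso.
move: xu; rewrite xs eqxx /= => /negbT c1.
have {}c1 : 0 < closers r v by lia.
have : closers r v <= closers r (set_nth 0 v q r).
  elim: v q qs e {IH c0 c1} => //= y v IH q qs.
  case: ifP => [/andP[/eqP-> /eqP c0] [<- _] /=|yu].
    by rewrite c0 eqxx /= ltn_eqF // eqxx.
  rewrite unmatched_posS; case e: (unmatched_pos r 0 v) => [|q' qs'] //= [<- _].
  by have := IH _ _ e; rewrite /=; case: eqP => _; [|case: eqP => _]; lia.
by rewrite c0; lia.
Qed.

Lemma iter_e_op r v : iter (size (unmatched r v)) (e_op r) v = ups r v.
Proof.
rewrite -change_unmatchedE /change_unmatched.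
have gen ps : forall v, unmatched r v = ps ->
    iter (size ps) (e_op r) v = foldl (fun u p => set_nth 0 u p r) v ps.
  elim: ps => [|p ps IH] {}v e //.
  rewrite /= -iterS iterSr {2}/e_op e IH //.
  by rewrite unmatchedE (@unmatched_e_op r v p ps) // -unmatchedE.
exact: gen.
Qed.

Lemma Upsilon_biwordE r w :
  Upsilon_biword r w = zip (unzip1 w) (ups r (unzip2 w)).
Proof. by rewrite /Upsilon_biword iter_e_op. Qed.

(** * Knuth equivalence *)

Inductive knuth1 : seq nat -> seq nat -> Prop :=
| Knuth_yzx x y z : x < y -> y <= z -> knuth1 [:: y; z; x] [:: y; x; z]
| Knuth_xzy x y z : x <= y -> y < z -> knuth1 [:: x; z; y] [:: z; x; y].

Inductive knuth : seq nat -> seq nat -> Prop :=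
| knuth_refl u : knuth u u
| knuth_step p a b q : knuth1 a b -> knuth (p ++ a ++ q) (p ++ b ++ q)
| knuth_sym u v : knuth u v -> knuth v u
| knuth_trans u v w : knuth u v -> knuth v w -> knuth u w.

Lemma knuth_ctx p q u v : knuth u v -> knuth (p ++ u ++ q) (p ++ v ++ q).
Proof.
elim=> {u v} [u|p' a b q' ab|u v _|u v w _ h1 _ h2].
- exact: knuth_refl.
- have e c : p ++ (p' ++ c ++ q') ++ q = (p ++ p') ++ c ++ (q' ++ q).
    by rewrite -!catA.
  by rewrite !e; apply: knuth_step.
- exact: knuth_sym.
- exact: knuth_trans h1 h2.
Qed.

Lemma knuth_catl p u v : knuth u v -> knuth (p ++ u) (p ++ v).
Proof. by move/(knuth_ctx p [::]); rewrite !cats0. Qed.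

Lemma knuth_catr q u v : knuth u v -> knuth (u ++ q) (v ++ q).
Proof. exact: (@knuth_ctx [::]). Qed.

Lemma knuth1_knuth a b : knuth1 a b -> knuth a b.
Proof. by move=> h; rewrite -(cats0 a) -(cats0 b); apply: (@knuth_step [::]). Qed.

Lemma knuth_perm u v : knuth u v -> perm_eq u v.
Proof.
elim=> {u v} [u|p a b q [] x y z _ _|u v _|u v w _ h1 _ h2].
- exact: perm_refl.
- rewrite perm_cat2l perm_cat2r; apply/permP => P /=; lia.
- rewrite perm_cat2l perm_cat2r; apply/permP => P /=; lia.
- by rewrite perm_sym.
- exact: perm_trans h1 h2.
Qed.

Definition starw (n : nat) (v : seq nat) := rev (map (compl n) v).

Lemma starw_cat n u v : starw n (u ++ v) = starw n v ++ starw n u.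
Proof. by rewrite /starw map_cat rev_cat. Qed.

Lemma compl_letter n a : letter n a -> letter n (compl n a).
Proof. by rewrite /letter /compl; lia. Qed.

Lemma complK n a : letter n a -> compl n (compl n a) = a.
Proof. by rewrite /letter /compl; lia. Qed.

Lemma starw_letter n v : all (letter n) v -> all (letter n) (starw n v).
Proof.
move=> h; rewrite /starw all_rev all_map; apply: sub_all h => a /=.
exact: compl_letter.
Qed.

Lemma starwK n v : all (letter n) v -> starw n (starw n v) = v.
Proof.
move=> h; rewrite /starw map_rev revK -map_comp.
by elim: v h => //= a v IH /andP[ha hv]; rewrite complK // IH.
Qed.

(** Reversal together with complementation exchanges the two Knuth relations. The letters are
    bounded because [compl] is a truncated subtraction. *)
Lemma knuth_starw n u v :
  knuth u v -> all (letter n) u -> knuth (starw n u) (starw n v).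
Proof.
elim=> {u v} [u|p a b q ab|u v uv IH|u v w uv h1 _ h2] hl.
- exact: knuth_refl.
- rewrite !starw_cat -!catA; apply: knuth_ctx.
  have {hl} : all (letter n) a by move: hl; rewrite !all_cat => /and3P[].
  case: ab => x y z h1 h2 /= /and4P[hx hy hz _]; apply: knuth_sym;
    apply: knuth1_knuth; rewrite /starw /rev /=.
    by constructor; move: hx hy hz; rewrite /letter /compl; lia.
  by constructor; move: hx hy hz; rewrite /letter /compl; lia.
- apply/knuth_sym/IH; move: hl.
  by rewrite -(perm_all _ (knuth_perm uv)).
- apply: knuth_trans (h1 hl) (h2 _); rewrite -(perm_all _ (knuth_perm uv)) //.
Qed.

(** The right context enters only through its number [k] of unmatched r, and three letters
    distinguish at most k = 0, k = 1 and larger values; the rest is the case analysis of which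
    letters are r or r+1. Equality of the counts allows a left context to be added afterwards. *)
Lemma knuth1_ups r k a b : knuth1 a b ->
  closers_above r k a = closers_above r k b /\
  knuth (ups_above r k a) (ups_above r k b).
Proof.
have yzx x y z : x < y -> y <= z -> knuth [:: y; z; x] [:: y; x; z].
  by move=> h1 h2; apply: knuth1_knuth; constructor.
have xzy x y z : x <= y -> y < z -> knuth [:: x; z; y] [:: z; x; y].
  by move=> h1 h2; apply: knuth1_knuth; constructor.
case=> x y z h1 h2 /=;
  case: (eqVneq x r) => [?|xr]; case: (eqVneq x r.+1) => [?|xs]; try lia;
  case: (eqVneq y r) => [?|yr]; case: (eqVneq y r.+1) => [?|ys]; try lia;
  case: (eqVneq z r) => [?|zr]; case: (eqVneq z r.+1) => [?|zs]; try lia;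
  case: k => [|[|k]] //=; (split; first by lia); subst => //=;
  try exact: knuth_refl; try (by apply: yzx; lia); try (by apply: xzy; lia);
  try (by apply: knuth_sym; apply: yzx; lia);
  try (by apply: knuth_sym; apply: xzy; lia).
Qed.

Lemma knuth_ups r u v : knuth u v -> knuth (ups r u) (ups r v).
Proof.
suff H k : knuth u v -> closers_above r k u = closers_above r k v /\
   knuth (ups_above r k u) (ups_above r k v) by case/(H 0).
move=> uv; elim: uv k => {u v} [u|p a b q ab|u v _ IH|u v w _ h1 _ h2] k.
- by split=> //; apply: knuth_refl.
- rewrite !ups_cat !closers_cat.
  have [-> h] := knuth1_ups r (closers_above r k q) ab.
  by split=> //; apply: knuth_ctx.
- by have [e h] := IH k; split=> //; apply: knuth_sym.
- have [e1 k1] := h1 k; have [e2 k2] := h2 k; split; first by rewrite e1.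
  exact: knuth_trans k1 k2.
Qed.

(** * Row insertion respects the Knuth relations *)

Lemma row_split R x : sorted leq R -> exists A B,
  [/\ R = A ++ B, all (fun y => y <= x) A, all (ltn x) B,
     find (fun y => x < y) R = size A & sorted leq A && sorted leq B].
Proof.
move=> sR; set p := find _ R.
exists (take p R), (drop p R).
have hp : p <= size R by apply: find_size.
split.
- by rewrite cat_take_drop.
- apply/(all_nthP 0) => i; rewrite size_take_min => hi.
  rewrite nth_take; last by lia.
  have h : i < p by lia.
  by have /negbT := before_find 0 h; rewrite -leqNgt.
- case: (ltnP p (size R)) => h; last by rewrite drop_oversize.
  have xp : x < nth 0 R p by apply: (@nth_find _ 0 (fun y => x < y)); rewrite has_find.
  apply/(all_nthP 0) => i; rewrite size_drop nth_drop => hi /=.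
  apply: leq_trans xp _; apply: (sorted_leq_nth leq_trans leqnn 0 sR); rewrite ?inE; lia.
- by rewrite size_take_min; lia.
- by rewrite take_sorted // drop_sorted.
Qed.

Lemma set_nth_size_cat (T : Type) (d : T) A b B x :
  set_nth d (A ++ b :: B) (size A) x = A ++ x :: B.
Proof. by elim: A => //= a A ->. Qed.

(** A list with at most one letter, so that passing to the next row is [foldl insert] and the
    letters bumped by successive insertions concatenate to a word. *)
Definition bumped (R : seq nat) (x : nat) : seq nat :=
  let p := find (fun y => x < y) R in
  if p < size R then [:: nth 0 R p] else [::].

Definition row_insert (R : seq nat) (x : nat) : seq nat :=
  set_nth 0 R (find (fun y => x < y) R) x.

Lemma row_insertP R x : sorted leq R ->
  (all (fun y => y <= x) R /\ row_insert R x = rcons R x /\ bumped R x = [::]) \/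
  exists A b B, [/\ R = A ++ b :: B, all (fun y => y <= x) A, x < b, all (leq b) B
    & row_insert R x = A ++ x :: B /\ bumped R x = [:: b]].
Proof.
move=> sR; have [A [[|b B] [eR hA hB hf sB]]] := row_split x sR.
  left; move: hf; rewrite eR cats0 => hf.
  rewrite /row_insert /bumped hf ltnn; split=> //; split=> //.
  by elim: (A) => //= a A' ->.
right; exists A, b, B; split=> //.
- by move: hB => /= /andP[].
- by move: sB => /andP[_] /=; rewrite (path_sortedE leq_trans) => /andP[].
- rewrite /row_insert /bumped hf eR size_cat /= set_nth_size_cat nth_cat.
  by rewrite ltnn subnn addnS ltnS leq_addr.
Qed.

Lemma insert_cons R T x :
  insert (R :: T) x = row_insert R x :: foldl insert T (bumped R x).
Proof. by rewrite /= /row_insert /bumped; case: ifP. Qed.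

Lemma sorted_leq_catE A b B : sorted leq (A ++ b :: B) =
  [&& sorted leq A, all (fun y => y <= b) A, all (leq b) B & sorted leq B].
Proof.
rewrite !(sorted_pairwise leq_trans) pairwise_cat allrel_consr /=.
have : all (fun y => y <= b) A -> all (leq b) B -> allrel leq A B.
  by move=> h1 h2; apply/allrelP => u v /(allP h1) hu /(allP h2); apply: leq_trans.
case: (all _ A) => [h|_]; last by rewrite /= andbF.
by case: (all _ B) h => [->|_] //=; rewrite !andbF.
Qed.

Lemma row_insert_sorted R x : sorted leq R -> sorted leq (row_insert R x).
Proof.
move=> sR; have [[h [-> _]]|[A [b [B [eR hA xb hB [-> _]]]]]] := row_insertP x sR.
  by rewrite -cats1 sorted_leq_catE sR h.
move: sR; rewrite eR !sorted_leq_catE => /and4P[-> _ _ ->]; rewrite hA /= andbT.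
by apply: sub_all hB => y; lia.
Qed.

Lemma insert_sorted T x : all (sorted leq) T -> all (sorted leq) (insert T x).
Proof.
elim: T x => // R T IH x /andP[sR sT]; rewrite insert_cons /= row_insert_sorted //=.
by rewrite /bumped; case: ifP => //= _; apply: IH.
Qed.

Lemma foldl_insert_sorted T u :
  all (sorted leq) T -> all (sorted leq) (foldl insert T u).
Proof. by elim: u T => //= x u IH T h; apply/IH/insert_sorted. Qed.

Definition bump_val (N : nat) R x := head N (bumped R x).

(* The effect of an insertion on the multiplicities [c] of the letters < N of
   a row; [b] is the bumped letter, N standing for no letter. *)
Definition bump_step (N : nat) (c : nat -> nat) (x b : nat) (c' : nat -> nat) :=
  [/\ x < b <= N, b < N -> 0 < c b, forall t, x < t < b -> c t = 0
    & forall t, t < N -> c' t + (b == t) = c t + (x == t)].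

Lemma row_insert_step N R x : sorted leq R -> all (fun y => y < N) R -> x < N ->
  [/\ bump_step N (fun t => count_mem t R) x (bump_val N R x)
        (fun t => count_mem t (row_insert R x)),
     all (fun y => y < N) (row_insert R x)
   & bumped R x = if bump_val N R x < N then [:: bump_val N R x] else [::] ].
Proof.
move=> sR lR xN; rewrite /bump_val.
have [[h [-> ->]]|[A [b [B [eR hA xb hB [-> ->]]]]]] := row_insertP x sR.
  rewrite ltnn /= all_rcons xN lR; split=> //; split=> //=; try lia.
    move=> t /andP[xt _]; apply/count_memPn/negP => /(allP h); lia.
  by move=> t tN; rewrite -cats1 count_cat /= addn0 [N == t]gtn_eqF // addn0.
move: lR; rewrite eR !all_cat /= => /and3P[-> bN ->].
rewrite bN xN; split=> //; split=> /=.
- lia.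
- by move=> _; rewrite count_cat /= eqxx; lia.
- move=> t ht; rewrite count_cat /= (_ : (b == t) = false); last by lia.
  have -> : count_mem t A = 0 by apply/count_memPn/negP => /(allP hA); lia.
  by have -> : count_mem t B = 0 by apply/count_memPn/negP => /(allP hB); lia.
- by move=> t _; rewrite !count_cat /=; lia.
Qed.

(** The bumped letter is the smallest one in the row that exceeds the inserted letter, with [N] as
    fallback; two such minima agree as soon as the candidates up to both of them agree. *)
Lemma bump_step_det N c x b c' e y d e' :
  bump_step N c x b c' -> bump_step N e y d e' ->
  (forall t, x < t -> t <= b -> t <= d -> t < N -> 0 < c t -> y < t /\ 0 < e t) ->
  (forall t, y < t -> t <= b -> t <= d -> t < N -> 0 < e t -> x < t /\ 0 < c t) ->
  b = d.
Proof.
case=> hb cb zb _ [hd ed zd _] h1 h2.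
have [bd|db|//] := ltngtP b d.
  have [] := h1 b; try lia; try (by apply: cb; lia).
  by move=> yb; rewrite zd //; lia.
have [] := h2 d; try lia; try (by apply: ed; lia).
by move=> yb; rewrite zb //; lia.
Qed.

Ltac linear_counts :=
  clear; repeat match goal with |- context [nat_of_bool ?b] =>
    let k := fresh in set k := nat_of_bool b; clearbody k end; lia.

(** Once y is in the row, x bumps a letter at most y and z one larger than z, so these insertions do
    not interfere. The bumped words are b1 b2 b3 and b1 b3 b2 with b3 < b1 <= b2: the same relation
    in the next row. *)
Lemma bump_step_yzx N x y z c b1 c1 b2 c2 b3 c3 d2 e2 d3 e3 :
  x < y -> y <= z -> z < N ->
  bump_step N c y b1 c1 -> bump_step N c1 z b2 c2 -> bump_step N c2 x b3 c3 ->
  bump_step N c1 x d2 e2 -> bump_step N e2 z d3 e3 ->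
  [/\ d2 = b3, d3 = b2, b3 <= y, b1 <= b2 & forall t, t < N -> c3 t = e3 t].
Proof.
move=> xy yz zN s1 s2 s3 s4 s5.
have [h1 p1 z1 q1] := s1; have [h2 p2 z2 q2] := s2; have [h3 p3 z3 q3] := s3.
have [g2 m2 n2 o2] := s4; have [g3 m3 n3 o3] := s5.
have c1y : 0 < c1 y by have := q1 y; lia.
have c2y : 0 < c2 y by have := q2 y; lia.
have b3y : b3 <= y by case: (leqP b3 y) => // h; have := z3 y; lia.
have d2y : d2 <= y by case: (leqP d2 y) => // h; have := n2 y; lia.
have e1 : d2 = b3.
  apply: (bump_step_det s4 s3) => t; have := q2 t; first by lia.
  by case: (eqVneq t y) => [->|]; lia.
have e2' : d3 = b2.
  by apply: (bump_step_det s5 s2) => t; have := o2 t; lia.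
split=> //.
  case: (leqP b1 b2) => // h; have := z1 b2; have := q1 b2; lia.
move=> t tN; subst d2 d3.
by move: (q1 t tN) (q2 t tN) (q3 t tN) (o2 t tN) (o3 t tN); linear_counts.
Qed.

(** The relation may change its type. If x bumps a letter at most z, each of x, y, z bumps the same
    letter in either order. Otherwise the row has no letter in (x, z]; when z comes first, x bumps
    that z, and the bumped words b1 b2 z and b1 z b2 are an instance of the other relation. *)
Lemma bump_step_xzy N x y z c b1 c1 b2 c2 b3 c3 d1 e1 d2 e2 d3 e3 :
  x <= y -> y < z -> z < N ->
  bump_step N c x b1 c1 -> bump_step N c1 z b2 c2 -> bump_step N c2 y b3 c3 ->
  bump_step N c z d1 e1 -> bump_step N e1 x d2 e2 -> bump_step N e2 y d3 e3 ->
  ([/\ d1 = b2, d2 = b1, d3 = b3, b1 <= b3 & b3 < b2] \/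
   [/\ d1 = b1, d2 = b3, d3 = b2, b3 < b1 & b1 <= b2]) /\
  forall t, t < N -> c3 t = e3 t.
Proof.
move=> xy yz zN s1 s2 s3 s4 s5 s6.
have [h1 p1 z1 q1] := s1; have [h2 p2 z2 q2] := s2; have [h3 p3 z3 q3] := s3.
have [g1 m1 n1 o1] := s4; have [g2 m2 n2 o2] := s5; have [g3 m3 n3 o3] := s6.
have c2z : 0 < c2 z by have := q2 z; lia.
have b3z : b3 <= z by case: (leqP b3 z) => // h; have := z3 z; lia.
have e1z : 0 < e1 z by have := o1 z; lia.
have d2z : d2 <= z by case: (leqP d2 z) => // h; have := n2 z; lia.
case: (leqP b1 z) => b1z.
  have E1 : d1 = b2 by apply: (bump_step_det s4 s2) => t; have := q1 t; lia.
  have E2 : d2 = b1.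
    by apply: (bump_step_det s5 s1) => t; have := o1 t; case: (eqVneq t b1) => [->|]; lia.
  subst d1 d2.
  have E3 : d3 = b3.
    by apply: (bump_step_det s6 s3) => t; have := q1 t; have := q2 t; have := o1 t; have := o2 t; lia.
  subst d3; split.
    left; split=> //; last by lia.
    case: (leqP b1 b3) => // h; have := z1 b3; have := q1 b3; have := q2 b3; lia.
  move=> t tN; move: (q1 t tN) (q2 t tN) (q3 t tN) (o1 t tN) (o2 t tN) (o3 t tN).
  by linear_counts.
have E1 : d1 = b1.
  by apply: (bump_step_det s4 s1) => t; have := z1 t; lia.
subst d1.
have E2 : d2 = z.
  case: (ltnP d2 z) => h; last by lia.
  by have := o1 d2; have := z1 d2; lia.
have E3 : b3 = z.
  case: (ltnP b3 z) => h; last by lia.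
  by have := q1 b3; have := z1 b3; have := q2 b3; lia.
subst d2 b3.
have E4 : d3 = b2.
  by apply: (bump_step_det s6 s2) => t; have := q1 t; have := o1 t; have := o2 t; have := z1 t; lia.
subst d3; split.
  right; split=> //.
  by case: (leqP b1 b2) => // h; have := z1 b2; have := q1 b2; lia.
move=> t tN; move: (q1 t tN) (q2 t tN) (q3 t tN) (o1 t tN) (o2 t tN) (o3 t tN).
by linear_counts.
Qed.

Lemma eq_row_counts N (R S : seq nat) :
  sorted leq R -> sorted leq S -> all (fun y => y < N) R -> all (fun y => y < N) S ->
  (forall t, t < N -> count_mem t R = count_mem t S) -> R = S.
Proof.
move=> sR sS lR lS h; apply: (sorted_eq leq_trans anti_leq) => //.
apply/allP => t _; apply/eqP; case: (ltnP t N) => [/h//|Nt].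
have z U : all (fun y => y < N) U -> count_mem t U = 0.
  by move=> lU; apply/count_memPn/negP => /(allP lU); lia.
by rewrite !z.
Qed.

Lemma insert3_cons R T x y z : foldl insert (R :: T) [:: x; y; z] =
  row_insert (row_insert (row_insert R x) y) z ::
  foldl insert T (bumped R x ++ bumped (row_insert R x) y ++
    bumped (row_insert (row_insert R x) y) z).
Proof. by rewrite -[LHS]/(insert (insert (insert (R :: T) x) y) z) !insert_cons !foldl_cat. Qed.

Lemma letters_bounded (R : seq nat) : exists N, all (fun y => y < N) R.
Proof.
elim: R => [|x R [N hN]]; first by exists 0.
exists (maxn x.+1 N); rewrite /= leq_maxl /=.
by apply: sub_all hN => y; lia.
Qed.

Lemma insert_knuth1 T a b : all (sorted leq) T -> knuth1 a b ->
  foldl insert T a = foldl insert T b.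
Proof.
elim: T a b => [|R T IH] a b.
  move=> _ []x y z h1 h2 /=.
    have e1 : z < y = false by lia.
    have e2 : z < x = false by lia.
    by rewrite e1 /= h1 /= e2.
  have e1 : z < x = false by lia.
  have e2 : y < x = false by lia.
  have e3 : x < z by lia.
  by rewrite e1 e3 /= e2 h2.
move=> /= /andP[sR sT] ab.
have [N hN] := letters_bounded (R ++ a).
move: hN; rewrite all_cat => /andP[lR].
case: ab => x y z h1 h2.
  case/and4P=> N1 N2 N3 _.
  have [s1 l1 u1] := row_insert_step sR lR N1.
  have sR1 := row_insert_sorted y sR.
  have [s2 l2 u2] := row_insert_step sR1 l1 N2.
  have sR2 := row_insert_sorted z sR1.
  have [s3 l3 u3] := row_insert_step sR2 l2 N3.
  have [s4 l4 u4] := row_insert_step sR1 l1 N3.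
  have sR4 := row_insert_sorted x sR1.
  have [s5 l5 u5] := row_insert_step sR4 l4 N2.
  have [E1 E2 h3 h4 hc] := bump_step_yzx h1 h2 N2 s1 s2 s3 s4 s5.
  rewrite !insert3_cons u1 u2 u3 u4 u5 E1 E2.
  rewrite (eq_row_counts _ _ l3 l5 hc); try exact: row_insert_sorted.
  congr (_ :: _).
  move: s1 h3 h4 => [/andP[+ _] _ _ _]; set b1 := bump_val N R y; set b2 := bump_val N _ z.
  set b3 := bump_val N _ x; clearbody b1 b2 b3 => h0 h3 h4.
  clear -IH sT h0 h1 h2 h3 h4 N2 N3.
  have -> : b3 < N by lia.
  (* If [b2] is [N], nothing is bumped by z and the two bumped words coincide; this includes the
     case that [b1] is [N], as b1 <= b2. Otherwise three genuine letters go up. *)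
  have [b1N|h] := ltnP b1 N; last by rewrite (_ : b2 < N = false) //; lia.
  by case: ifP => // b2N; apply: IH => //; apply: Knuth_yzx => //; lia.
case/and4P=> N1 N2 N3 _.
have [s1 l1 u1] := row_insert_step sR lR N1.
have sR1 := row_insert_sorted x sR.
have [s2 l2 u2] := row_insert_step sR1 l1 N2.
have sR2 := row_insert_sorted z sR1.
have [s3 l3 u3] := row_insert_step sR2 l2 N3.
have [t1 k1 v1] := row_insert_step sR lR N2.
have sS1 := row_insert_sorted z sR.
have [t2 k2 v2] := row_insert_step sS1 k1 N1.
have sS2 := row_insert_sorted x sS1.
have [t3 k3 v3] := row_insert_step sS2 k2 N3.
have [C hc] := bump_step_xzy h1 h2 N2 s1 s2 s3 t1 t2 t3.
rewrite !insert3_cons u1 u2 u3 v1 v2 v3.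
rewrite (eq_row_counts _ _ l3 k3 hc); try exact: row_insert_sorted.
congr (_ :: _).
move: s1 s2 s3 C => [/andP[_ +] _ _ _] [/andP[_ +] _ _ _] [/andP[_ +] _ _ _].
set b1 := bump_val N R x; set b2 := bump_val N _ z.
set b3 := bump_val N _ y; clearbody b1 b2 b3 => q1 q2 q3 C.
clear -IH sT q1 q2 q3 C.
case: C => [] [-> -> -> p1 p2].
  have -> : b3 < N by lia.
  have -> : b1 < N by lia.
  by case: ifP => // b2N; apply: IH => //; apply: Knuth_xzy.
have -> : b3 < N by lia.
have [b1N|h] := ltnP b1 N; last by rewrite (_ : b2 < N = false) //; lia.
by case: ifP => // b2N; apply: IH => //; apply: Knuth_yzx.
Qed.

Lemma insert_knuth u v : knuth u v -> schensted u = schensted v.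
Proof.
elim=> {u v} [//|p a b q ab|u v _ ->//|u v w _ -> _ //].
rewrite /schensted !foldl_cat (insert_knuth1 _ ab) //.
exact: foldl_insert_sorted.
Qed.

(** * A word is Knuth equivalent to the row word of its tableau *)

Definition row_word (T : seq (seq nat)) := flatten (rev T).

Lemma row_word_cons R T : row_word (R :: T) = row_word T ++ R.
Proof. by rewrite /row_word rev_cons flatten_rcons. Qed.

Lemma knuth_slide_left b x B : x < b -> path leq b B ->
  knuth (b :: B ++ [:: x]) (b :: x :: B).
Proof.
elim: B b => [|c B IH] b xb /=; first by move=> _; apply: knuth_refl.
move=> /andP[bc sB]; apply: (@knuth_trans _ ([:: b; c; x] ++ B)).
  by apply: (@knuth_catl [:: b]); apply: IH; lia.
apply: (@knuth_catr _ _ [:: b; x; c]).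
exact/knuth1_knuth/Knuth_yzx.
Qed.

Lemma knuth_slide_right A b x : x < b -> sorted leq (rcons A x) ->
  knuth (A ++ [:: b; x]) (b :: rcons A x).
Proof.
elim: A => [|a A IH] xb /=; first by move=> _; apply: knuth_refl.
move=> sA; apply: (@knuth_trans _ (a :: b :: rcons A x)).
  by apply: (@knuth_catl [:: a]); apply: IH => //; exact: path_sorted sA.
have : all (fun y => y <= x) (rcons A x).
  move: (path_sorted sA); rewrite -cats1 sorted_leq_catE => /and4P[_ h _ _].
  by rewrite all_cat h /= leqnn.
case E: (rcons A x) sA => [|c C] /=; first by case: (A) E.
move=> /andP[ac _] /andP[cx _].
apply: (@knuth_catr C [:: a; b; c] [:: b; a; c]).
by apply/knuth1_knuth/Knuth_xzy => //; lia.
Qed.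

(** In the word A b B x the letter x first moves left across B up to b, then b moves left across
    A. *)
Lemma knuth_row_insert R x : sorted leq R ->
  knuth (R ++ [:: x]) (bumped R x ++ row_insert R x).
Proof.
move=> sR; have [[h [-> ->]]|[A [b [B [eR hA xb hB [-> ->]]]]]] := row_insertP x sR.
  by rewrite cats1; apply: knuth_refl.
move: sR; rewrite eR sorted_leq_catE => /and4P[sA hAb _ sB] {R eR}.
apply: (@knuth_trans _ (A ++ b :: x :: B)).
  rewrite -catA; apply: knuth_catl; apply: knuth_slide_left => //.
  by rewrite (path_sortedE leq_trans) hB.
have -> : A ++ b :: x :: B = (A ++ [:: b; x]) ++ B by rewrite -catA.
have -> : [:: b] ++ A ++ x :: B = (b :: rcons A x) ++ B by rewrite /= cat_rcons.
apply/knuth_catr/knuth_slide_right => //.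
by rewrite -cats1 sorted_leq_catE sA hA.
Qed.

Lemma knuth_insert T x : all (sorted leq) T ->
  knuth (row_word T ++ [:: x]) (row_word (insert T x)).
Proof.
elim: T x => [|R T IH] x; first by move=> _; apply: knuth_refl.
case/andP=> sR sT; rewrite insert_cons !row_word_cons -catA.
apply: (@knuth_trans _ (row_word T ++ bumped R x ++ row_insert R x)).
  exact/knuth_catl/knuth_row_insert.
rewrite catA; apply: knuth_catr.
rewrite /bumped; case: ifP => _; last by rewrite cats0; apply: knuth_refl.
exact: IH.
Qed.

Lemma knuth_schensted v : knuth v (row_word (schensted v)).
Proof.
elim/last_ind: v => [|v x IH]; first exact: knuth_refl.
rewrite /schensted foldl_rcons -cats1.
apply: knuth_trans (knuth_catr _ IH) _.
by apply: knuth_insert; apply: foldl_insert_sorted.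
Qed.

(** * Tableaux and column words *)

Definition above (R S : seq nat) : bool :=
  (size S <= size R) && all (fun j => nth 0 R j < nth 0 S j) (iota 0 (size S)).

(** Column strictness is stated between consecutive rows, the form in which row insertion preserves
    it. *)
Definition tableau (T : seq (seq nat)) : bool :=
  [&& all (sorted leq) T, all (fun R => R != [::]) T & sorted above T].

Definition col (T : seq (seq nat)) (j : nat) : seq nat :=
  [seq nth 0 R j | R <- T & j < size R].

Lemma aboveP R S : reflect
  (size S <= size R /\ forall j, j < size S -> nth 0 R j < nth 0 S j) (above R S).
Proof.
apply: (iffP andP) => -[h1 h2]; split=> //.
  by move=> j hj; apply: (allP h2); rewrite mem_iota.
by apply/allP => j; rewrite mem_iota => /andP[_]; apply: h2.
Qed.

Lemma transposeE T : transpose T = [seq col T j | j <- iota 0 (size (head [::] T))].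
Proof. by []. Qed.

Lemma tableau_cons R T : tableau (R :: T) =
  [&& sorted leq R, R != [::], (if T is U :: _ then above R U else true)
    & tableau T].
Proof.
rewrite /tableau /=; case: T => [|S T] /=; first by rewrite !andbT.
case: (sorted leq R); case: (R != [::]); case: (above R S) => //=; rewrite ?andbF //.
Qed.

Lemma row_insert_nth R x j : nth 0 (row_insert R x) j =
  if j == find (fun y => x < y) R then x else nth 0 R j.
Proof. by rewrite /row_insert nth_set_nth. Qed.

Lemma row_insert_size R x : size (row_insert R x) =
  if find (fun y => x < y) R < size R then size R else (size R).+1.
Proof.
rewrite size_set_nth; have := find_size (fun y => x < y) R.
by case: ltnP; lia.
Qed.

Lemma find_gtP (R : seq nat) x (p := find (fun y => x < y) R) :
  [/\ p <= size R, forall j, j < p -> nth 0 R j <= x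
    & p < size R -> x < nth 0 R p].
Proof.
split; first exact: find_size.
  by move=> j /(before_find 0); rewrite ltnNge => /negbFE.
by move=> h; apply: (@nth_find _ 0 (fun y => x < y)); rewrite has_find.
Qed.

(** The entry of [S] over the old place of b exceeds b, so b lands weakly to the left of its old
    column; underneath it finds x or an entry at most x. *)
Lemma above_row_insert R S x b : sorted leq R -> above R S ->
  bumped R x = [:: b] -> above (row_insert R x) (row_insert S b).
Proof.
move=> sR /aboveP[sz h]; rewrite /bumped.
have := find_gtP R x; set p := find _ R => -[p1 p2 p3].
case: ifP => // pR [eb].
have := find_gtP S b; set q := find (fun y => b < y) S => -[q1 q2 q3].
have qp : q <= p.
  rewrite leqNgt; apply/negP => pq; have := q2 p pq; rewrite -eb.
  by have := h p; lia.
apply/aboveP; rewrite !row_insert_size -/p -/q pR; split.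
  by case: ltnP; lia.
move=> j hj; rewrite !row_insert_nth -/p -/q.
have xb : x < b by rewrite -eb p3.
case: (eqVneq j p) => [jp|jp]; case: (eqVneq j q) => [jq|jq] //.
- have jS : j < size S by move: hj; case: ifP; lia.
  by have := h j jS; subst j; rewrite eb; lia.
- by have := p2 j; lia.
- by apply: h; move: hj; case: ifP; lia.
Qed.

Lemma row_insert_neq0 R x : row_insert R x != [::].
Proof. by rewrite -size_eq0 row_insert_size; case: ifP; lia. Qed.

Lemma insert_tableau T x : tableau T -> tableau (insert T x).
Proof.
elim: T x => // R T IH x; rewrite insert_cons tableau_cons => /and4P[sR _ hT tT].
rewrite tableau_cons row_insert_sorted // row_insert_neq0 /=.
case E : (bumped R x) => [|b [|c bs]] /=; last by move: E; rewrite /bumped; case: ifP.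
  rewrite tT andbT; case: T hT {IH tT} => // S T /aboveP[s1 s2].
  move: E; rewrite /bumped; case: ifP => // pR _.
  have := find_gtP R x; move: pR; set p := find _ R => pR [p1 p2 p3].
  apply/aboveP; rewrite row_insert_size -/p pR; split; first by lia.
  by move=> j hj; rewrite row_insert_nth -/p ifN; [apply: s2|lia].
rewrite IH // andbT; case: T hT {IH tT} => [_|S T hS]; last first.
  by rewrite insert_cons; apply: above_row_insert.
have := @above_row_insert R [::] x b sR _ E; rewrite /row_insert /=; apply.
by apply/aboveP.
Qed.

Lemma schensted_tableau v : tableau (schensted v).
Proof.
by elim/last_ind: v => // v x; rewrite /schensted foldl_rcons; apply: insert_tableau.
Qed.

Lemma insert_perm T x : perm_eq (flatten (insert T x)) (x :: flatten T).
Proof.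
apply/permP => P.
elim: T x => //= R T IH x; rewrite -/(row_insert R x) count_cat.
have -> : (if find (fun y => x < y) R < size R then insert T (nth 0 R (find (fun y => x < y) R)) else T)
  = foldl insert T (bumped R x) by rewrite /bumped; case: ifP.
rewrite /bumped /row_insert.
have [h1 h2 h3] := find_gtP R x; move: h1 h2 h3; set p := find _ R => h1 h2 h3.
case: ltnP => pR.
  have e : count P R = count P (take p R ++ drop p R) by rewrite cat_take_drop.
  rewrite /= IH /= set_nthE pR !count_cat e count_cat (drop_nth 0 pR) /=; lia.
by rewrite /= set_nthE ltnNge pR (_ : p - size R = 0) ?count_cat /=; lia.
Qed.

Lemma schensted_perm v : perm_eq (flatten (schensted v)) v.
Proof.
elim/last_ind: v => // v x IH; rewrite /schensted foldl_rcons.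
rewrite (perm_trans (insert_perm _ _)) // perm_sym perm_rcons perm_sym.
by rewrite perm_cons.
Qed.

Lemma col_cons R T j : col (R :: T) j =
  if j < size R then nth 0 R j :: col T j else col T j.
Proof. by rewrite /col /=; case: ifP. Qed.

Lemma sorted_size_col0 R T j : sorted geq (map size (R :: T)) ->
  size R <= j -> col T j = [::].
Proof.
rewrite /= (path_sortedE (rev_trans leq_trans)) => /andP[h _] hj.
rewrite /col; suff -> : [seq R0 <- T | j < size R0] = [::] by [].
apply/eqP; rewrite -[_ == _]negbK -has_filter; apply/hasPn => S hS.
by have := allP h (size S) (map_f _ hS); rewrite /=; lia.
Qed.

Lemma above_columns T : sorted geq (map size T) ->
  all (fun R => R != [::]) T ->
  all (sorted ltn) (transpose T) = sorted above T.
Proof.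
move=> sT nT; apply/idP/idP.
  have H : all (sorted ltn) (transpose T) -> forall j, sorted ltn (col T j).
    rewrite transposeE all_map => /allP h j.
    case: (ltnP j (size (head [::] T))) => hj; first by apply: h; rewrite mem_iota.
    by case: T sT {nT h} hj => //= R T sT hj; rewrite col_cons ltnNge hj /= (sorted_size_col0 sT).
  move/H {H}; elim: T sT nT => // R [|S T] IH // sT /andP[_ nT] h.
  rewrite /= -/(sorted above (S :: T)) IH ?andbT //; last first.
  - by move=> j; have := h j; rewrite col_cons; case: ifP => // _ /path_sorted.
  - exact: path_sorted sT.
  apply/aboveP; split; first by move: sT => /= /andP[].
  move=> j hj; have := h j; rewrite !col_cons hj.
  have -> : j < size R by move: sT => /= /andP[]; lia.
  by move=> /= /andP[].
rewrite transposeE all_map => h; apply/allP => j _ /=.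
elim: T sT h {nT} => // R [|S T] IH sT.
  by move=> _; rewrite col_cons; case: ifP.
move=> /= /andP[/aboveP[h1 h2] h3].
have := IH (path_sorted sT) h3; rewrite !col_cons.
case: (ltnP j (size S)) => hj.
  have -> : j < size R by exact: leq_trans hj h1.
  by move=> /=; rewrite h2.
rewrite (@sorted_size_col0 S T j) //; first by case: ifP.
exact: path_sorted sT.
Qed.

Lemma sorted_above_size T : sorted above T -> sorted geq (map size T).
Proof.
by rewrite sorted_map; apply: sub_sorted => R S /aboveP[].
Qed.

Lemma is_ssytE n T : is_ssyt n T = tableau T && all (all (letter n)) T.
Proof.
rewrite /is_ssyt /tableau; case E: (all (fun R => R != [::]) T); rewrite /= ?andbF //.
case S: (sorted geq (map size T)) => /=.
  by rewrite (above_columns S E) -!andbA.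
case A : (sorted above T); last by rewrite !andbF.
by rewrite sorted_above_size in S.
Qed.

Lemma schensted_ssyt n v : all (letter n) v -> is_ssyt n (schensted v).
Proof.
rewrite is_ssytE schensted_tableau /= => h.
apply/allP => R hR; apply/allP => y hy; apply: (allP h).
by rewrite -(perm_mem (schensted_perm v)); apply/flattenP; exists R.
Qed.

Fixpoint addcol (rs : seq (seq nat)) (xs : seq nat) : seq (seq nat) :=
  match xs, rs with
  | [::], _ => rs
  | x :: xs', [::] => [:: x] :: addcol [::] xs'
  | x :: xs', r :: rs' => rcons r x :: addcol rs' xs'
  end.

Definition col_fits (rs : seq (seq nat)) (xs : seq nat) : bool :=
  all (fun p : seq nat * nat => all (fun y => y <= p.2) p.1) (zip rs xs).

(** By [col_fits] the old entries of the bottom row are at most x, so x bumps the bottom of the last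
    column, which bumps the next entry in turn: the column moves up by one. *)
Lemma insert_addcol rs x ys : path ltn x ys -> col_fits rs (x :: ys) ->
  insert (addcol rs ys) x = addcol rs (x :: ys).
Proof.
have ins r y : all (fun z => z <= y) r -> row_insert r y = rcons r y /\ bumped r y = [::].
  move=> h; have e : find (fun z => y < z) r = size r.
    by apply: hasNfind; apply/hasPn => z /(allP h); rewrite -leqNgt.
  by rewrite /row_insert /bumped e ltnn set_nthE ltnn subnn cats1.
elim: ys rs x => [|y ys IH] rs x /=.
  case: rs => // r rs _ /andP[/ins[e1 e2] _].
  by rewrite insert_cons e1 e2.
case: rs => [|r rs] /andP[xy sy] h.
  by rewrite /= xy /= IH.
have {}xy : x < y by [].
have {h} /andP[h0 h1] : all (fun z => z <= x) r && col_fits rs (y :: ys) by [].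
have eb : bumped (rcons r y) x = [:: y] /\ row_insert (rcons r y) x = rcons r x.
  have e : find (fun z => x < z) (rcons r y) = size r.
    rewrite -cats1 find_cat (_ : has _ r = false) /= ?xy ?addn0 //.
    by apply/negbTE/hasPn => z /(allP h0); rewrite -leqNgt.
  rewrite /row_insert /bumped e size_rcons ltnSn nth_rcons ltnn eqxx.
  by rewrite -!cats1 set_nth_size_cat.
by rewrite insert_cons eb.1 eb.2 /=; congr (_ :: _); apply: IH.
Qed.

Lemma col_fits_cons rs x xs : path ltn x xs -> col_fits rs (x :: xs) -> col_fits rs xs.
Proof.
elim: xs rs x => [|y xs IH] [|r rs] x //= /andP[xy sy] /andP[h1 h2].
have {}xy : x < y by [].
rewrite /col_fits /=; apply/andP; split; last exact: (IH _ _ sy h2).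
by apply: sub_all h1 => z /=; lia.
Qed.

Lemma foldl_insert_addcol rs xs : sorted ltn xs -> col_fits rs xs ->
  foldl insert rs (rev xs) = addcol rs xs.
Proof.
elim: xs => [|x xs IH] sx h; first by case: rs {h}.
rewrite rev_cons foldl_rcons IH ?(path_sorted sx) //; last exact: col_fits_cons h.
exact: insert_addcol.
Qed.

Lemma addcol_take T j : 0 < j -> sorted geq (map size T) ->
  addcol [seq take j R | R <- T] (col T j) = [seq take j.+1 R | R <- T].
Proof.
move=> j0; elim: T => // R T IH sT.
rewrite col_cons; case: ltnP => hj /=.
  by rewrite -take_nth // IH //; exact: path_sorted sT.
rewrite (sorted_size_col0 sT hj) /= !take_oversize //; last by lia.
congr (_ :: _); apply/eq_in_map => U hU; rewrite !take_oversize //.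
  move: sT; rewrite /= (path_sortedE (rev_trans leq_trans)) => /andP[/allP h _].
  by have := h _ (map_f size hU); rewrite /=; lia.
move: sT; rewrite /= (path_sortedE (rev_trans leq_trans)) => /andP[/allP h _].
by have := h _ (map_f size hU); rewrite /=; lia.
Qed.

Lemma addcol_col0 T : all (fun R => R != [::]) T ->
  addcol [::] (col T 0) = [seq take 1 R | R <- T].
Proof.
elim: T => //= R T IH /andP[hR hT]; rewrite col_cons.
by case: R hR => //= x R _; rewrite IH // take0.
Qed.

Lemma tableauP T : tableau T ->
  [/\ all (sorted leq) T, all (fun R => R != [::]) T, sorted geq (map size T)
    & forall j, sorted ltn (col T j)].
Proof.
move=> /and3P[h1 h2 h3]; have h4 := sorted_above_size h3; split=> // j.
have := above_columns h4 h2; rewrite h3 transposeE all_map => /allP h.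
case: (ltnP j (size (head [::] T))) => hj; first by apply: h; rewrite mem_iota.
by case: T h4 {h1 h2 h3 h} hj => //= R T h4 hj; rewrite col_cons ltnNge hj /= (sorted_size_col0 h4).
Qed.

Lemma col_fits_take T j : all (sorted leq) T -> sorted geq (map size T) ->
  col_fits [seq take j R | R <- T] (col T j).
Proof.
elim: T => // R T IH /andP[sR sT] sz.
rewrite col_cons; case: ltnP => hj; last by rewrite (sorted_size_col0 sz hj) /col_fits; case: (map _ _).
rewrite /col_fits /=; apply/andP; split; last by apply: IH => //; exact: path_sorted sz.
apply/(all_nthP 0) => i; rewrite size_take_min => hi; rewrite nth_take; last by lia.
by apply: (sorted_leq_nth leq_trans leqnn 0 sR); rewrite ?inE; lia.
Qed.

Lemma schensted_column_word T : tableau T -> schensted (column_word T) = T.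
Proof.
move=> /tableauP[h1 h2 h3 h4]; case: T h1 h2 h3 h4 => // R T h1 h2 h3 h4.
rewrite /column_word transposeE.
have nR : 0 < size R by move: h2 => /= /andP[]; case: (R).
suff H j : 0 < j -> schensted (flatten (map rev [seq col (R :: T) j | j <- iota 0 j]))
    = [seq take j U | U <- R :: T].
  rewrite H //; apply/map_id_in => U hU; rewrite take_oversize //.
  move: hU; rewrite inE => /orP[/eqP->//|hU].
  move: h3; rewrite /= (path_sortedE (rev_trans leq_trans)) => /andP[/allP h _].
  exact: (h _ (map_f size hU)).
elim: j => // [[_ _|j IH _]].
  rewrite [iota _ _]/= [map _ [:: 0]]/= [map rev _]/= /flatten [foldr _ _ _]/= cats0.
  rewrite /schensted foldl_insert_addcol; first exact: addcol_col0.
    exact: h4.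
  by rewrite /col_fits; case: (col _ _).
rewrite -[j.+2]addn1 iotaD !map_cat flatten_cat /= cats0 add0n /schensted foldl_cat.
rewrite [X in foldl _ X]IH // foldl_insert_addcol ?addcol_take ?addn1 //.
exact: col_fits_take.
Qed.

Lemma knuth_column_word v : knuth (column_word (schensted v)) v.
Proof.
apply: knuth_trans (knuth_schensted _) _; apply: knuth_sym.
by rewrite schensted_column_word ?schensted_tableau //; apply: knuth_schensted.
Qed.

Lemma knuthP u v : knuth u v <-> schensted u = schensted v.
Proof.
split; first exact: insert_knuth.
move=> e; apply: knuth_trans (knuth_schensted u) _; rewrite e.
exact/knuth_sym/knuth_schensted.
Qed.

(** * Symmetry of RSK *)

Definition addcell (T : seq (seq nat)) (k M : nat) : seq (seq nat) :=
  set_nth [::] T k (rcons (nth [::] T k) M).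

Lemma new_row_cons R T x : new_row (R :: T) x =
  if bumped R x is y :: _ then (new_row T y).+1 else 0.
Proof. by rewrite /= /bumped; case: ifP. Qed.

Lemma bumpedP R x :
  (bumped R x = [::] /\ all (fun y => y <= x) R /\ row_insert R x = rcons R x) \/
  exists2 b, bumped R x = [:: b] & x < b /\ b \in R.
Proof.
have [h1 h2 h3] := find_gtP R x; rewrite /bumped /row_insert.
move: h1 h2 h3; set p := find _ R => h1 h2 h3; case: ltnP => pR.
  by right; exists (nth 0 R p) => //; split; [exact: h3|exact: mem_nth].
left; split=> //; split; first by apply/(all_nthP 0) => i hi; apply: h2; lia.
by rewrite (_ : p = size R) ?set_nthE ?ltnn ?subnn ?cats1 //; lia.
Qed.

Lemma insert_max T M : all (all (fun y => y <= M)) T ->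
  insert T M = addcell T 0 M /\ new_row T M = 0.
Proof.
case: T => // R T /andP[hR _]; rewrite insert_cons new_row_cons.
have [[-> [_ ->]] //|[b _ [Mb /(allP hR)]]] := bumpedP R M; lia.
Qed.

Lemma new_row_size T x : new_row T x <= size T.
Proof.
elim: T x => // R T IH x; rewrite new_row_cons.
by case: (bumped R x) => //= y _; apply: IH.
Qed.

Lemma insert_size T x : size (insert T x) = maxn (size T) (new_row T x).+1.
Proof.
elim: T x => // R T IH x; rewrite insert_cons new_row_cons /=.
have [[-> _]|[b -> _]] /= := bumpedP R x; first by lia.
by rewrite IH; lia.
Qed.

Lemma addcell_size T k M : size (addcell T k M) = maxn k.+1 (size T).
Proof. by rewrite size_set_nth. Qed.

Lemma all_take (T : eqType) (p : pred T) k s : all p s -> all p (take k s).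
Proof. by move/allP=> h; apply/allP => y /mem_take/h. Qed.

Lemma all_drop (T : eqType) (p : pred T) k s : all p s -> all p (drop k s).
Proof. by move/allP=> h; apply/allP => y /mem_drop/h. Qed.

Lemma all_row_insert (p : pred nat) R x :
  p x -> all p R -> all p (row_insert R x) /\ all p (bumped R x).
Proof.
move=> px hR; have [h1 h2 h3] := find_gtP R x; rewrite /row_insert /bumped.
move: h1; set q := find _ R => h1; split.
  rewrite set_nthE; case: ltnP => qR.
    rewrite all_cat /= px all_take //=.
    exact: all_drop.
  by rewrite (_ : q - size R = 0) ?all_cat ?hR /= ?px //; lia.
by case: ltnP => //= qR; rewrite andbT; apply: (allP hR); apply: mem_nth.
Qed.

Lemma all_insert (p : pred nat) T x :
  p x -> all (all p) T -> all (all p) (insert T x).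
Proof.
elim: T x => [|R T IH] x px; first by rewrite /= px.
move=> /andP[hR hT]; rewrite insert_cons /=.
have [-> h] := all_row_insert px hR.
case: (bumped R x) (bumpedP R x) h => [|b [|c bs]] //=; last by case=> [[]|[]].
by move=> _ /andP[pb _]; apply: IH.
Qed.

Lemma all_addcell (p : pred nat) T k M :
  k <= size T -> p M -> all (all p) T -> all (all p) (addcell T k M).
Proof.
move=> kT pM hT; rewrite /addcell set_nthE.
have hk : all p (nth [::] T k).
  by case: (ltnP k (size T)) => h; [apply: (allP hT); apply: mem_nth | rewrite nth_default].
case: ltnP => h.
  by rewrite all_cat /= all_rcons pM hk all_take //= all_drop.
by rewrite (_ : k - size T = 0) ?all_cat ?hT /= ?all_rcons ?pM ?hk //; lia.
Qed.

Lemma insert_rcons R x M : x < M ->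
  row_insert (rcons R M) x =
    (if bumped R x is [::] then rcons R x else rcons (row_insert R x) M) /\
  bumped (rcons R M) x = (if bumped R x is [::] then [:: M] else bumped R x).
Proof.
move=> xM; rewrite /row_insert /bumped -!cats1 find_cat has_find.
have [h1 _ _] := find_gtP R x; move: h1; set p := find _ R => h1.
rewrite size_cat /= addn1 ltnS; case: (ltnP p (size R)) => pR.
  rewrite ltnW // nth_cat pR; split=> //.
  by elim: (R) p pR {h1} => // a R' IH [|p] //= pR; rewrite IH.
by rewrite xM addn0 leqnn nth_cat ltnn subnn /= set_nth_size_cat.
Qed.

(** The largest letter M interferes only if the insertion of x ends in row [k]: then M is bumped
    from the end of that row and settles at the end of the next one. The rows before [k] hold
    letters < M, so the letter that reaches row [k] is still smaller than M. *)
Lemma insert_addcell T k x M : k <= size T -> x < M ->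
  all (all (fun y => y <= M)) T -> all (all (fun y => y < M)) (take k T) ->
  insert (addcell T k M) x =
    addcell (insert T x) (if new_row T x == k then k.+1 else k) M /\
  new_row (addcell T k M) x =
    if new_row T x == k then k.+1 else new_row T x.
Proof.
elim: T k x => [|R T IH] [|k] x //.
- by move=> _ xM _ _; rewrite /addcell /= xM.
- move=> _ xM /andP[hR hT] _; rewrite /addcell [nth _ _ _]/= [set_nth _ _ _ _]/=.
  rewrite !insert_cons !new_row_cons; have [-> ->] := insert_rcons R xM.
  have [[-> [_ ->]]|[b -> _]] //= := bumpedP R x.
  by have [-> ->] := insert_max hT.
- move=> kT xM /andP[_ hT] /andP[hR hk].
  rewrite -[addcell _ _ _]/(R :: addcell T k M) !insert_cons !new_row_cons.
  have [_ ] := @all_row_insert (fun y => y < M) R x xM hR.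
  have [[-> [_ ->]]|[b -> _]] //= := bumpedP R x; rewrite andbT => bM.
  have kT' : k <= size T by [].
  have [-> ->] := IH k b kT' bM hT hk.
  by rewrite eqSS; case: eqP.
Qed.

Lemma insert_low_rows T k x M :
  x < M -> all (all (fun y => y < M)) (take k T) ->
  all (all (fun y => y < M))
    (take (if new_row T x == k then k.+1 else k) (insert T x)).
Proof.
elim: T k x => [|R T IH] [|k] x xM; rewrite ?new_row_cons ?insert_cons //=.
- by rewrite xM.
- by rewrite xM.
- move=> _; have [[-> [hR ->]]|[b -> _]] //= := bumpedP R x.
  rewrite all_rcons xM take0 andbT; apply: sub_all hR => y; lia.
move=> /andP[hR hk]; have [h1 h2] := @all_row_insert (fun y => y < M) R x xM hR; move: h2.
have [[-> _]|[b -> _]] //= := bumpedP R x.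
  by rewrite h1.
rewrite andbT eqSS => /IH/(_ hk); case: eqP => _ /=; by rewrite h1.
Qed.

(** In each row y bumps a letter at least as large as the one bumped by x, or none, so its path
    stops no later. *)
Lemma new_row_insert T x y : all (sorted leq) T -> x <= y ->
  new_row (insert T x) y <= new_row T x.
Proof.
elim: T x y => [|R T IH] x y.
  by move=> _ xy; rewrite /= (_ : y < x = false) //; lia.
move=> /andP[sR sT] xy; rewrite insert_cons !new_row_cons.
have [[h [-> ->]]|[A [b [B [eR hA xb hB [-> ->]]]]]] := row_insertP x sR.
  have [[-> _]|[b -> [yb]]] // := bumpedP (rcons R x) y.
  by rewrite mem_rcons inE => /orP[/eqP|/(allP h)]; lia.
have [[-> _]|[c -> [yc]]] // := bumpedP (A ++ x :: B) y.
rewrite mem_cat inE => /or3P[/(allP hA)|/eqP|/(allP hB) bc]; try lia.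
by rewrite ltnS; apply: IH.
Qed.

Lemma RSK_rcons w a b : RSK (rcons w (a, b)) =
  (insert (RSK w).1 b, addcell (RSK w).2 (new_row (RSK w).1 b) a).
Proof. by rewrite /RSK foldl_rcons; case: (foldl _ _ _). Qed.

Lemma RSK1 w : (RSK w).1 = schensted (unzip2 w).
Proof.
elim/last_ind: w => // w [a b] IH.
by rewrite RSK_rcons /= IH /unzip2 map_rcons /schensted foldl_rcons.
Qed.

Lemma RSK_size w : size (RSK w).2 = size (RSK w).1.
Proof.
by elim/last_ind: w => // w [a b] IH; rewrite RSK_rcons /= addcell_size insert_size IH; lia.
Qed.

Lemma RSK_all1 (p : pred nat) w :
  all (fun c => p c.2) w -> all (all p) (RSK w).1.
Proof.
elim/last_ind: w => // w [a b] IH; rewrite RSK_rcons all_rcons => /andP[pb /IH].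
exact: all_insert.
Qed.

Lemma RSK_all2 (p : pred nat) w :
  all (fun c => p c.1) w -> all (all p) (RSK w).2.
Proof.
elim/last_ind: w => // w [a b] IH; rewrite RSK_rcons all_rcons => /andP[pa /IH].
by apply: all_addcell => //; rewrite RSK_size new_row_size.
Qed.

Lemma biletter_le_trans : transitive biletter_le.
Proof. by move=> [a b] [c d] [e f]; rewrite /biletter_le /=; lia. Qed.

Lemma biletter_le_total : total biletter_le.
Proof. by move=> [a b] [c d]; rewrite /biletter_le /=; lia. Qed.

Lemma biletter_le_anti : antisymmetric biletter_le.
Proof.
move=> [a b] [c d]; rewrite /biletter_le /= => h.
by congr (_, _); lia.
Qed.

Lemma sorted_rconsE w c : sorted biletter_le (rcons w c) =
  all (fun b => biletter_le b c) w && sorted biletter_le w.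
Proof.
by rewrite !(sorted_pairwise biletter_le_trans) pairwise_rcons.
Qed.

Lemma take_addcell T k M e : e <= k -> k <= size T ->
  take e (addcell T k M) = take e T.
Proof.
elim: T k e => [|R T IH] [|k] [|e] //=; rewrite ?take0 // => ek kT.
by congr (_ :: _); apply: IH.
Qed.

(** Biletters with the same upper entry a have weakly increasing lower entries, so their new cells
    descend weakly and the rows below the next one are free of a. This is the condition under which
    [insert_addcell] applies to the recording tableau. *)
Lemma RSK_ties w a b : sorted biletter_le (rcons w (a, b)) ->
  all (all (fun x => x < a)) (take (new_row (RSK w).1 b) (RSK w).2).
Proof.
elim/last_ind: w b => // w [a' b'] IH b s.
move: (s); rewrite sorted_rconsE all_rcons => /andP[/andP[le hall] sw].
have [aa|] := ltnP a' a.
  apply/all_take/RSK_all2; rewrite all_rcons /= aa /=.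
  move: sw; rewrite sorted_rconsE => /andP[h _]; apply: sub_all h => -[c d].
  by rewrite /biletter_le /=; lia.
move=> aa; have ea : a' = a by move: le; rewrite /biletter_le /=; lia.
have bb : b' <= b by move: le; rewrite /biletter_le /=; lia.
subst a'; have {IH} := IH _ sw.
have ss : all (sorted leq) (RSK w).1 by rewrite RSK1 foldl_insert_sorted.
have := new_row_insert ss bb; rewrite RSK_rcons /=.
set d := new_row (RSK w).1 b'; set e := new_row _ b => ed h.
have dw : d <= size (RSK w).2 by rewrite RSK_size new_row_size.
rewrite take_addcell ?ed //.
by rewrite -(take_takel _ ed); apply: all_take.
Qed.

(* Here j is the largest lower entry: a biletter inserted into the biword acts on
   the recording tableau as a row insertion of its upper entry. *)
Lemma RSK_insert_max u y i j : sorted biletter_le (u ++ y) ->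
  all (fun c => (c.1 <= i) && (c.2 <= j)) u ->
  all (fun c => (i < c.1) && (c.2 < j)) y ->
  let k := new_row (RSK (u ++ y)).2 i in
  RSK (u ++ (i, j) :: y) =
    (addcell (RSK (u ++ y)).1 k j, insert (RSK (u ++ y)).2 i) /\
  all (all (fun x => x < j)) (take k (RSK (u ++ y)).1).
Proof.
elim/last_ind: y => [|y [a b] IH] s hu hy /=.
  rewrite cats0 cats1 RSK_rcons.
  have h1 : all (all (fun x => x <= i)) (RSK u).2.
    by apply: RSK_all2; apply: sub_all hu => c /andP[].
  have h2 : all (all (fun x => x <= j)) (RSK u).1.
    by apply: RSK_all1; apply: sub_all hu => c /andP[].
  have [-> ->] := insert_max h1; have [-> ->] := insert_max h2.
  by rewrite take0.
move: s; rewrite -rcons_cat => s.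
move: hy; rewrite all_rcons => /andP[/= /andP[ia bj] hy].
have sw : sorted biletter_le (u ++ y) by move: s; rewrite sorted_rconsE => /andP[].
have {IH} := IH sw hu hy.
rewrite -rcons_cons -!rcons_cat !RSK_rcons /=.
set P := (RSK (u ++ y)).1; set Q := (RSK (u ++ y)).2 => -[-> hk] /=.
set k := new_row Q i in hk *; set d := new_row P b.
have sz : size Q = size P by apply: RSK_size.
have kP : k <= size P by rewrite -sz new_row_size.
have dQ : d <= size Q by rewrite sz new_row_size.
have lP : all (all (fun x => x <= j)) P.
  apply: RSK_all1; rewrite all_cat; apply/andP; split.
    by apply: sub_all hu => c /andP[].
  by apply: sub_all hy => c; lia.
have lQ : all (all (fun x => x <= a)) Q.
  apply: RSK_all2; move: s; rewrite sorted_rconsE => /andP[h _].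
  by apply: sub_all h => -[c1 c2]; rewrite /biletter_le /=; lia.
have tQ : all (all (fun x => x < a)) (take d Q) := RSK_ties s.
(* The same lemma acts on both tableaux, with the largest letter j in [P] and a in [Q]. If the rows
   [d] and [k] coincide, j is pushed to the next row and a is recorded there as well. *)
have [-> ->] := insert_addcell kP bj lP hk; have [-> ->] := insert_addcell dQ ia lQ tQ.
rewrite -/d -/k (eq_sym k d).
case: (eqVneq d k) => [e|ne]; last first.
  by split=> //; have := insert_low_rows bj hk; rewrite -/d (negbTE ne).
by rewrite -e; split=> //; have := insert_low_rows bj hk; rewrite -/d -e eqxx.
Qed.

Lemma sorted_insertion s c : sorted biletter_le s -> exists u y,
  [/\ s = u ++ y, all (fun b => biletter_le b c) u,
      all (fun b => ~~ biletter_le b c) y & sorted biletter_le (u ++ c :: y)].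
Proof.
move=> ss; set p := find (fun b => ~~ biletter_le b c) s.
have hu : all (fun b => biletter_le b c) (take p s).
  apply/(all_nthP c) => i; rewrite size_take_min => hi; rewrite nth_take; last by lia.
  have h : i < p by lia.
  by have /negbFE := before_find c h.
have hy : all (fun b => ~~ biletter_le b c) (drop p s).
  case: (ltnP p (size s)) => h; last by rewrite drop_oversize.
  have hp : ~~ biletter_le (nth c s p) c.
    by apply: (@nth_find _ c (fun b => ~~ biletter_le b c)); rewrite has_find.
  have := drop_sorted p ss; rewrite (drop_nth c h) /= hp /=.
  rewrite (path_sortedE biletter_le_trans) => /andP[h1 _].
  apply: sub_all h1 => b hb; apply: contra hp; exact: biletter_le_trans.
exists (take p s), (drop p s); split=> //; first by rewrite cat_take_drop.
rewrite (sorted_pairwise biletter_le_trans) pairwise_cat allrel_consr /= hu /=.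
move: ss; rewrite -{1}(cat_take_drop p s) (sorted_pairwise biletter_le_trans).
rewrite pairwise_cat => /and3P[-> -> ->]; rewrite andbT /=.
by apply: sub_all hy => b; case/orP: (biletter_le_total b c) => ->.
Qed.

(** The last biletter (j, i) has the largest upper entry, so in [bar w] it becomes a biletter with
    the largest lower entry; [RSK_insert_max] inserts it with the roles of the two tableaux
    exchanged. *)
Theorem RSK_symmetry w : sorted biletter_le w ->
  RSK (bar w) = ((RSK w).2, (RSK w).1).
Proof.
elim/last_ind: w => // w [j i] IH s.
have /andP[hw sw] : all (fun b => biletter_le b (j, i)) w && sorted biletter_le w.
  by rewrite -sorted_rconsE.
have {IH} := IH sw.
have sbar : sorted biletter_le (bar w) by apply: sort_sorted; exact: biletter_le_total.
have [u [y [e hu hy sy]]] := sorted_insertion (i, j) sbar.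
have -> : bar (rcons w (j, i)) = u ++ (i, j) :: y.
  apply: (sorted_eq biletter_le_trans biletter_le_anti) => //.
    by apply: sort_sorted; exact: biletter_le_total.
  rewrite /bar map_rcons /= perm_sort perm_rcons perm_sym perm_catC /= perm_cons.
  by rewrite perm_catC -e perm_sort.
(* Ties: in [bar w] the biletters with lower entry j have upper entry at most i, so everything
   behind (i, j) has a lower entry strictly below j. *)
have hb c : c \in bar w -> (c.2 < j) || ((c.2 == j) && (c.1 <= i)).
  by rewrite mem_sort => /mapP[[a b] /(allP hw) h ->].
have hu' : all (fun c => (c.1 <= i) && (c.2 <= j)) u.
  apply/allP => -[a b] h; have := allP hu _ h; have := hb (a, b).
  by rewrite e mem_cat h => /(_ isT); rewrite /biletter_le /=; lia.
have hy' : all (fun c => (i < c.1) && (c.2 < j)) y.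
  apply/allP => -[a b] h; have := allP hy _ h; have := hb (a, b).
  by rewrite e mem_cat h orbT => /(_ isT); rewrite /biletter_le /=; lia.
rewrite e in sbar *; have [-> _] := RSK_insert_max sbar hu' hy'.
by move=> ->; rewrite RSK_rcons.
Qed.

(** * Changing unmatched letters in a tableau *)

Definition revcol (n : nat) (T : seq (seq nat)) (j : nat) : seq nat :=
  map (compl n) (col T j).

(** The starred column word runs through the columns from right to left, so the first [j] columns
    are those read after column [j] (columns start at 0). *)
Fixpoint col_closers (r : nat) (C : nat -> seq nat) (j : nat) : nat :=
  if j is j'.+1 then closers_above r (col_closers r C j') (C j') else 0.

(** In a decreasing column an r directly follows r+1 if both are present, and they match; a lone r+1
    is unmatched when no r is left over from the letters read after the column. *)
Lemma ups_decreasing r k C : sorted gtn C ->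
  ups_above r k C =
    [seq if [&& x == r.+1, r \notin C & k == 0] then r else x | x <- C] /\
  closers_above r k C =
    (if r.+1 \in C then if r \in C then k else k.-1
     else if r \in C then k.+1 else k).
Proof.
elim: C => // x C IH sC; have [IH1 IH2] := IH (path_sorted sC).
have lt y : y \in C -> y < x.
  by move: sC; rewrite /= (path_sortedE (rev_trans ltn_trans)) => /andP[/allP h _] /h.
have sxC : x <= r.+1 -> (r.+1 \in C) = false by move=> h; apply/negP => /lt; lia.
have rxC : x <= r -> (r \in C) = false by move=> h; apply/negP => /lt; lia.
rewrite /= IH1 IH2 !inE.
case: (eqVneq x r.+1) => [xs|xs] /=.
  have -> : (r == x) = false by lia.
  rewrite sxC ?xs //=; split; last by case: (r \in C).
  congr (_ :: _); first by case: (r \in C) => //=.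
case: (eqVneq x r) => [xr|xr] //=.
rewrite sxC ?rxC ?xr //=; split=> //; congr (_ :: _).
apply/eq_in_map => y /lt; rewrite xr => h; rewrite (_ : (y == r.+1) = false) //; lia.
Qed.

Lemma starw_column_word n T : starw n (column_word T) =
  flatten (rev [seq revcol n T j | j <- iota 0 (size (head [::] T))]).
Proof.
rewrite /starw /column_word map_flatten rev_flatten transposeE -!map_comp.
by congr (flatten (rev _)); apply: eq_map => j /=; rewrite map_rev revK.
Qed.

Lemma ups_columns r (C : nat -> seq nat) m :
  closers r (flatten (rev [seq C j | j <- iota 0 m])) = col_closers r C m /\
  ups r (flatten (rev [seq C j | j <- iota 0 m])) =
  flatten (rev [seq ups_above r (col_closers r C j) (C j) | j <- iota 0 m]).
Proof.
elim: m => // m [IH1 IH2].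
rewrite -addn1 iotaD !map_cat !rev_cat /= add0n addn1 closers_cat ups_cat.
by rewrite /= IH1 IH2.
Qed.

Definition cell_at (T : seq (seq nat)) i j := nth 0 (nth [::] T i) j.

Lemma tableau_col_lt T i1 i2 j : tableau T -> i1 < i2 -> j < size (nth [::] T i2) ->
  j < size (nth [::] T i1) /\ cell_at T i1 j < cell_at T i2 j.
Proof.
case/and3P=> _ _ ab i12 hj.
have i2T : i2 < size T by case: ltnP => // h; rewrite nth_default in hj.
have tr : transitive above.
  move=> S R U /aboveP[h1 h2] /aboveP[h3 h4]; apply/aboveP; split; first by lia.
  by move=> k hk; apply: ltn_trans (h2 _ _) (h4 _ hk); lia.
have /aboveP[h1 h2] : above (nth [::] T i1) (nth [::] T i2).
  by apply: (sorted_ltn_nth tr [::] ab) => //; rewrite inE //; lia.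
by split; [lia | apply: h2].
Qed.

Lemma tableau_row_le T i j1 j2 : tableau T -> j1 <= j2 ->
  j2 < size (nth [::] T i) -> cell_at T i j1 <= cell_at T i j2.
Proof.
case/and3P=> sT _ _ h hj.
have iT : i < size T by case: ltnP => // h'; rewrite nth_default in hj.
have s : sorted leq (nth [::] T i) by apply: (allP sT); apply: mem_nth.
by apply: (sorted_leq_nth leq_trans leqnn 0 s) => //; rewrite inE //; lia.
Qed.

Lemma mem_colP T j x : reflect
  (exists i, j < size (nth [::] T i) /\ cell_at T i j = x) (x \in col T j).
Proof.
apply: (iffP mapP) => [[R]|[i [hj <-]]].
  rewrite mem_filter => /andP[hj /(nthP [::])[i iT eR] ->].
  by exists i; rewrite /cell_at eR.
exists (nth [::] T i) => //; rewrite mem_filter hj mem_nth //.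
by case: ltnP => // h'; rewrite nth_default in hj.
Qed.

Lemma col_letter n T j : all (all (letter n)) T -> all (letter n) (col T j).
Proof.
move=> lT; apply/allP => x /mem_colP[i [hj <-]].
have iT : i < size T by case: ltnP => // h; rewrite nth_default in hj.
by apply: (allP (allP lT _ (mem_nth [::] iT))); apply: mem_nth.
Qed.

Lemma mem_revcol n T a j : all (all (letter n)) T -> letter n a ->
  (a \in revcol n T j) = (compl n a \in col T j).
Proof.
move=> lT la; apply/mapP/idP => [[x hx ->]|h]; last by exists (compl n a); rewrite ?complK.
by rewrite complK //; apply: (allP (col_letter j lT)).
Qed.

Lemma revcol_sorted n T j : all (all (letter n)) T -> tableau T ->
  sorted gtn (revcol n T j).
Proof.
move=> lT tT; have [_ _ _ sc] := tableauP tT; rewrite /revcol.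
apply: (@homo_sorted_in _ _ (letter n) (compl n) ltn gtn); last exact: sc.
  by move=> x y; rewrite !unfold_in /letter /compl /=; lia.
exact: col_letter.
Qed.

Section UpsTableau.

Variables (n r : nat) (T : seq (seq nat)).
Hypotheses (rn : 0 < r < n) (tT : tableau T) (lT : all (all (letter n)) T).

Let k j := col_closers r (revcol n T) j.

Let changes j x :=
  [&& x == compl n r.+1, compl n r \notin col T j & k j == 0].

Let change j x := if changes j x then compl n r else x.

Definition ups_rows : seq (seq nat) :=
  [seq mkseq (fun j => change j (nth 0 R j)) (size R) | R <- T].

Lemma size_nth_ups_rows i : size (nth [::] ups_rows i) = size (nth [::] T i).
Proof.
case: (ltnP i (size T)) => h; last by rewrite !nth_default ?size_map.
by rewrite (nth_map [::]) // size_mkseq.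
Qed.

Lemma cell_ups_rows i j : j < size (nth [::] T i) ->
  cell_at ups_rows i j = change j (cell_at T i j).
Proof.
move=> hj; have iT : i < size T by case: ltnP => // h; rewrite nth_default in hj.
by rewrite /cell_at (nth_map [::]) // nth_mkseq.
Qed.

Lemma col_ups_rows j : col ups_rows j = map (change j) (col T j).
Proof.
rewrite /col /ups_rows filter_map -!map_comp.
rewrite (eq_filter (a2 := fun R : seq nat => j < size R)); last first.
  by move=> R /=; rewrite size_mkseq.
apply/eq_in_map => R; rewrite mem_filter => /andP[hj _] /=.
by rewrite nth_mkseq.
Qed.

Lemma change_letter j x : letter n x -> letter n (change j x).
Proof. by rewrite /change; case: ifP => // _ _; move: rn; rewrite /letter /compl; lia. Qed.

Lemma revcol_ups_rows j : revcol n ups_rows j = ups_above r (k j) (revcol n T j).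
Proof.
have [-> _] := ups_decreasing r (k j) (revcol_sorted j lT tT).
rewrite /revcol col_ups_rows -map_comp -[RHS]map_comp.
apply/eq_in_map => x hx /=.
have lx := allP (col_letter j lT) x hx.
rewrite -/(revcol n T j) mem_revcol //; last by move: rn; rewrite /letter; lia.
rewrite /change /changes.
have -> : (compl n x == r.+1) = (x == compl n r.+1).
  by move: lx rn; rewrite /letter /compl; lia.
by case: ifP => // _; rewrite complK //; move: rn; rewrite /letter; lia.
Qed.

Lemma ups_rows_tableau : tableau ups_rows.
Proof.
(* [T] holds the complements, so changing r+1 into r raises an entry by one. *)
have es : compl n r = (compl n r.+1).+1 by move: rn; rewrite /compl; lia.
apply/and3P; split.
- apply/allP => R' /(nthP [::])[i]; rewrite size_map => iT <-.
  apply/(sortedP 0) => j; rewrite size_nth_ups_rows => hj.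
  rewrite -/(cell_at _ _ _) -/(cell_at _ i j.+1) !cell_ups_rows //; last by lia.
  have le := tableau_row_le tT (leqnSn j) hj.
  rewrite /change; case: ifP => [/and3P[/eqP e1 h2 /eqP h3]|_]; last first.
    by apply: leq_trans le _; case: ifP => [/and3P[/eqP-> _ _]|_]; lia.
  case: ifP => // /negbT; rewrite /changes => nch.
  rewrite es ltn_neqAle -{2}e1 le andbT; apply: contra nch => /eqP e2.
  rewrite -e2 eqxx /=; apply/andP; split.
    (* A complement of r in column j+1 would lie above row i; its left neighbour exceeds the entry
       of row i in column j, which is the complement of r+1, and is at most the complement of r,
       hence equal to it, contrary to [h2]. *)
    apply: contra h2 => /mem_colP[i2 [hj2 e3]].
    have i12 : i < i2.
      rewrite ltn_neqAle; apply/andP; split.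
        by apply/eqP => e; move: e3; rewrite -e -e2 es; lia.
      rewrite leqNgt; apply/negP => h; have [_] := tableau_col_lt tT h hj.
      by rewrite e3 -e2; lia.
    apply/mem_colP; exists i2.
    have hj2' : j < size (nth [::] T i2) by lia.
    have [_ h] := tableau_col_lt tT i12 hj2'.
    have := tableau_row_le tT (leqnSn j) hj2; split=> //; lia.
  (* Column j contains r+1 but not r, so the count of unmatched r stays at zero behind it. *)
  rewrite /k /= -/(k j) h3.
  have [_ ->] := ups_decreasing r 0 (revcol_sorted j lT tT).
  rewrite !mem_revcol //; try by move: rn; rewrite /letter; lia.
  by rewrite (negbTE h2) /=; case: ifP.
- rewrite all_map; case/and3P: tT => _ h _; apply: sub_all h => R /=.
  by rewrite -!size_eq0 size_mkseq.
apply/(sortedP [::]) => i; rewrite size_map => iT.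
apply/aboveP; rewrite !size_nth_ups_rows.
have hs j : j < size (nth [::] T i.+1) -> j < size (nth [::] T i).
  by move=> h; have [] := tableau_col_lt tT (ltnSn i) h.
split.
  by case: (size (nth [::] T i.+1)) hs => // m; apply.
move=> j hj; have [hj' lt] := tableau_col_lt tT (ltnSn i) hj.
rewrite -/(cell_at _ _ _) -/(cell_at _ i.+1 j) !cell_ups_rows //.
have le x : x <= change j x by rewrite /change; case: ifP => // /and3P[/eqP-> _ _]; lia.
apply: leq_trans (le _); rewrite /change; case: ifP => // /and3P[/eqP e1 h2 _].
rewrite es ltn_neqAle; apply/andP; split; last by rewrite -e1.
apply: contra h2 => /eqP e2; apply/mem_colP; exists i.+1; split=> //.
by rewrite -e2 es.
Qed.

Lemma starw_ups_rows :
  starw n (column_word ups_rows) = ups r (starw n (column_word T)).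
Proof.
rewrite !starw_column_word (ups_columns r (revcol n T) _).2.
have -> : size (head [::] ups_rows) = size (head [::] T).
  by rewrite -!nth0 size_nth_ups_rows.
by congr (flatten (rev _)); apply/eq_map => j; rewrite revcol_ups_rows.
Qed.

End UpsTableau.

(** Being a tableau, [ups_rows] is the tableau of its own column word; starred, that word is the
    changed form of a word Knuth equivalent to [v]. *)
Lemma schensted_starw_ups n r v : 0 < r < n -> all (letter n) v ->
  let T := schensted (starw n v) in
  schensted (starw n (ups r v)) = ups_rows n r T.
Proof.
move=> rn lv T; have lT : all (all (letter n)) T.
  have := schensted_ssyt (starw_letter lv); rewrite is_ssytE => /andP[] //.
have tT : tableau T by apply: schensted_tableau.
have lc S : all (all (letter n)) S -> all (letter n) (column_word S).
  move=> lS; rewrite /column_word transposeE.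
  apply/allP => x /flattenP[_ /mapP[_ /mapP[j _ ->] ->]].
  by rewrite mem_rev => hx; apply: (allP (col_letter j lS)).
have lT' : all (all (letter n)) (ups_rows n r T).
  rewrite all_map; apply: sub_all (lT) => R lR /=.
  apply/allP => x /mapP[j]; rewrite mem_iota => /andP[_ hj] ->.
  by apply: change_letter => //; apply: (allP lR); apply: mem_nth.
rewrite -[RHS]schensted_column_word; last exact: ups_rows_tableau.
apply: insert_knuth; rewrite -[X in knuth _ X](@starwK n) ?lc //.
apply: knuth_starw; last first.
  by apply/allP => x /mem_ups[/(allP lv)//|[-> _]]; move: rn; rewrite /letter; lia.
rewrite starw_ups_rows //; apply: knuth_ups; apply: knuth_sym.
rewrite -{1}(starwK lv); apply: knuth_starw; last exact: lc.
exact: knuth_column_word.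
Qed.

(** * Skyline fillings as greedy chains of rows *)

(* A row of a filling is a function of the column, 0 standing for an empty place;
   g is the row above f. *)
Definition greedy (f g : nat -> nat) : Prop :=
  (forall c, g c <= f c) /\
  (forall c c', c < c' -> 0 < g c' -> g c' <= f c -> g c' < g c).

Definition values (n : nat) (g : nat -> nat) : seq nat :=
  [seq x <- [seq g c | c <- iota 1 n] | 0 < x].

Definition base_row (n c : nat) : nat := if c <= n then c else 0.

Lemma mem_values n g a : a \in values n g -> 0 < a /\ exists2 c, 0 < c <= n & g c = a.
Proof.
rewrite mem_filter => /andP[a0 /mapP[c]]; rewrite mem_iota => h e; split=> //.
by exists c; [lia|].
Qed.

Lemma values_mem n g c : 0 < c <= n -> 0 < g c -> g c \in values n g.
Proof.
by move=> h h'; rewrite mem_filter h' map_f // mem_iota; lia.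
Qed.

(** Descending induction on the value a: once the rows agree on all entries larger than a, both must
    have a in the leftmost admissible column without a larger entry. *)
Lemma greedy_unique n f g g' : (forall c, f c <= base_row n c) ->
  greedy f g -> greedy f g' -> values n g =i values n g' ->
  forall c, g c = g' c.
Proof.
move=> fn [bg hg] [bg' hg'] e.
have fle c : 0 < f c -> 0 < c <= n by have := fn c; rewrite /base_row; case: ifP; lia.
have ins h c : (forall c, h c <= f c) -> 0 < h c -> h c \in values n h.
  by move=> hb hc; apply: values_mem => //; apply: fle; have := hb c; lia.
have H d : forall a, n < a + d -> 0 < a -> forall c, (g c == a) = (g' c == a).
  elim: d => [|d IH] a ad a0 c.
    have := bg c; have := bg' c; have := fn c; rewrite /base_row.
    by case: ifP => h; case: eqP; case: eqP; lia.
  have gt c1 : (a < g c1) = (a < g' c1).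
    apply/idP/idP => h.
      have /eqP -> : g' c1 == g c1 by rewrite -IH //; lia.
      by [].
    have /eqP -> : g c1 == g' c1 by rewrite IH //; lia.
    by [].
  apply/eqP/eqP => h.
    have := ins g c bg; rewrite h e => /(_ a0)/mem_values[_ [c1 _ h1]].
    have [cc|cc|->//] := ltngtP c c1.
      by have := hg' _ _ cc; rewrite h1 -gt h; have := bg c; lia.
    by have := hg _ _ cc; rewrite h gt h1; have := bg' c1; lia.
  have := ins g' c bg'; rewrite h -e => /(_ a0)/mem_values[_ [c1 _ h1]].
  have [cc|cc|->//] := ltngtP c c1.
    by have := hg _ _ cc; rewrite h1 gt h; have := bg' c; lia.
  by have := hg' _ _ cc; rewrite h -gt h1; have := bg c1; lia.
move=> c; case: (posnP (g c)) => [g0|g0].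
  case: (posnP (g' c)) => [->//|g0'].
  by apply/eqP; rewrite (H n) //; lia.
by apply/esym/eqP; rewrite -(H n) //; lia.
Qed.

Definition chain (n : nat) (fr : nat -> nat -> nat) : Prop :=
  (forall c, fr 0 c = base_row n c) /\ forall i, greedy (fr i) (fr i.+1).

Definition chain_of (n : nat) (fr : nat -> nat -> nat) (T : seq (seq nat)) : Prop :=
  chain n fr /\ forall i, perm_eq (values n (fr i.+1)) (revcol n T i).

Lemma chain_le n fr i j c : chain n fr -> i <= j -> fr j c <= fr i c.
Proof.
move=> [_ h]; elim: j => [|j IH]; first by case: i.
rewrite leq_eqVlt => /orP[/eqP->//|/IH]; have [hb _] := h j.
by have := hb c; lia.
Qed.

Lemma chain_base n fr i c : chain n fr -> fr i c <= base_row n c.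
Proof. by move=> h; rewrite -(proj1 h); apply: (@chain_le n fr 0). Qed.

(** An entry a placed over a basement letter larger than a would also fit over the basement letter a
    further left, where greediness would demand an entry larger than a. So the equality rule of
    [place] for the basement is a case of the greedy rule. *)
Lemma chain_row1 n fr c : chain n fr -> 0 < fr 1 c -> fr 1 c = c.
Proof.
move=> h f0; have := chain_base 1 c h; rewrite /base_row; case: ifP => cn; last by lia.
rewrite leq_eqVlt => /orP[/eqP//|lt].
have [_ /(_ 0)[b0 g0]] := h; have := g0 _ _ lt f0; rewrite (proj1 h) /base_row.
have -> : fr 1 c <= n by lia.
by move=> /(_ (leqnn _)); have := b0 (fr 1 c); rewrite (proj1 h) /base_row; case: ifP; lia.
Qed.

Definition skyline (fr : nat -> nat -> nat) (m c : nat) : seq nat :=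
  [seq x <- [seq fr i c | i <- iota 0 m.+1] | 0 < x].

Definition height (fr : nat -> nat -> nat) (m c : nat) : nat :=
  count (fun i => 0 < fr i c) (iota 1 m).

Lemma skylineS fr m c : skyline fr m.+1 c =
  skyline fr m c ++ (if 0 < fr m.+1 c then [:: fr m.+1 c] else [::]).
Proof. by rewrite /skyline -[m.+2]addn1 iotaD map_cat filter_cat. Qed.

Lemma skyline_full n fr m c : chain n fr -> 0 < fr m c ->
  size (skyline fr m c) = m.+1 /\ last 0 (skyline fr m c) = fr m c.
Proof.
move=> h f0; have e : skyline fr m c = [seq fr i c | i <- iota 0 m.+1].
  apply/all_filterP/allP => _ /mapP[i hi ->]; move: hi; rewrite mem_iota => hi.
  by have := @chain_le n fr i m c h; lia.
by rewrite e size_map size_iota; split=> //; rewrite -[m.+1]addn1 iotaD map_cat last_cat.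
Qed.

Lemma size_skyline_le fr m c : fr m c = 0 -> size (skyline fr m c) <= m.
Proof.
move=> f0; rewrite /skyline -[m.+1]addn1 iotaD map_cat filter_cat /= f0 /= cats0.
by rewrite size_filter (leq_trans (count_size _ _)) // size_map size_iota.
Qed.

Lemma find_iota (P : pred nat) n c : 0 < c <= n -> P c ->
  (forall c', 0 < c' < c -> ~~ P c') -> find P (iota 1 n) = c.-1.
Proof.
move=> hc Pc h; have -> : n = c.-1 + (n - c.-1) by lia.
rewrite iotaD find_cat ifN; last first.
  by apply/hasPn => c'; rewrite mem_iota => ?; apply: h; lia.
rewrite size_iota (_ : n - c.-1 = (n - c).+1) /=; last by lia.
by rewrite (_ : 1 + c.-1 = c) ?Pc ?addn0 //; lia.
Qed.

Lemma set_nth_map_iota (h : nat -> seq nat) n c x : 0 < c <= n ->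
  set_nth [::] [seq h c' | c' <- iota 1 n] c.-1 x =
  [seq (if c' == c then x else h c') | c' <- iota 1 n].
Proof.
move=> hc; apply: (@eq_from_nth _ [::]).
  by rewrite size_set_nth !size_map size_iota; lia.
rewrite size_set_nth size_map size_iota => i hi.
have {}hi : i < n by lia.
rewrite nth_set_nth /= !(nth_map 0) ?size_iota // nth_iota //.
case: (eqVneq i c.-1) => [->|ne]; first by rewrite (_ : 1 + c.-1 = c) ?eqxx //; lia.
by rewrite (_ : (1 + i == c) = false) //; lia.
Qed.

(** The letters arrive in decreasing order. An admissible column to the left of the place of a
    carries, by greediness, a larger entry, which has already been placed and blocks that column. *)
Lemma place_row n fr i (l : seq nat) : chain n fr ->
  sorted gtn l -> (forall a, a \in l <-> a \in values n (fr i.+1)) ->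
  foldl (place i) [seq skyline fr i c | c <- iota 1 n] l =
  [seq skyline fr i.+1 c | c <- iota 1 n].
Proof.
move=> ch sl hl.
have [hb hg] := proj2 ch i.
(* The state of the loop once the letters [p] of the new row are in place. *)
pose st (p : seq nat) := [seq skyline fr i c ++ (if fr i.+1 c \in p then [:: fr i.+1 c] else [::])
   | c <- iota 1 n].
suff H p q : l = p ++ q -> foldl (place i) (st p) q = st l.
  have -> : [seq skyline fr i c | c <- iota 1 n] = st [::].
    by apply/eq_map => c; rewrite cats0.
  rewrite (H [::]) //; apply/eq_in_map => c; rewrite mem_iota => hc; rewrite skylineS.
  congr (_ ++ _); case: (posnP (fr i.+1 c)) => f0.
    by case: ifP => // /hl/mem_values[]; lia.
  by case: ifP => // /negP[]; apply/hl/values_mem => //; lia.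
elim: q p => [|a q IH] p e /=; first by rewrite e cats0.
have al : a \in l by rewrite e mem_cat inE eqxx orbT.
have [a0 [ca hca fa]] := mem_values (proj1 (hl a) al).
have ap : a \notin p.
  move: sl; rewrite e => s; apply/negP => h; move: (s).
  have tr : transitive gtn by apply: rev_trans; exact: ltn_trans.
  rewrite (sorted_pairwise tr) pairwise_cat => /andP[/allrelP/(_ a a h)].
  by rewrite inE eqxx => /(_ isT); rewrite /= ltnn.
rewrite -cat_rcons in e; rewrite -(IH (rcons p a) e); congr (foldl _ _ _).
have Pc c : 0 < c <= n ->
  ((size (skyline fr i c ++ (if fr i.+1 c \in p then [:: fr i.+1 c] else [::])) == i.+1) &&
     (if i == 0 then last 0 (skyline fr i c ++ (if fr i.+1 c \in p then [:: fr i.+1 c] else [::])) == a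
      else a <= last 0 (skyline fr i c ++ (if fr i.+1 c \in p then [:: fr i.+1 c] else [::])))) =
  [&& 0 < fr i c, fr i.+1 c \notin p & if i == 0 then c == a else a <= fr i c].
  move=> hc; case: (posnP (fr i c)) => f0.
    have g0 : fr i.+1 c = 0 by have := hb c; lia.
    have -> : fr i.+1 c \in p = false.
      by apply/negP => h; have /hl/mem_values[] : fr i.+1 c \in l; [rewrite e mem_cat mem_rcons inE h orbT|lia].
    by rewrite cats0 ltn_eqF // ltnS; apply: size_skyline_le.
  have [s1 s2] := skyline_full ch f0.
  case: ifP => _; first by rewrite size_cat s1 /= addn1 gtn_eqF.
  rewrite cats0 s1 s2 eqxx /=; case: eqP => // i0.
  by rewrite i0 (proj1 ch) /base_row; have -> : c <= n by lia.
rewrite /place /st find_map size_map size_iota.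
rewrite (@find_iota _ n ca hca) /=; first last.
- move=> c' hc'; rewrite Pc; last by lia.
  apply/negP => /and3P[f0 gp le].
  have lt : c' < ca by lia.
  case: (posnP i) le => [i0|i0] le; first by move: fa le hc'; rewrite i0 => /eqP fa /eqP; have := @chain_row1 n fr ca ch; lia.
  have le' : a <= fr i c' by [].
  have := hg c' ca lt; rewrite fa => /(_ a0 le') gt; case/negP: gp.
  have : fr i.+1 c' \in l by apply/hl/values_mem; lia.
  rewrite e mem_cat mem_rcons inE => /orP[/orP[/eqP|//]|h]; first by lia.
  move: sl; rewrite e cat_rcons (sorted_pairwise (rev_trans ltn_trans)) pairwise_cat /=.
  by case/and3P=> _ _ /andP[/allP/(_ _ h)]; lia.
- rewrite Pc // fa ap; have := hb ca; rewrite fa => le.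
  case: (posnP i) => [i0|i0]; last by lia.
  by subst i; have := chain_row1 ch (_ : 0 < fr 1 ca); rewrite fa => ->; rewrite ?eqxx; lia.
rewrite (_ : ca.-1 < n); last by lia.
rewrite set_nth_map_iota //; apply/eq_in_map => c; rewrite mem_iota => hc.
rewrite (nth_map 0) ?size_iota; last by lia.
rewrite nth_iota; last by lia.
rewrite (_ : 1 + ca.-1 = ca); last by lia.
rewrite mem_rcons inE; case: (eqVneq c ca) => [->|ne].
  by rewrite fa eqxx (negbTE ap) /= cats0 cats1.
case: (eqVneq (fr i.+1 c) a) => [fc|//].
have [cc|cc|] := ltngtP c ca; last by move/eqP; rewrite (negbTE ne).
  by have := hg _ _ cc; have := hb c; lia.
by have := hg _ _ cc; have := hb ca; lia.
Qed.

Lemma gtn_trans : transitive gtn.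
Proof. exact: (rev_trans ltn_trans). Qed.

Lemma col_map f T j : col (map (map f) T) j = map f (col T j).
Proof.
rewrite /col filter_map -!map_comp.
rewrite (eq_filter (a2 := fun R : seq nat => j < size R)); last first.
  by move=> R /=; rewrite size_map.
apply/eq_in_map => R; rewrite mem_filter => /andP[hj _] /=.
by rewrite (nth_map 0).
Qed.

Lemma transpose_map_compl n T : transpose (map (map (compl n)) T) =
  [seq revcol n T j | j <- iota 0 (size (head [::] T))].
Proof.
rewrite transposeE; have -> : size (head [::] (map (map (compl n)) T)) = size (head [::] T).
  by case: T => //= R T; rewrite size_map.
by apply: eq_map => j; rewrite col_map.
Qed.

Lemma rho_chain n fr T : all (all (letter n)) T -> tableau T -> chain_of n fr T ->
  rho n (map (map (compl n)) T) =
  [seq skyline fr (size (head [::] T)) c | c <- iota 1 n].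
Proof.
move=> lT tT [ch pv]; rewrite /rho transpose_map_compl size_map size_iota.
have -> : basement n = [seq skyline fr 0 c | c <- iota 1 n].
  apply/eq_in_map => c; rewrite mem_iota => hc.
  rewrite /skyline /= (proj1 ch) /base_row (_ : c <= n) /=; last by lia.
  by rewrite (_ : 0 < c) //; lia.
elim: (size (head [::] T)) => // m IH.
rewrite -[m.+1]addn1 iotaD map_cat zip_cat ?size_map ?size_iota // foldl_cat IH addn1 /=.
have sr := revcol_sorted m lT tT.
rewrite sorted_sort; first last.
- by apply: sub_sorted sr => x y /=; lia.
- exact: (rev_trans leq_trans).
by apply: place_row => // a; rewrite (perm_mem (pv m)).
Qed.

Lemma size_skyline n fr m c : chain n fr -> 0 < c <= n ->
  size (skyline fr m c) = (height fr m c).+1.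
Proof.
move=> ch hc; rewrite /skyline size_filter count_map /= /height /preim /=.
rewrite (proj1 ch) /base_row (_ : c <= n); last by lia.
by rewrite (_ : 0 < c) //; lia.
Qed.

Lemma col_oversize T j : tableau T -> size (head [::] T) <= j -> col T j = [::].
Proof.
case/tableauP=> _ _ h _; case: T h => // R T h hj.
by rewrite col_cons ltnNge hj /= (sorted_size_col0 h).
Qed.

Lemma chain_of_oversize n fr T i c : tableau T -> chain_of n fr T ->
  size (head [::] T) < i -> 0 < c <= n -> fr i c = 0.
Proof.
move=> tT [ch pv]; case: i => // i hi hc; case: (posnP (fr i.+1 c)) => // f0.
have := values_mem hc f0; rewrite (perm_mem (pv i)) /revcol col_oversize //.
Qed.

Lemma nth_skyline n fr T i c : tableau T -> chain_of n fr T -> 0 < c <= n ->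
  nth 0 (skyline fr (size (head [::] T)) c) i = fr i c.
Proof.
move=> tT cf hc; have [ch _] := cf; set m := size _.
case: (ltnP m i) => hi.
  rewrite (chain_of_oversize tT cf hi hc) nth_default //.
  rewrite /skyline size_filter (leq_trans (count_size _ _)) //.
  by rewrite size_map size_iota.
elim: m hi => [|m IH] hi.
  have -> : i = 0 by lia.
  have f0 : 0 < fr 0 c by rewrite (proj1 ch) /base_row; case: ifP; lia.
  by rewrite /skyline /= f0.
rewrite skylineS nth_cat; case: (posnP (fr m.+1 c)) => f0.
  rewrite nth_nil; case: (ltnP i m.+1) => im.
    case: ltnP => h; first by apply: IH; lia.
    by rewrite -IH ?nth_default //; lia.
  have -> : i = m.+1 by lia.
  case: ltnP => // h; rewrite f0; case: (posnP (fr m c)) => f1.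
    by have := size_skyline_le f1; lia.
  by rewrite (skyline_full ch f1).1 ltnn in h.
have fm : 0 < fr m c by have := @chain_le n fr m m.+1 c ch (leqnSn m); lia.
have [s1 _] := skyline_full ch fm; rewrite s1.
case: ltnP => im; first by apply: IH; lia.
by rewrite (_ : i = m.+1) ?subnn //; lia.
Qed.

Lemma eq_tableau_cols T1 T2 : tableau T1 -> tableau T2 ->
  (forall j, col T1 j = col T2 j) -> T1 = T2.
Proof.
move=> t1 t2 e.
have le S1 S2 : tableau S1 -> tableau S2 -> (forall j, col S1 j = col S2 j) ->
    size (head [::] S1) <= size (head [::] S2).
  move=> h1 h2 h; rewrite leqNgt; apply/negP => lt.
  have := h (size (head [::] S2)); rewrite [RHS]col_oversize //.
  by case: S1 lt {h1 h} => //= R S1 lt; rewrite col_cons lt.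
rewrite -(schensted_column_word t1) -(schensted_column_word t2).
congr schensted; rewrite /column_word !transposeE.
have -> : size (head [::] T1) = size (head [::] T2).
  by apply/eqP; rewrite eqn_leq !le.
by congr (flatten (map rev _)); apply: eq_map.
Qed.

(** The rows are read off the filling by [nth_skyline], and a row determines its tableau column
    because columns are strictly monotone. *)
Lemma rho_inj n fr1 fr2 T1 T2 :
  all (all (letter n)) T1 -> tableau T1 -> chain_of n fr1 T1 ->
  all (all (letter n)) T2 -> tableau T2 -> chain_of n fr2 T2 ->
  rho n (map (map (compl n)) T1) = rho n (map (map (compl n)) T2) -> T1 = T2.
Proof.
move=> l1 t1 c1 l2 t2 c2; rewrite (rho_chain l1 t1 c1) (rho_chain l2 t2 c2).
move/eq_in_map => e.
have ef i c : 0 < c <= n -> fr1 i c = fr2 i c.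
  move=> hc; rewrite -(nth_skyline i t1 c1 hc) -(nth_skyline i t2 c2 hc) e //.
  by rewrite mem_iota; lia.
apply: eq_tableau_cols => // j.
have pe : perm_eq (revcol n T1 j) (revcol n T2 j).
  have [_ /(_ j) p1] := c1; have [_ /(_ j) p2] := c2.
  rewrite -(permPl p1) -(permPr p2) /values.
  suff -> : [seq fr1 j.+1 c | c <- iota 1 n] = [seq fr2 j.+1 c | c <- iota 1 n] by [].
  by apply/eq_in_map => c; rewrite mem_iota => hc; apply: ef; lia.
have er : revcol n T1 j = revcol n T2 j.
  apply: (sorted_eq gtn_trans _ _ _ pe); try exact: revcol_sorted.
  by move=> x y /=; lia.
have K S : all (all (letter n)) S -> col S j = map (compl n) (revcol n S j).
  move=> lS; rewrite /revcol -map_comp -[LHS]map_id; apply/eq_in_map => x hx /=.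
  by rewrite complK //; apply: (allP (col_letter j lS)).
by rewrite (K T1) // (K T2) // er.
Qed.

Lemma sh_rho n fr T : all (all (letter n)) T -> tableau T -> chain_of n fr T ->
  sh (rho n (map (map (compl n)) T)) =
  [seq height fr (size (head [::] T)) c | c <- iota 1 n].
Proof.
move=> lT tT cf; rewrite (rho_chain lT tT cf) /sh -map_comp.
apply/eq_in_map => c; rewrite mem_iota => hc /=.
by rewrite (size_skyline _ (proj1 cf)) //; lia.
Qed.

(** * Insertion of a letter into a filling *)

(* A letter k enters the row u, lying above l, from the left; [carry l u k c] is
   the letter in hand in front of column c, 0 standing for none. *)
Fixpoint carry (l u : nat -> nat) (k c : nat) : nat :=
  if c is c'.+1 then
    let x := carry l u k c' in if u c' < x <= l c' then u c' else x
  else k.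

Definition pass (l u : nat -> nat) (k c : nat) : nat :=
  let x := carry l u k c in if u c < x <= l c then x else u c.

Lemma l_out n (l : nat -> nat) c :
  (forall c, l c <= base_row n c) -> n < c -> l c = 0.
Proof. by move=> ln h; have := ln c; rewrite /base_row; case: ifP; lia. Qed.

Section Carry.

Variables (l u : nat -> nat) (k : nat).

Lemma carryS c : (carry l u k c.+1) = if u c < (carry l u k c) <= l c then u c else (carry l u k c).
Proof. by []. Qed.

Lemma carry_anti c c' : c <= c' -> (carry l u k c') <= (carry l u k c).
Proof.
elim: c' => [|c' IH]; first by case: c.
rewrite leq_eqVlt => /orP[/eqP->//|/IH h]; rewrite carryS; case: ifP; lia.
Qed.

(** An intermediate value principle: if the letter in hand falls from above t to at most t, then at
    some column it was exchanged for an entry at most t. At such a column greediness will be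
    contradicted. *)
Lemma carry_cross t c c' : c <= c' -> (carry l u k c') <= t < (carry l u k c) ->
  exists c0, [/\ c <= c0 < c', t < (carry l u k c0) <= l c0, u c0 <= t & (carry l u k c0.+1) = u c0].
Proof.
elim: c' => [|c' IH] cc ht; first by move: cc ht; case: c => //; lia.
move: cc; rewrite leq_eqVlt => /orP[/eqP e|cc]; first by move: ht; rewrite e; lia.
rewrite ltnS in cc; have [h|h] := leqP ((carry l u k c')) t.
  have ht' : (carry l u k c') <= t < (carry l u k c) by lia.
  by have [c0 [h1 h2 h3 h4]] := IH cc ht'; exists c0; split=> //; lia.
exists c'; move: ht; rewrite carryS; case: ifP => h2 ht; split=> //; lia.
Qed.

Lemma carry_val c : (carry l u k c) = k \/ exists2 c0, c0 < c & (carry l u k c) = u c0 /\ u c0 < (carry l u k c0) <= l c0.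
Proof.
elim: c => [|c IH]; first by left.
rewrite carryS; case: ifP => h; first by right; exists c.
by case: IH => [|[c0 h1 h2]]; [left | right; exists c0 => //; lia].
Qed.

Variable (n : nat).
Hypothesis (ln : forall c, l c <= base_row n c).

Let z := (carry l u k n.+1).

Lemma carry_out c : z <= (carry l u k c).
Proof.
case: (leqP c n.+1) => h; first exact: carry_anti.
rewrite /z; elim: c h => // c IH h.
have -> : (carry l u k c.+1) = (carry l u k c) by rewrite carryS; case: ifP => //; have := @l_out n l c ln; lia.
by move: h; rewrite ltnS leq_eqVlt => /orP[/eqP<-|/IH].
Qed.

End Carry.

Section Pass.

Variables (l u : nat -> nat) (k : nat).
Hypothesis (gr : greedy l u).
Hypotheses (uI : forall c c', 0 < u c -> u c = u c' -> c = c').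
Hypothesis (ku : 0 < k -> forall c, u c != k).


Lemma pass_le c : pass l u k c <= l c.
Proof. by rewrite /pass; case: ifP => [/andP[]|_] //; apply: (proj1 gr). Qed.

Lemma pass_ge c : u c <= pass l u k c.
Proof. by rewrite /pass; case: ifP => [/andP[/ltnW]|_]. Qed.

(** Let a letter put down at c' also fit at c < c'. If the hand fits at c, it is put down there or a
    larger entry is kept; if it is too large at c, it shrinks later through an entry that greediness
    makes smaller than u c. *)
Lemma pass_greedy : greedy l (pass l u k).
Proof.
have [ub ug] := gr; split=> [|c c' cc]; first exact: pass_le.
have up := pass_ge c.
rewrite {1 2 3}/pass; case: ifP => [/andP[h1 h2] h0 h3|_ h0 h3]; last first.
  exact: leq_trans (ug _ _ cc h0 h3) up.
have a1 := carry_anti l u k (ltnW cc); have a2 := carry_anti l u k cc.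
have e := carryS l u k c.
rewrite /pass; case: ifP => h4; first by move: e; rewrite h4; lia.
have [h5|h5] := leqP ((carry l u k c)) (l c).
  have h6 : (carry l u k c) <= u c by lia.
  rewrite ltnNge; apply/negP => h7; have h8 : u c = (carry l u k c) by lia.
  case: (carry_val l u k c) => [h9|[c0 h9 [h10 h11]]].
    by have := ku; rewrite -h9 => /(_ _ c); rewrite h8 eqxx => /(_ ltac:(lia)).
  by have := @uI c c0; rewrite h8 h10; lia.
have [|c0 [h6 h7 h8 h9]] := @carry_cross l u k (l c) c c' (ltnW cc); first by lia.
have cc0 : c < c0.
  by rewrite ltn_neqAle; apply/andP; split; [apply/eqP => e0; subst c0|]; lia.
have := carry_anti l u k (_ : c0.+1 <= c'); rewrite h9 => /(_ ltac:(lia)) h10.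
by have := ug _ _ cc0; lia.
Qed.

Variable (n : nat).
Hypothesis (ln : forall c, l c <= base_row n c).

Let z := carry l u k n.+1.

(** A letter z of [l] at column c could not leave: in hand at c it would be put down over itself,
    and picked up further right it would violate greediness at c. Hence z is new to the row [l],
    which it enters next. *)
Lemma out_notin : 0 < z -> forall c, l c != z.
Proof.
move=> z0 c; apply/eqP => e; have [ub ug] := gr.
have cn : c <= n by case: leqP => // h; have := l_out ln h; lia.
have zc := carry_out u k ln c; have zc1 := carry_out u k ln c.+1; have eS := carryS l u k c.
have [h|h] := leqP ((carry l u k c)) z.
  have qz : (carry l u k c) = z by lia.
  have uz : u c = z by have := ub c; move: eS; case: ifP; lia.
  case: (carry_val l u k c) => [h9|[c0 h9 [h10 h11]]].
    by have := ku; rewrite -h9 => /(_ _ c); rewrite uz qz eqxx => /(_ z0).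
  by have := @uI c c0; rewrite uz -h10 qz; lia.
have [|c0 [h1 h2 h3 h4]] := @carry_cross l u k z c n.+1 (leqW cn); first by rewrite -/z; lia.
have zc0 := carry_out u k ln c0.+1; rewrite h4 in zc0.
have cc0 : c < c0.
  by rewrite ltn_neqAle; apply/andP; split; [apply/eqP => e0; subst c0|]; lia.
by have := ug _ _ cc0; have := ub c; lia.
Qed.

(** This makes the outgoing z extremal: counted over all columns, the new upper row has at least as
    many entries >= z as [l], so together with z it had too many. A hand that is too large at c
    comes under l c only through an entry, at least z, that greediness makes smaller than u c. *)
Lemma pass_violation c : 0 < z -> z <= l c -> z <= pass l u k c.
Proof.
move=> z0 zl; have [ub ug] := gr.
have cn : c <= n by case: leqP => // h; have := l_out ln h; lia.
have zc := carry_out u k ln c; have := pass_ge c; rewrite /pass.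
case: ifP => // h _; have [h1|h1] := leqP ((carry l u k c)) (l c); first by lia.
have [|c0 [h2 h3 h4 h5]] := @carry_cross l u k (l c) c n.+1 (leqW cn); first by rewrite -/z; lia.
have zc0 := carry_out u k ln c0.+1; rewrite h5 in zc0.
have cc0 : c < c0.
  by rewrite ltn_neqAle; apply/andP; split; [apply/eqP => e0; subst c0|]; lia.
by have := ug _ _ cc0; lia.
Qed.

Definition row_count (g : nat -> nat) (a : nat) := count (fun c => a <= g c) (iota 1 n).

Lemma pass_count a : 0 < a ->
  row_count (pass l u k) a + (a <= z) = row_count u a + (a <= k).
Proof.
move=> a0.
have H m : count (fun c => a <= pass l u k c) (iota 0 m) + (a <= (carry l u k m)) =
  count (fun c => a <= u c) (iota 0 m) + (a <= k).
  elim: m => [|m IH] //; rewrite -[m.+1]addn1 iotaD !count_cat addn1 carryS /= !add0n.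
  by move: IH; rewrite /pass; case: ifP => h; lia.
have p0 : pass l u k 0 = 0 by have := pass_le 0; have := ln 0; rewrite /base_row /=; lia.
have u0 : u 0 = 0 by have := pass_ge 0; lia.
have := H n.+1; rewrite -[iota 0 n.+1]/([:: 0] ++ iota 1 n) !count_cat -/z.
by rewrite /row_count [count _ [:: 0]]/= [X in _ = X + _ + _]/= p0 u0; lia.
Qed.

End Pass.

(** Over the old row [l] this is [pass_greedy]; a failure needs a letter t newly put into [l] at c.
    As t <= z and z has left the upper row, the entry at c' is an old one, smaller than z, and the
    hand was too large for l c'. Every position of z and l2 c relative to l c' then contradicts
    greediness of an old row. *)
Lemma pass_greedy2 n l2 l u k : (forall c, l2 c <= base_row n c) ->
  greedy l2 l -> greedy l u ->
  (forall c c', 0 < u c -> u c = u c' -> c = c') ->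
  (0 < k -> forall c, u c != k) ->
  greedy (pass l2 l (carry l u k n.+1)) (pass l u k).
Proof.
move=> l2n g2 g1 uI ku; set z := carry l u k n.+1.
have ln c : l c <= base_row n c by apply: leq_trans (l2n c); apply: (proj1 g2).
have [pb pg] := pass_greedy g1 uI ku.
have lle c := pass_ge l2 l z c; have [lb lg] := g2; have [ub ug] := g1.
split=> [c|c c' cc a0 al]; first exact: leq_trans (pb c) (lle c).
have [h|h] := leqP (pass l u k c') (l c); first exact: pg.
exfalso; move: al; rewrite {2}/pass; set t := carry l2 l z c.
case: ifP => [/andP[h1 h2] h3|_]; last by lia.
have tz : t <= z by apply: (@carry_anti l2 l z 0).
have al := pb c'.
have cn : c' <= n by case: leqP => // h'; have := l_out ln h'; lia.
have zc := carry_out u k ln c'; have zc1 := carry_out u k ln c'.+1.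
rewrite -/z in zc zc1.
have eS := carryS l u k c'; rewrite /= in eS zc1.
move: a0 h h3 al; rewrite /pass; case: ifP => h5; first by move: zc1; rewrite h5; lia.
move=> a0 h h3 al.
have ne : u c' <> z.
  move=> e; case: (carry_val l u k n.+1) => [h9|[c0 h9 [h10 h11]]].
    by have := ku; rewrite -h9 -/z => /(_ ltac:(lia) c'); rewrite e eqxx.
  by have := @uI c' c0 a0; rewrite e -h10 => /(_ erefl) e'; subst c0; rewrite h11 in h5.
have h6 : l c' < carry l u k c' by lia.
have [h7|h7] := leqP z (l c').
  have [|c0 [h8 h9 h10 h11]] := @carry_cross l u k (l c') c' n.+1 (leqW cn).
    by rewrite -/z; lia.
  have zc0 := carry_out u k ln c0.+1; rewrite h11 -/z in zc0.
  have cc0 : c' < c0.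
    by rewrite ltn_neqAle; apply/andP; split; [apply/eqP => e0; subst c0|]; lia.
  by have := ug _ _ cc0; lia.
have [h8|h8] := leqP (l c') (l2 c); first by have := lg _ _ cc; lia.
(* Here t <= l2 c < l c' < z, so the hand in the row [l] crossed the value l c' to the left of c. *)
have [|c0 [h9 h10 h11 h12]] := @carry_cross l2 l z (l c') 0 c (leq0n c).
  by rewrite -/t /=; lia.
have cc0 : c0 < c' by lia.
by have := lg _ _ cc0; lia.
Qed.

(** * Column counts under row insertion *)

Definition col_count (T : seq (seq nat)) (j t : nat) := count (fun y => y <= t) (col T j).

Lemma col_count_cons R T j t :
  col_count (R :: T) j t = ((j < size R) && (nth 0 R j <= t)) + col_count T j t.
Proof. by rewrite /col_count col_cons; case: ifP. Qed.

Lemma col_count_le T j t : tableau T -> 0 < j -> col_count T j t <= col_count T j.-1 t.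
Proof.
elim: T => // R T IH; rewrite tableau_cons => /and4P[sR _ _ tT] j0.
rewrite !col_count_cons; apply: leq_add; last exact: IH.
case: (ltnP j (size R)) => //= hj; rewrite (_ : j.-1 < size R) /=; last by lia.
have : nth 0 R j.-1 <= nth 0 R j.
  by apply: (sorted_leq_nth leq_trans leqnn 0 sR); rewrite ?inE; lia.
by case: leqP => //=; case: leqP => //; lia.
Qed.

(* Row insertion seen on columns, from right to left: [q j.+1] enters column j
   and [q j] leaves it, M standing for no letter. *)
Lemma insert_columns M T x : tableau T -> all (all (fun y => y < M)) T -> x < M ->
  exists q : nat -> nat,
  [/\ forall j, find (fun y => x < y) (head [::] T) < j -> q j = x,
      q 0 = M, forall j, x <= q j <= M,
      forall j t, t < M -> col_count (insert T x) j t + (q j <= t) =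
                           col_count T j t + (q j.+1 <= t)
    & forall j, 0 < j ->
      (forall t, t < M -> col_count (insert T x) j t <= col_count T j.-1 t) /\
      (q j < M -> col_count T j.-1 (q j) < col_count T j (q j) + (q j.+1 <= q j))].
Proof.
elim: T x => [|R T IH] x.
  move=> _ _ xM; exists (fun j => if j is 0 then M else x); split=> //.
  - by case.
  - by case=> [|j]; lia.
  - move=> [|j] t tM; rewrite /col_count /col /=; last by lia.
    by rewrite [M <= t]leqNgt tM; lia.
  - move=> [|j] // _; split=> [t tM|_]; rewrite /col_count /col //=.
    by rewrite leqnn.
rewrite tableau_cons => /and4P[sR nR hRT tT] /andP[lR lT] xM.
rewrite insert_cons [head _ _]/=.
have [p1 p2 p3] := find_gtP R x; set p := find _ R in p1 p2 p3 *.
have right j t : p <= j -> t <= x -> (j < size R) && (nth 0 R j <= t) = false.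
  move=> pj tx; case: (ltnP j (size R)) => //= hj.
  have h : nth 0 R p <= nth 0 R j.
    by apply: (sorted_leq_nth leq_trans leqnn 0 sR); rewrite ?inE; lia.
  have h3 : x < nth 0 R p by apply: p3; lia.
  by apply/negbTE; lia.
have right0 j : p <= j -> col_count (R :: T) j x = 0.
  move=> pj; rewrite col_count_cons right //=.
  apply/eqP; rewrite -leqn0 leqNgt -has_count; apply/hasPn => y /mem_colP[i [hi <-]].
  have tRT : tableau (R :: T) by rewrite tableau_cons sR nR hRT.
  have [h1 h2] := @tableau_col_lt (R :: T) 0 i.+1 j tRT (ltn0Sn _) hi.
  by have := right j x pj (leqnn x); rewrite /cell_at /= in h1 h2 *; rewrite h1 /=; lia.
have inS j t : (j < size (row_insert R x)) && (nth 0 (row_insert R x) j <= t) =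
    if j == p then x <= t else (j < size R) && (nth 0 R j <= t).
  rewrite row_insert_size row_insert_nth -/p; case: (eqVneq j p) => [->|jp].
    by case: ifP => [->|] //; rewrite (_ : p < (size R).+1) //; lia.
  by congr (_ && _); case: ifP; lia.
have dom j t : 0 < j -> ((j < size (row_insert R x)) && (nth 0 (row_insert R x) j <= t)) <=
    ((j.-1 < size R) && (nth 0 R j.-1 <= t)).
  move=> j0; rewrite inS; case: (eqVneq j p) => [jp|jp].
    have h : nth 0 R j.-1 <= x by apply: p2; lia.
    rewrite (_ : j.-1 < size R) /=; last by lia.
    by case: (leqP x t) => // xt; rewrite (_ : nth 0 R j.-1 <= t) //; lia.
  case: (ltnP j (size R)) => //= hj; rewrite (_ : j.-1 < size R) /=; last by lia.
  have h : nth 0 R j.-1 <= nth 0 R j.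
    by apply: (sorted_leq_nth leq_trans leqnn 0 sR); rewrite ?inE; lia.
  by case: (leqP (nth 0 R j) t) => // ht; rewrite (_ : nth 0 R j.-1 <= t) //; lia.
have [pR|pR] := ltnP p (size R).
  set y := nth 0 R p; have eb : bumped R x = [:: y] by rewrite /bumped -/p pR.
  have yM : y < M by apply: (allP lR); apply: mem_nth.
  have [q [qx q0 qb qc qd]] := IH y tT lT yM.
  have hp : find (fun z => y < z) (head [::] T) <= p.
    case: (T) hRT => //= S T' /aboveP[h1 h2]; have [f1 f2 f3] := find_gtP S y.
    case: leqP => // h; have := f2 _ h; have := h2 p; rewrite -/y; lia.
  have xy : x < y := p3 pR.
  (* Columns to the right of [p] are untouched and x is still in hand. In column [p] the letter y
     moves from the bottom row into the other rows, whose insertion supplies the letters from there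
     to the left. *)
  exists (fun j => if p < j then x else q j); split.
  - by move=> j ->.
  - by [].
  - by move=> j; have := qb j; case: ifP; lia.
  - move=> j t tM; rewrite eb /= !col_count_cons inS; have := qc j t tM.
    case: (eqVneq j p) => [->|jp].
      by rewrite ltnn ltnSn pR /= -/y (qx p.+1) ?ltnS //; linear_counts.
    case: (ltnP p j) => pj.
      by rewrite (qx j (leq_ltn_trans hp pj)) (qx j.+1 (leq_ltn_trans hp (leqW pj))) (leqW pj);
        linear_counts.
    have -> : (p < j.+1) = false by clear -pj jp; lia.
    by linear_counts.
  move=> j j0; have [d1 d2] := qd j j0; split=> [t tM|].
    by rewrite eb /= !col_count_cons; apply: leq_add; [exact: dom|exact: d1].
  case: ifP => pj qM.
    by rewrite right0 ?(leqW pj) ?leqnn ?addn1 //; clear -pj; lia.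
  have := d2 qM; rewrite !col_count_cons; set t := q j.
  have yt : y <= t by have := qb j; lia.
  have -> : (j < size R) && (nth 0 R j <= t) = true.
    have h : nth 0 R j <= y.
      by apply: (sorted_leq_nth leq_trans leqnn 0 sR); rewrite ?inE; lia.
    by apply/andP; split; lia.
  have : (q j.+1 <= t) <= ((if p < j.+1 then x else q j.+1) <= t).
    by case: ifP => // _; rewrite (_ : x <= t) ?leq_b1 //; clear -xy yt; lia.
  have := leq_b1 ((j.-1 < size R) && (nth 0 R j.-1 <= t)).
  by rewrite [nat_of_bool true]/=; linear_counts.
have eb : bumped R x = [::] by rewrite /bumped -/p ltnNge pR.
(* x settles at the end of the bottom row, in column [p], which no letter leaves. *)
exists (fun j => if p < j then x else M); split.
- by move=> j ->.
- by [].
- by move=> j; case: ifP; lia.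
- move=> j t tM; rewrite eb /= !col_count_cons inS.
  case: (eqVneq j p) => [->|jp]; first rewrite ltnn ltnSn.
    have -> : (p < size R) = false by clear -pR; lia.
    have -> : (M <= t) = false by clear -tM; lia.
    by linear_counts.
  case: (ltnP p j) => pj; first by rewrite (leqW pj); linear_counts.
  have -> : (p < j.+1) = false by clear -pj jp; lia.
  have -> : (M <= t) = false by clear -tM; lia.
  by linear_counts.
move=> j j0; split=> [t tM|].
  rewrite eb /= !col_count_cons; apply: leq_add; first exact: dom.
  exact: col_count_le.
case: ifP => pj qM; last by lia.
by rewrite right0 ?(leqW pj) ?leqnn ?addn1 //; clear -pj; lia.
Qed.

Lemma uniq_map_in_inj (T1 T2 : eqType) (f : T1 -> T2) s :
  uniq (map f s) -> {in s &, injective f}.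
Proof.
elim: s => // x s IH /= /andP[h /IH inj] a b; rewrite !inE.
case/orP=> [/eqP->|ha] /orP[/eqP->|hb] // e; last exact: inj.
- by case/negP: h; rewrite e map_f.
- by case/negP: h; rewrite -e map_f.
Qed.

Lemma values_inj n f g c c' : (forall c, f c <= base_row n c) -> (forall c, g c <= f c) ->
  uniq (values n g) -> 0 < g c -> g c = g c' -> c = c'.
Proof.
move=> fn gf u gc e.
have inn d : 0 < g d -> 0 < d <= n.
  by move=> h; have := gf d; have := fn d; rewrite /base_row; case: ifP; lia.
have hc := inn c gc; have hc' : 0 < c' <= n by apply: inn; rewrite -e.
move: u; rewrite /values filter_map => /uniq_map_in_inj; apply => //.
  by rewrite mem_filter mem_iota /= gc; lia.
by rewrite mem_filter mem_iota /= -e gc; lia.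
Qed.

Lemma row_count_values n g a : 0 < a ->
  row_count n g a = count (fun y => a <= y) (values n g).
Proof.
move=> a0; rewrite /row_count /values count_filter count_map.
by apply: eq_count => c /=; case: leqP => //= h; lia.
Qed.

Lemma letter_pos n a : letter n a -> 0 < a. Proof. by case/andP. Qed.

Lemma revcol_count n T j a : all (all (letter n)) T -> letter n a ->
  count (fun y => a <= y) (revcol n T j) = col_count T j (compl n a).
Proof.
move=> lT la; rewrite /revcol count_map /col_count; apply: eq_in_count => y hy /=.
have := allP (col_letter j lT) y hy; move: la; rewrite /letter /compl; lia.
Qed.

Lemma perm_eq_counts n (s1 s2 : seq nat) :
  all (letter n) s1 -> all (letter n) s2 ->
  (forall a, letter n a -> count (fun y => a <= y) s1 = count (fun y => a <= y) s2) ->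
  perm_eq s1 s2.
Proof.
move=> l1 l2 h.
have cs s a : count (fun y => a <= y) s = count_mem a s + count (fun y => a < y) s.
  by elim: s => //= y s ->; lia.
have h' a : 0 < a -> count (fun y => a <= y) s1 = count (fun y => a <= y) s2.
  move=> a0; case: (leqP a n) => an; first by apply: h; rewrite /letter a0.
  have z s : all (letter n) s -> count (fun y => a <= y) s = 0.
    move=> ls; apply/eqP; rewrite -leqn0 leqNgt -has_count; apply/hasPn => y /(allP ls).
    by rewrite /letter; lia.
  by rewrite !z.
apply/allP => a; rewrite mem_cat => ha.
have a0 : 0 < a by case/orP: ha => [/(allP l1)|/(allP l2)] /andP[].
by have := h' a a0; rewrite (cs s1) (cs s2) (h' a.+1 isT) => /addIn e; rewrite /= e.
Qed.

(** Row-wise form of sh_r < sh_(r+1): the two agree because the columns of a chain have no gaps. *)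
Definition separated (fr : nat -> nat -> nat) (r : nat) : Prop :=
  exists i, fr i r = 0 /\ 0 < fr i r.+1.

(** * The chain of a word multiplied by a letter on the left *)

Section Insertion.

Variables (n : nat) (fr : nat -> nat -> nat) (T : seq (seq nat)) (x : nat).
Hypotheses (tT : tableau T) (lT : all (all (letter n)) T) (cf : chain_of n fr T).
Hypothesis (lx : letter n x).

Let m := (size (head [::] T)).+1.

(** The recursion descends from the empty row [m], with [d] the distance from it; below, [k i] is
    the letter that enters row i. The upper row index is (m - d) + 1 in disguise. *)
Fixpoint carry_from (d : nat) : nat :=
  if d is d'.+1 then carry (fr (m - d)) (fr (m - d').-1.+1) (carry_from d') n.+1 else x.

Let k i := carry_from (m - i).

Definition inserted_rows (i : nat) : nat -> nat :=
  if i is i'.+1 then pass (fr i') (fr i) (k i) else fr 0.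

Let ch : chain n fr := proj1 cf.
Let frn i c : fr i c <= base_row n c := chain_base i c ch.

Lemma fr_oversize i c : m <= i -> fr i c = 0.
Proof.
move=> mi; have [h|h] := boolP (0 < c <= n); first exact: (chain_of_oversize tT cf).
by have := frn i c; rewrite /base_row; case: ifP; lia.
Qed.

Lemma k_top i : m <= i -> k i = x.
Proof. by move=> mi; rewrite /k (_ : m - i = 0) //; lia. Qed.

Lemma kS i : k i = carry (fr i) (fr i.+1) (k i.+1) n.+1.
Proof.
case: (ltnP i m) => im.
  rewrite /k (_ : m - i = (m - i.+1).+1) /=; last by lia.
  rewrite (_ : m - (m - i.+1).+1 = i); last by lia.
  by rewrite (_ : (m - (m - i.+1)).-1 = i) //; lia.
rewrite !k_top //; last by lia.
elim: n.+1 => //= c <-; rewrite !fr_oversize //; last by lia.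
by case: ifP => // /andP[]; lia.
Qed.

Lemma k_le i : k i <= x.
Proof.
have [d e] : exists d, m <= i + d by exists m; lia.
elim: d i e => [|d IH] i e; first by rewrite k_top //; lia.
rewrite kS; apply: leq_trans (IH i.+1 _); last by lia.
exact: (@carry_anti (fr i) (fr i.+1) (k i.+1) 0).
Qed.

Lemma rows_inj i c c' : 0 < fr i.+1 c -> fr i.+1 c = fr i.+1 c' -> c = c'.
Proof.
apply: (@values_inj n (fr i)); first exact: frn.
  exact: (proj1 (proj2 ch i)).
by rewrite (perm_uniq (proj2 cf i)) (sorted_uniq gtn_trans) ?revcol_sorted // => y /=; rewrite ltnn.
Qed.

Lemma k_notin i : 0 < k i.+1 -> forall c, fr i.+1 c != k i.+1.
Proof.
have [d e] : exists d, m <= i + d by exists m; lia.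
elim: d i e => [|d IH] i e k0 c; first by rewrite fr_oversize ?ltn_eqF //; lia.
case: (leqP m i.+1) => mi; first by rewrite fr_oversize ?ltn_eqF.
have k0' := k0; rewrite kS in k0' *.
apply: (out_notin (proj2 ch i.+1) (@rows_inj i.+1) _ (frn i.+1) k0').
by apply: IH; lia.
Qed.

(** A nonzero letter arriving at the basement would differ from all of 1, ..., n by [out_notin],
    although it is at most x. *)
Lemma k0_eq0 : k 0 = 0.
Proof.
case: (posnP (k 0)) => // h; exfalso.
have h' := h; rewrite kS in h'.
have := out_notin (proj2 ch 0) (@rows_inj 0) (@k_notin 0) (frn 0) h'.
move=> /(_ (k 0)); rewrite -kS (proj1 ch) /base_row (leq_trans (k_le 0)) ?eqxx //.
by case/andP: lx.
Qed.

Lemma inserted_chain : chain n inserted_rows.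
Proof.
split=> [c|[|i]]; first exact: (proj1 ch).
  exact: (pass_greedy (proj2 ch 0) (@rows_inj 0) (@k_notin 0)).
rewrite /= (kS i.+1).
exact: (pass_greedy2 (frn i) (proj2 ch i) (proj2 ch i.+1) (@rows_inj i.+1) (@k_notin i.+1)).
Qed.

Lemma inserted_count i a : 0 < a ->
  row_count n (inserted_rows i.+1) a + (a <= k i) =
  row_count n (fr i.+1) a + (a <= k i.+1).
Proof.
move=> a0; rewrite (kS i).
exact: (pass_count (proj2 ch i) (@k_notin i) (frn i) a0).
Qed.

(** With [inserted_count] and [inserted_violation] this determines k i as the largest threshold at
    which row i+1, with its incoming letter, exceeds row i. The last clause of [insert_columns] says
    the same, for i > 0, of the complement of [q i]. *)
Lemma inserted_dom i a : row_count n (inserted_rows i.+1) a <= row_count n (fr i) a.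
Proof.
apply: sub_count => c /= h; apply: leq_trans h _.
exact: (pass_le _ (proj2 ch i)).
Qed.

Lemma inserted_violation i : 0 < k i ->
  row_count n (fr i) (k i) <= row_count n (inserted_rows i.+1) (k i).
Proof.
move=> k0; apply: sub_count => c /= h.
by have := @pass_violation _ _ _ (proj2 ch i) (@k_notin i) _ (frn i) c; rewrite -kS; apply.
Qed.

(** Let b be the top of column r+1. The entry under the empty place of column r beside it is smaller
    than b, whereas a hand that could settle there entered the row larger than b. It would have to
    drop below b further left, over an entry at least b, where greediness requires an upper entry
    larger than b. *)
Lemma inserted_separated r : separated fr r -> separated inserted_rows r.
Proof.
case=> i0 [r0 s0].
have [i [f1 f2 f3]] : exists i, [/\ fr i r = 0, 0 < fr i r.+1 & fr i.+1 r.+1 = 0].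
  have [d e] : exists d, m <= i0 + d by exists m; lia.
  elim: d i0 e r0 s0 => [|d IH] i0 e r0 s0; first by move: s0; rewrite fr_oversize //; lia.
  case: (posnP (fr i0.+1 r.+1)) => h; first by exists i0.
  apply: (IH i0.+1) => //; first by lia.
  by have := @chain_le n fr i0 i0.+1 r ch (leqnSn _); lia.
case: i f1 f2 f3 => [|i] f1 f2 f3; first by exists 0.
exists i.+1; split; last by apply: leq_trans f2 _; apply: pass_ge.
have [b1 g1] := proj2 ch i; have [b2 g2] := proj2 ch i.+1.
rewrite /inserted_rows /pass f1; case: ifP => // /andP[e0 el].
set e := carry _ _ _ r in e0 el.
have gl := g1 r r.+1 (ltnSn r) f2.
have b_gt : fr i r < fr i.+1 r.+1 by rewrite ltnNge; apply/negP => /gl; lia.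
(* The place above b is empty: in the row above, a hand at most b would have settled there, and a
   letter at most b picked up further right would contradict greediness. *)
have zb : fr i.+1 r.+1 < k i.+1.
  have zk := carry_out (fr i.+2) (k i.+2) (frn i.+1); rewrite -(kS i.+1) in zk.
  have ez : e <= k i.+1 by apply: (@carry_anti (fr i) (fr i.+1) (k i.+1) 0).
  have := carryS (fr i.+1) (fr i.+2) (k i.+2) r.+1; have z1 := zk r.+1; have z2 := zk r.+2.
  rewrite f3; case: ifP => h1 h2; first by lia.
  rewrite ltnNge; apply/negP => h3.
  have rn : r.+1 <= n.+1.
    by have := frn i.+1 r.+1; rewrite /base_row; case: ifP; lia.
  have [|c0 [h4 h5 h6 h7]] := @carry_cross (fr i.+1) (fr i.+2) (k i.+2) (fr i.+1 r.+1) r.+1 n.+1 rn.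
    by rewrite -(kS i.+1); lia.
  have z3 := zk c0.+1; rewrite h7 in z3.
  have [c0r|c0r] := leqP c0 r.+1; first by (have ec : c0 = r.+1 by lia); subst c0; lia.
  by have := g2 _ _ c0r; lia.
have [|c0 [h4 h5 h6 h7]] := @carry_cross (fr i) (fr i.+1) (k i.+1) (fr i.+1 r.+1) 0 r (leq0n r).
  by rewrite -/e /=; lia.
by have := g1 c0 r.+1; lia.
Qed.

Lemma inserted_chain_of :
  chain_of n inserted_rows (insert T (compl n x)).
Proof.
split; first exact: inserted_chain.
have lT1 : all (all (fun y => y < n.+1)) T.
  by apply: sub_all lT => R; apply: sub_all => y; rewrite /letter; lia.
have xM : compl n x < n.+1 by move: lx; rewrite /letter /compl; lia.
have [q [qx q0 qb qc qd]] := insert_columns tT lT1 xM.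
have lT' : all (all (letter n)) (insert T (compl n x)).
  by apply: all_insert => //; apply: compl_letter.
have rc i a : letter n a -> row_count n (fr i.+1) a = col_count T i (compl n a).
  move=> la; rewrite row_count_values ?(letter_pos la) // -revcol_count //.
  exact/permP/(proj2 cf).
have ka i a : letter n a -> (q i <= compl n a) = (a <= compl n (q i)).
  by have := qb i; rewrite /letter /compl; lia.
(* Descending induction from the top, where both letters are x. If they differed, the larger one
   would be an exceeded threshold in one process while the other process guarantees that it is not
   exceeded. *)
have kq i : k i = compl n (q i).
  have [d e] : exists d, m <= i + d by exists m; lia.
  elim: d i e => [|d IH] i e.
    rewrite k_top; last by lia.
    rewrite qx ?complK //; apply: leq_ltn_trans (find_size _ _) _.
    by rewrite /m in e; lia.
  have {IH} IH := IH i.+1 ltac:(lia).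
  (* At the basement the two encodings of no letter meet: k 0 = 0 and q 0 = n + 1. *)
  case: i e IH => [|i] e IH; first by rewrite k0_eq0 q0 /compl subnn.
  have [d1 d2] := qd i.+1 isT.
  have [h|h|//] := ltngtP (k i.+1) (compl n (q i.+1)).
    have la : letter n (compl n (q i.+1)).
      by have := qb i.+1; move: lx h; rewrite /letter /compl; lia.
    have cq : compl n (compl n (q i.+1)) = q i.+1.
      by have := qb i.+1; move: lx h; rewrite /letter /compl; lia.
    have qM : q i.+1 < n.+1 by move: h; rewrite /compl; lia.
    have := d2 qM; rewrite /= -{1 2 4}cq -!rc // -{3}cq ka // -IH.
    have := inserted_count i.+1 (letter_pos la).
    have := inserted_dom i.+1 (compl n (q i.+1)).
    have -> : (compl n (q i.+1) <= k i.+1) = false by clear -h; lia.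
    by rewrite [nat_of_bool false]/=; linear_counts.
  have la : letter n (k i.+1) by have := k_le i.+1; move: lx h; rewrite /letter; lia.
  have c1 := d1 (compl n (k i.+1)) ltac:(move: la; rewrite /letter /compl; lia).
  have := qc i.+1 (compl n (k i.+1)) ltac:(move: la; rewrite /letter /compl; lia).
  rewrite !ka // -rc // -IH.
  have := inserted_count i.+1 (letter_pos la).
  have := inserted_violation (letter_pos la).
  have -> : (k i.+1 <= compl n (q i.+1)) = false by clear -h; lia.
  move: c1; rewrite -rc // leqnn /=.
  by linear_counts.
move=> i; apply: (@perm_eq_counts n).
- apply/allP => y /mem_values[y0 [c hc e]]; rewrite /letter y0 /= -e.
  by have := chain_base i.+1 c inserted_chain; rewrite /base_row; case: ifP; lia.
- apply/allP => y /mapP[y0 hy ->]; apply: compl_letter.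
  exact: (allP (col_letter i lT')).
move=> a la; rewrite -row_count_values ?(letter_pos la) // revcol_count //.
have aM : compl n a < n.+1 by move: la; rewrite /letter /compl; lia.
have := qc i _ aM; rewrite !ka // -!kq -rc //.
by have := inserted_count i (letter_pos la); linear_counts.
Qed.

End Insertion.

(** * Changing unmatched letters in a filling *)

Definition transp (r x : nat) : nat :=
  if x == r then r.+1 else if x == r.+1 then r else x.

Lemma transp_r r : transp r r = r.+1.
Proof. by rewrite /transp eqxx. Qed.

Lemma transp_s r : transp r r.+1 = r.
Proof. by rewrite /transp eqxx gtn_eqF. Qed.

Lemma transp_id r x : x <> r -> x <> r.+1 -> transp r x = x.
Proof. by move=> h1 h2; rewrite /transp; case: eqP => // _; case: eqP. Qed.

Lemma transpP r x : [\/ x = r /\ transp r x = r.+1, x = r.+1 /\ transp r x = r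
  | [/\ x <> r, x <> r.+1 & transp r x = x]].
Proof.
rewrite /transp; case: eqP => [->|h]; first by constructor 1.
by case: eqP => [->|h']; [constructor 2|constructor 3].
Qed.

Lemma transpK r : involutive (transp r).
Proof.
move=> x; have [[-> ->]|[-> ->]|[_ _ e]] := transpP r x; last by rewrite !e.
  exact: transp_s.
exact: transp_r.
Qed.

(** Only the threshold r+1 separates r from r+1; a row without r+1 does not notice an exchange of
    values below it. *)
Lemma leq_transp r a y : a <> r.+1 -> (a <= transp r y) = (a <= y).
Proof. by have [[-> ->]|[-> ->]|[_ _ ->]] := transpP r y; lia. Qed.

Lemma transp_letter n r x : 0 < r < n -> (0 < transp r x <= n) = (0 < x <= n).
Proof. by have [[-> ->]|[-> ->]|[_ _ ->]] := transpP r x; lia. Qed.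

(** Only the order of the columns r and r+1 changes. The second case arises when the entry of column
    r also fits over column r+1 and is not smaller than the entry there: with the lower places
    exchanged, the left column takes it again and [g] stays as it is. *)
Lemma greedy_swap r f g : greedy f g ->
  greedy (f \o transp r) (g \o transp r) \/
  (greedy (f \o transp r) g /\ g r.+1 < g r).
Proof.
case=> b h.
have [/andP[c1 /andP[c2 c3]]|nc] := boolP [&& 0 < g r, g r <= f r.+1 & g r.+1 <= g r].
  have lt : g r.+1 < g r.
    case: (posnP (g r.+1)) => [->//|p]; apply: (h _ _ (ltnSn r)) => //.
    by apply: leq_trans c3 (b r).
  right; split=> //; split=> [c|c c' cc a0] /=.
    have := b c; have [[-> ->]|[-> ->]|[_ _ ->]] := transpP r c => //.
    by have := b r; lia.
  have [[ec ->]|[ec ->]|[n1 n2 ->]] := transpP r c; try subst c.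
  - case: (eqVneq c' r.+1) => [-> //|ne] le.
    have cc' : r.+1 < c' by lia.
    by have := h _ _ cc' a0 le; lia.
  - move=> le; have rc : r < c' by lia.
    by have h1 := h _ _ rc a0 le; apply: h => //; lia.
  by apply: h.
left; split=> [c|c c' cc] /=; first exact: b.
have [[ec ->]|[ec ->]|[n1 n2 ->]] := transpP r c;
  have [[ec' ->]|[ec' ->]|[n1' n2' ->]] := transpP r c'; try lia; try (by apply: h; lia).
Qed.

Lemma mem_valuesP n g a : (forall c, g c <= base_row n c) -> 0 < a ->
  reflect (exists c, g c = a) (a \in values n g).
Proof.
move=> gn a0; apply: (iffP idP) => [/mem_values[_ [c _ <-]]|[c e]]; first by exists c.
rewrite -e; apply: values_mem; last by lia.
by have := gn c; rewrite /base_row; case: ifP; lia.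
Qed.

Section Values.

Variables (n r : nat).
Hypothesis (rn : 0 < r < n).

Lemma values_swap g : values n (g \o transp r) =i values n g.
Proof.
have H g' a : a \in values n (g' \o transp r) -> a \in values n g'.
  move=> /mem_values[a0 [c hc e]]; move: a0; rewrite -e /= => a0.
  by apply: values_mem => //; rewrite transp_letter.
move=> a; apply/idP/idP; first exact: H.
move=> h; apply: (H (g \o transp r)).
suff -> : values n ((g \o transp r) \o transp r) = values n g by [].
by rewrite /values; congr filter; apply: eq_map => c /=; rewrite transpK.
Qed.

Lemma values_transp g : values n (transp r \o g) =i [seq transp r x | x <- values n g].
Proof.
move=> a; rewrite /values filter_map map_comp -map_comp filter_map -map_comp.
suff -> : [seq x <- iota 1 n | preim (transp r \o g) (fun x => 0 < x) x] =
  [seq x <- iota 1 n | preim g (fun x => 0 < x) x] by [].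
apply: eq_filter => c /=.
by have [[-> ->]|[-> ->]|[_ _ ->]] := transpP r (g c); lia.
Qed.

End Values.

(* Exchanging the values r and r+1 in a row may only be compared with the greedy
   rule when r+1 is met before r. *)
Definition follows (r : nat) (f : nat -> nat) : Prop :=
  forall c, f c = r -> exists2 c0, c0 < c & f c0 = r.+1.

Section Step.

Variables (n r : nat) (f g h : nat -> nat).
Hypothesis (rn : 0 < r < n).
Hypotheses (fn : forall c, f c <= base_row n c) (gr : greedy f g).
Hypotheses (fI : forall c c', 0 < f c -> f c = f c' -> c = c').
Hypotheses (gI : forall c c', 0 < g c -> g c = g c' -> c = c').
Hypothesis (fo : follows r f).
Hypothesis (hf : (forall c, h c = f c) \/ (forall c, h c = transp r (f c))).

Lemma step_no_s : (forall c, g c <> r.+1) -> greedy h g.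
Proof.
move=> gs; have [b p] := gr.
have e a c : a <> r.+1 -> (a <= h c) = (a <= f c).
  by move=> na; case: hf => ->; rewrite ?leq_transp.
by split=> [c|c c' cc a0]; rewrite e //; apply: p.
Qed.

(** An r in [f] has an r+1 further left by [follows], and there the r+1 of the upper row would have
    been admissible. *)
Lemma no_late_s c1 c : g c1 = r.+1 -> c < c1 -> f c <> r.
Proof.
move=> e1 cc /fo[c0 c0c e0]; have [b p] := gr.
by have := p c0 c1 ltac:(lia); rewrite e1 e0 => /(_ isT (leqnn _)); have := b c0; lia.
Qed.

Lemma step_only_s : (forall c, g c <> r) -> greedy h (transp r \o g).
Proof.
move=> grr; have [b p] := gr.
have e a c : a <> r.+1 -> (a <= h c) = (a <= f c).
  by move=> na; case: hf => ->; rewrite ?leq_transp.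
split=> [c|c c' cc] /=.
  have := b c; have [[ec _]|[ec ->]|[n1 n2 ->]] := transpP r (g c); first by have := @grr c.
    by rewrite e; lia.
  by rewrite e.
have [[ec _]|[ec ->]|[n1 n2 ->]] := transpP r (g c'); first by have := @grr c'.
  move=> r0; rewrite e; last by lia.
  move=> rf; have nr := no_late_s ec cc.
  have := p _ _ cc; rewrite ec => /(_ isT ltac:(lia)).
  by have [[-> ->]|[-> ->]|[_ _ ->]] := transpP r (g c); lia.
move=> a0; rewrite e // => le; have := p _ _ cc a0 le.
by have [[-> ->]|[-> ->]|[_ _ ->]] := transpP r (g c); lia.
Qed.

(** If the lower values are exchanged, the upper ones must follow when r+1 stands on r+1, for then
    it loses its room; otherwise the upper row may stay. *)
Lemma step_both c1 c2 : g c1 = r.+1 -> g c2 = r ->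
  greedy h g \/ greedy h (transp r \o g).
Proof.
move=> e1 e2; have [b p] := gr.
case: hf => hE.
  by left; split=> [c|c c' cc]; rewrite hE //; apply: p.
have ez a c : a <> r.+1 -> (a <= h c) = (a <= f c) by move=> na; rewrite hE leq_transp.
have uniq1 c : g c = r.+1 -> c = c1 by move=> ec; apply: gI; rewrite ec.
have [fc1|fc1] := eqVneq (f c1) r.+1; last first.
  left; split=> [c|c c' cc].
    case: (eqVneq (g c) r.+1) => [ec|/eqP ne]; last by rewrite ez.
    have := b c; have := uniq1 _ ec => ecc; subst c.
    by rewrite hE ec; have [[? ->]|[? ->]|[_ _ ->]] := transpP r (f c1); lia.
  case: (eqVneq (g c') r.+1) => [ec|/eqP ne]; last by rewrite ez //; apply: p.
  rewrite ec => _; have ecc := uniq1 _ ec; subst c'; rewrite hE => le.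
  have nr := no_late_s ec cc.
  have := p _ _ cc; rewrite ec; apply=> //.
  by move: le; have [[? ->]|[? ->]|[_ _ ->]] := transpP r (f c); lia.
right; split=> [c|c c' cc] /=.
  have := b c; have [[ec ->]|[ec ->]|[n1 n2 ->]] := transpP r (g c).
  - have ne : c <> c1 by move=> e; subst c; lia.
    have nf : f c <> r.+1 by move=> e; apply: ne; apply: fI; rewrite e.
    by rewrite hE; have [[? ->]|[? ->]|[? ? ->]] := transpP r (f c); lia.
  - by rewrite ez; lia.
  - by rewrite ez.
have [[ec ->]|[ec ->]|[n1 n2 ->]] := transpP r (g c').
- rewrite hE => _ le.
  have ne : c <> c1 by move=> e; subst c; move: le; rewrite fc1 transp_s; lia.
  have nf : f c <> r.+1 by move=> e; apply: ne; apply: fI; rewrite e.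
  have ng : g c <> r.+1 by move=> e; apply: ne; apply: uniq1.
  have := p _ _ cc; rewrite ec => /(_ ltac:(lia)).
  move: le; have [[-> ->]|[? ->]|[_ _ ->]] := transpP r (f c); try lia;
    have [[? ->]|[? ->]|[_ _ ->]] := transpP r (g c); lia.
- have ecc := uniq1 _ ec; subst c'; rewrite ez; last by lia.
  move=> r0 le; have nr := no_late_s ec cc.
  have := p _ _ cc; rewrite ec => /(_ isT ltac:(lia)).
  by have [[? ->]|[? ->]|[_ _ ->]] := transpP r (g c); lia.
move=> a0; rewrite ez // => le; have := p _ _ cc a0 le.
by have [[-> ->]|[-> ->]|[_ _ ->]] := transpP r (g c); lia.
Qed.

Lemma follows_both c1 : g c1 = r.+1 -> follows r g.
Proof.
move=> e1 c2 e2; exists c1 => //; have [b p] := gr.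
rewrite ltnNge leq_eqVlt; apply/negP => /orP[/eqP e|cc]; first by subst c2; lia.
have nr := no_late_s e1 cc.
by have := p _ _ cc; rewrite e1 e2 => /(_ isT); have := b c2; lia.
Qed.

End Step.

Lemma greedy_ext f1 f2 g1 g2 : f1 =1 f2 -> g1 =1 g2 -> greedy f1 g1 -> greedy f2 g2.
Proof.
by move=> ef eg [b h]; split=> [c|c c' cc]; rewrite -!ef -!eg; [apply: b|apply: h].
Qed.

(* Relates a row f of the filling of a tableau and the row f' of the filling
   obtained after the unmatched r+1 have been changed; k counts the unmatched r
   of the rows up to f. *)
Definition row_sim (r k : nat) (f f' : nat -> nat) : Prop :=
  [/\ k = 0, f' =1 f, f r = r & f r.+1 = r.+1] \/
  exists h (e : bool),
   [/\ h =1 f \/ (k = 0 /\ h =1 transp r \o f),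
       f' =1 (if e then h \o transp r else h),
       k = 0 -> follows r f & e \/ f r.+1 <= f r].

Section SimStep.

Variables (n r k k' : nat) (f g f' g' : nat -> nat).
Hypothesis (rn : 0 < r < n).
Hypotheses (fn : forall c, f c <= base_row n c) (gr : greedy f g).
Hypotheses (fn' : forall c, f' c <= base_row n c) (gr' : greedy f' g').
Hypotheses (fI : forall c c', 0 < f c -> f c = f c' -> c = c').
Hypotheses (gI : forall c c', 0 < g c -> g c = g c' -> c = c').
Hypothesis (vg : values n g' =i
  [seq if [&& x == r.+1, r \notin values n g & k == 0] then r else x | x <- values n g]).
Hypothesis (kE : k' = if r.+1 \in values n g then if r \in values n g then k else k.-1
  else if r \in values n g then k.+1 else k).

Lemma gbase c : g c <= base_row n c.
Proof. by apply: leq_trans (fn c); apply: (proj1 gr). Qed.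

Lemma notin_values a c : 0 < a -> a \notin values n g -> g c <> a.
Proof.
by move=> a0 h e; case/negP: h; apply/(mem_valuesP gbase a0); exists c.
Qed.

Lemma row_unique G : greedy f' G -> values n G =i values n g' -> g' =1 G.
Proof. by move=> grG vG; apply: (greedy_unique fn' gr' grG) => a; rewrite vG. Qed.

(** [g2] is the solution over [h], before columns are exchanged. [greedy_swap] transfers it to f',
    either keeping the exchange or ending it; the inequality recorded at the end excludes a
    resumption. *)
Lemma row_sim_finish h e g2 : f' =1 (if e then h \o transp r else h) ->
  e \/ f r.+1 <= f r -> greedy h g2 -> values n g2 =i values n g' ->
  g2 =1 g \/ (k' = 0 /\ g2 =1 transp r \o g) -> (k' = 0 -> follows r g) ->
  row_sim r k' g g'.
Proof.
move=> ef he gh v2 hg fo; right.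
case: e ef he => ef he; last first.
  exists g2, false; split=> //.
    by apply: row_unique => //; apply: greedy_ext gh => // c; rewrite ef.
  right; case: he => // he; case: (posnP (g r.+1)) => [->//|p].
  have [b pg] := gr; apply/ltnW/(pg _ _ (ltnSn r)) => //.
  by apply: leq_trans he; apply: b.
have [gs|[gs lt]] := greedy_swap r gh.
  exists g2, true; split=> //; last by left.
  apply: row_unique => [|a]; first by apply: greedy_ext gs => // c; rewrite ef.
  by rewrite (values_swap rn).
have eg : g' =1 g2 by apply: row_unique => //; apply: greedy_ext gs => // c; rewrite ef.
exists g2, false; split=> //; right; case: hg => [hg|[_ hg]].
  by rewrite -!hg ltnW.
(* Undoing the exchange of values could reverse the inequality only if g' r were r+1, but column r
   stands on the basement letter r. *)
have := proj1 gr' r; have := fn' r; rewrite eg /base_row.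
move: lt; rewrite !hg /=; case: ifP => _;
  have [[? ->]|[? ->]|[? ? ->]] := transpP r (g r);
  have [[? ->]|[? ->]|[? ? ->]] := transpP r (g r.+1); lia.
Qed.

Lemma row_sim_step : row_sim r k f f' -> row_sim r k' g g'.
Proof.
have r0 : 0 < r by case/andP: rn.
have vid : ~~ [&& r.+1 \in values n g, r \notin values n g & k == 0] ->
    values n g =i values n g'.
  move=> nc a; rewrite vg; congr (a \in _); rewrite -[LHS]map_id.
  apply/eq_in_map => x hx; case: ifP => // /and3P[/eqP ex h1 h2].
  by case/negP: nc; rewrite -ex hx h1.
have vtr : r \notin values n g -> k = 0 -> values n (transp r \o g) =i values n g'.
  move=> nr k0 a; rewrite vg (values_transp rn); congr (a \in _).
  apply/eq_in_map => x hx; rewrite nr k0 eqxx andbT.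
  have [[xr _]|[-> ->]|[_ ns ->]] := transpP r x; last by case: eqP.
    by case/negP: nr; rewrite -xr.
  by rewrite eqxx.
have [b pg] := gr.
case=> [[k0 ef fr fs]|[h [e [hf ef fo he]]]]; last first.
  (* For k > 0 any r+1 of this row is matched, so the row keeps its values. *)
  case: (posnP k) => [k0|kp]; last first.
    have {}hf : h =1 f by case: hf => // -[]; lia.
    apply: (@row_sim_finish h e g) => //.
    - exact: greedy_ext gr.
    - by apply: vid; rewrite (gtn_eqF kp) !andbF.
    - by left.
    rewrite kE; case: ifP => hs; case: ifP => hr; try lia.
    by move=> _ c ec; case: (@notin_values r c r0) => //; rewrite hr.
  have {}fo := fo k0.
  have {}hf : (forall c, h c = f c) \/ (forall c, h c = transp r (f c)).
    by case: hf => [|[_]]; [left|right].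
  have [hs|hs] := boolP (r.+1 \in values n g); last first.
    apply: (@row_sim_finish h e g) => //.
    - by apply: (step_no_s gr hf) => c; apply: notin_values.
    - by apply: vid; rewrite (negbTE hs).
    - by left.
    rewrite kE (negbTE hs) k0; case: ifP => // hr _ c ec.
    by case: (@notin_values r c r0) => //; rewrite hr.
  have [hr|hr] := boolP (r \in values n g); last first.
    apply: (@row_sim_finish h e (transp r \o g)) => //.
    - by apply: (step_only_s rn gr fo hf) => c; apply: notin_values.
    - exact: vtr.
    - by right; rewrite kE hs (negbTE hr) k0.
    by move=> _ c ec; case: (@notin_values r c r0).
  have /(mem_valuesP gbase (ltn0Sn r))[c1 e1] := hs.
  have /(mem_valuesP gbase r0)[c2 e2] := hr.
  have fog : k' = 0 -> follows r g by move=> _; apply: (follows_both rn gr fo e1).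
  have k'0 : k' = 0 by rewrite kE hs hr.
  have vv : values n g =i values n g' by apply: vid; rewrite hr andbF.
  have [gh|gh] := step_both rn gr fI gI fo hf e1 e2.
    by apply: (@row_sim_finish h e g) => //; left.
  apply: (@row_sim_finish h e (transp r \o g)) => //; last by right.
  move=> a; rewrite (values_transp rn) -vv; apply/mapP/idP => [[x hx ->]|ha].
    by have [[_ ->]|[_ ->]|[_ _ ->]] := transpP r x.
  exists (transp r a); last by rewrite transpK.
  by have [[_ ->]|[_ ->]|[_ _ ->]] := transpP r a.
(* The initial stage remains: the chains coincide so far, with r and r+1 on their own basement
   columns. *)
have fc c : f c <= c by have := fn c; rewrite /base_row; case: ifP; lia.
have gs_at c : g c = r.+1 -> c = r.+1.
  move=> ec; have [lt|lt|//] := ltngtP c r.+1; first by have := fc c; have := b c; lia.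
  by have := pg _ _ lt; rewrite ec fs => /(_ isT (leqnn _)); have := b r.+1; lia.
have gr_at c : g c = r -> c = r.
  move=> ec; have [lt|lt|//] := ltngtP c r; first by have := fc c; have := b c; lia.
  by have := pg _ _ lt; rewrite ec fr => /(_ r0 (leqnn _)); have := b r; lia.
have [hs|hs] := boolP (r.+1 \in values n g); last first.
  have vv : values n g =i values n g' by apply: vid; rewrite (negbTE hs).
  right; exists g, false; split=> //; first by left.
  - by apply: row_unique => //; apply: greedy_ext gr.
  - rewrite kE (negbTE hs) k0; case: ifP => // hr _ c ec.
    by case: (@notin_values r c r0) => //; rewrite hr.
  right; case: (posnP (g r.+1)) => [->//|p].
  have ns := @notin_values r.+1 r.+1 (ltn0Sn r) hs; have bs := b r.+1.
  by apply/ltnW/(pg _ _ (ltnSn r)) => //; lia.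
have /(mem_valuesP gbase (ltn0Sn r))[c1 e1] := hs.
have ec1 := gs_at _ e1; subst c1.
have [hr|hr] := boolP (r \in values n g).
  have /(mem_valuesP gbase r0)[c2 e2] := hr.
  have ec2 := gr_at _ e2; subst c2.
  left; split=> //; first by rewrite kE hs hr.
  apply: row_unique; first exact: greedy_ext gr.
  by apply: vid; rewrite hr andbF.
have nr c : g c <> r by apply: notin_values.
(* r+1 occurs without r: it becomes r and moves from column r+1 to column r. Here the exchange of
   columns begins, together with one of values. *)
right; exists (transp r \o g), true; split.
- by right; rewrite kE hs (negbTE hr) k0.
- apply: row_unique; last by move=> a; rewrite (values_swap rn) // vtr.
  have gs c : c <> r.+1 -> g c <> r.+1 by move=> h /gs_at.
  have br : g r < r by have := b r; have := nr r; lia.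
  have id c : c <> r.+1 -> transp r (g c) = g c by move=> h; apply: transp_id; [exact: nr|exact: gs].
  split=> [c|c c' cc] /=; rewrite ?ef.
    have [[-> ->]|[-> ->]|[n1 n2 ->]] := transpP r c.
    - by rewrite e1 transp_s fr.
    - by rewrite id ?fs; lia.
    - by rewrite id.
  have [[ec' ->]|[ec' ->]|[n1' n2' ->]] := transpP r c'.
  - by rewrite e1 transp_s => _; have := fc c; lia.
  - rewrite id; last by lia.
    have [[ec ->]|[ec ->]|[n1 n2 ->]] := transpP r c; try lia.
      by rewrite e1 transp_s => _ _.
    by rewrite id // => a0 le; apply: pg => //; lia.
  rewrite id // => a0; have nc' := nr c'; have nsc' := gs c' n2'.
  have [[ec ->]|[ec ->]|[n1 n2 ->]] := transpP r c.
  - by rewrite e1 transp_s ec fr; lia.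
  - rewrite ec fs => le; rewrite id; last by lia.
    by apply: pg => //; lia.
  by rewrite id //; apply: pg.
- by move=> _ c /nr.
by left.
Qed.

End SimStep.

Fixpoint unmatched_rows (n r : nat) (fr : nat -> nat -> nat) (i : nat) : nat :=
  if i is i'.+1 then
    let k := unmatched_rows n r fr i' in
    if r.+1 \in values n (fr i) then if r \in values n (fr i) then k else k.-1
    else if r \in values n (fr i) then k.+1 else k
  else 0.

(** Exchanging values keeps the occupied places, so only the flag [e] counts. Where it is false, f
    (r+1) <= f r; separation makes column r the shorter one, so both places are filled or both are
    empty and an exchange is invisible. *)
Lemma separated_swap n r T fr fr' T' : 0 < r < n ->
  all (all (letter n)) T -> tableau T -> chain_of n fr T -> chain_of n fr' T' ->
  (forall i, revcol n T' i =
     [seq if [&& x == r.+1, r \notin revcol n T i & unmatched_rows n r fr i == 0]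
          then r else x | x <- revcol n T i]) ->
  separated fr r -> forall i c, (0 < fr' i c) = (0 < fr i (transp r c)).
Proof.
move=> rn lT tT cf cf' hv [i0 [z0 p0]].
have r0 : 0 < r by case/andP: rn.
have [ch pv] := cf; have [ch' pv'] := cf'.
have inj0 c c' : 0 < fr 0 c -> fr 0 c = fr 0 c' -> c = c'.
  by rewrite !(proj1 ch) /base_row; case: ifP => _; case: ifP => _; lia.
have inj i c c' : 0 < fr i c -> fr i c = fr i c' -> c = c'.
  by case: i => [|i]; [exact: inj0|exact: (rows_inj tT lT cf)].
have sim i : row_sim r (unmatched_rows n r fr i) (fr i) (fr' i).
  elim: i => [|i IH].
    left; split=> //; first by move=> c; rewrite (proj1 ch) (proj1 ch').
      by rewrite (proj1 ch) /base_row; case: ifP; lia.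
    by rewrite (proj1 ch) /base_row; case: ifP; lia.
  apply: (row_sim_step rn (fun c => chain_base i c ch) (proj2 ch i)
    (fun c => chain_base i c ch') (proj2 ch' i) (inj i) (inj i.+1) _ _ IH) => // a.
  rewrite (perm_mem (pv' i)) hv; apply/idP/idP.
    move=> /mapP[x hx ->]; apply/mapP; exists x; first by rewrite (perm_mem (pv i)).
    by rewrite (perm_mem (pv i)).
  move=> /mapP[x hx ->]; apply/mapP; exists x; first by rewrite -(perm_mem (pv i)).
  by rewrite (perm_mem (pv i)).
have supp i : (0 < fr i r) = (0 < fr i r.+1) ->
    forall c, (0 < fr i (transp r c)) = (0 < fr i c).
  by move=> e c; have [[-> ->]|[-> ->]|[_ _ ->]] := transpP r c; rewrite ?e.
have order i : 0 < fr i r -> 0 < fr i r.+1.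
  move=> h; case: (leqP i i0) => le; first by have := @chain_le n fr i i0 r.+1 ch le; lia.
  by have := @chain_le n fr i0 i r ch (ltnW le); lia.
move=> i c; have [[_ ef fr_r fr_s]|[h [e [hf ef _ he]]]] := sim i.
  by rewrite ef supp // fr_r fr_s r0.
have hp c' : (0 < h c') = (0 < fr i c').
  case: hf => [->//|[_ ->]] /=.
  by have [[-> ->]|[-> ->]|[_ _ ->]] := transpP r (fr i c'); rewrite ?r0.
case: (eqVneq (0 < fr i r) (0 < fr i r.+1)) => [eq|ne].
  by rewrite ef; case: (e); rewrite /= hp supp.
have [pr|ps] : 0 < fr i r \/ (fr i r = 0 /\ 0 < fr i r.+1).
  by move: ne; case: (posnP (fr i r)); case: (posnP (fr i r.+1)); intuition.
  by move: ne; rewrite pr order.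
by case: he ef => [->|]; [move=> ->; rewrite /= hp | lia].
Qed.

(** * The theorem *)

(** The final complementation is left out; [revcol] reads the columns of the reverse tableau off
    this one. *)
Definition Ptilde n v := schensted (starw n v).

Definition ssaf n v := rho n (map (map (compl n)) (Ptilde n v)).

Lemma Ptilde_tableau n v : tableau (Ptilde n v).
Proof. exact: schensted_tableau. Qed.

Lemma Ptilde_letter n v : all (letter n) v -> all (all (letter n)) (Ptilde n v).
Proof.
by move=> /starw_letter/schensted_ssyt; rewrite is_ssytE => /andP[].
Qed.

Lemma Ptilde_cons n x v : Ptilde n (x :: v) = insert (Ptilde n v) (compl n x).
Proof. by rewrite /Ptilde /starw /= rev_cons /schensted foldl_rcons. Qed.

Lemma mem_Ptilde n v y : all (letter n) v -> letter n y ->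
  (exists j, y \in revcol n (Ptilde n v) j) <-> y \in v.
Proof.
move=> lv ly; have lT := Ptilde_letter lv.
have pe := schensted_perm (starw n v); rewrite -/(Ptilde n v) in pe.
have e : (compl n y \in flatten (Ptilde n v)) = (y \in v).
  rewrite (perm_mem pe) mem_rev; apply/mapP/idP => [[x hx ex]|h]; last by exists y.
  by rewrite -(complK ly) ex complK //; apply: (allP lv).
rewrite -e; split=> [[j]|/flattenP[R /(nthP [::])[i iT <-] /(nthP 0)[j jR ej]]].
  rewrite (mem_revcol j lT ly) => /mem_colP[i [hj <-]].
  apply/flattenP; exists (nth [::] (Ptilde n v) i); last exact: mem_nth.
  by apply: mem_nth; case: ltnP => // h; rewrite nth_default in hj.
by exists j; rewrite (mem_revcol j lT ly); apply/mem_colP; exists i.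
Qed.

Lemma chain_exists n v : all (letter n) v -> exists fr, chain_of n fr (Ptilde n v).
Proof.
elim: v => [_|x v IH /andP[lx lv]].
  exists (fun i => if i is 0 then base_row n else fun=> 0); split.
    split=> // i; split=> [c|c c' _ //]; by case: i.
  move=> i; rewrite /revcol /col /=; suff -> : values n (fun=> 0) = [::] by [].
  by rewrite /values; elim: (iota 1 n).
have [fr cf] := IH lv; rewrite Ptilde_cons.
exists (inserted_rows n fr (Ptilde n v) x).
by apply: inserted_chain_of => //; [exact: Ptilde_tableau|exact: Ptilde_letter].
Qed.

(** Letters in front are handled by [inserted_separated]. The word from r+1 on has no r, so column r
    is empty from row 1 on; the entry r+1 stands in some column c >= r+1 whose basement letter c
    occurs in the word, which leaves c = r+1. *)
Lemma separated_exists n r v1 v2 : 0 < r < n -> all (letter n) (v1 ++ r.+1 :: v2) ->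
  all (fun y => (y == r.+1) || (y < r)) v2 ->
  exists2 fr, chain_of n fr (Ptilde n (v1 ++ r.+1 :: v2)) & separated fr r.
Proof.
move=> rn; elim: v1 => [|x v1 IH] /= /andP[lx lv] hv2; last first.
  have [fr cf sf] := IH lv hv2; rewrite Ptilde_cons.
  exists (inserted_rows n fr (Ptilde n (v1 ++ r.+1 :: v2)) x).
    by apply: inserted_chain_of => //; [exact: Ptilde_tableau|exact: Ptilde_letter].
  by apply: inserted_separated => //; [exact: Ptilde_tableau|exact: Ptilde_letter].
have lv0 : all (letter n) (r.+1 :: v2) by rewrite /= lx.
have [fr cf] := chain_exists lv0; have [ch pv] := cf.
have row1 c : 0 < fr 1 c -> c \in r.+1 :: v2.
  move=> f0; have e := chain_row1 ch f0.
  have hc : 0 < c <= n.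
    by have := chain_base 1 c ch; rewrite /base_row; case: ifP; lia.
  have h : c \in values n (fr 1) by rewrite -{1}e; apply: values_mem.
  apply/(mem_Ptilde lv0 (y := c)); first by rewrite /letter; lia.
  by exists 0; rewrite -(perm_mem (pv 0)).
exists fr => //; exists 1; split.
  case: (posnP (fr 1 r)) => // /row1; rewrite inE => /orP[|/(allP hv2)]; lia.
have [j hj] : exists j, r.+1 \in revcol n (Ptilde n (r.+1 :: v2)) j.
  by apply/(mem_Ptilde lv0 (y := r.+1)); [|rewrite inE eqxx].
move: hj; rewrite -(perm_mem (pv j)) => /mem_values[_ [c hc e]].
have f1 : 0 < fr 1 c by have := @chain_le n fr 1 j.+1 c ch isT; lia.
have cr : r < c by have := chain_base j.+1 c ch; rewrite /base_row; case: ifP; lia.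
have ec : c = r.+1 by have := row1 c f1; rewrite inE => /orP[/eqP|/(allP hv2)]; lia.
by rewrite -ec.
Qed.

Lemma ssaf_knuth n u v : all (letter n) u -> knuth u v -> ssaf n u = ssaf n v.
Proof. by move=> lu h; rewrite /ssaf /Ptilde (insert_knuth (knuth_starw h lu)). Qed.

Lemma ssaf_inj n u v : all (letter n) u -> all (letter n) v ->
  ssaf n u = ssaf n v -> knuth u v.
Proof.
move=> lu lv; have [fu cu] := chain_exists lu; have [fv cv] := chain_exists lv.
move/(rho_inj (Ptilde_letter lu) (Ptilde_tableau n u) cu
  (Ptilde_letter lv) (Ptilde_tableau n v) cv) => /knuthP h.
rewrite -(starwK lu) -(starwK lv); apply: knuth_starw h _.
exact: starw_letter.
Qed.

Lemma Psi_ssaf n P : Psi n P = ssaf n (column_word P).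
Proof. by []. Qed.

Lemma ups_letter n r v : 0 < r < n -> all (letter n) v -> all (letter n) (ups r v).
Proof.
move=> rn lv; apply/allP => x /mem_ups[/(allP lv)//|[-> _]].
by move: rn; rewrite /letter; lia.
Qed.

Lemma transposeK X : sorted geq (map size X) -> all (fun R => R != [::]) X ->
  transpose (transpose X) = X.
Proof.
elim: X => // R X IH sX /andP[hR hX].
have sX' : sorted geq (map size X) by apply: path_sorted sX.
have eT : transpose (R :: X) = [seq nth 0 R j :: col X j | j <- iota 0 (size R)].
  rewrite transposeE; apply/eq_in_map => j; rewrite mem_iota => hj.
  by rewrite col_cons; have -> : j < size R by case/andP: hj.
have eR : R = [seq nth 0 R j | j <- iota 0 (size R)] by rewrite -/(mkseq _ _) mkseq_nth.
have e0 : col (transpose (R :: X)) 0 = R.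
  by rewrite eT {3}eR; elim: (iota 0 (size R)) => //= j s IHs; rewrite col_cons /= IHs.
have eS i : col (transpose (R :: X)) i.+1 = col (transpose X) i.
  have -> : col (transpose (R :: X)) i.+1 = col [seq col X j | j <- iota 0 (size R)] i.
    by rewrite eT; elim: (iota 0 (size R)) => //= j s IHs; rewrite !col_cons /= ltnS IHs.
  have le : size (head [::] X) <= size R.
    by case: (X) sX => //= S X' /andP[].
  rewrite transposeE -{1}(subnKC le) iotaD map_cat /col filter_cat map_cat add0n.
  rewrite -[RHS]cats0 -/(col X); congr (_ ++ _).
  suff -> : [seq U <- [seq col X j | j <- iota (size (head [::] X)) (size R - size (head [::] X))]
    | i < size U] = [::] by [].
  apply/eqP; rewrite -[_ == _]negbK -has_filter; apply/hasPn => U /mapP[j].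
  rewrite mem_iota => hj ->; rewrite (_ : col X j = [::]) //.
  case: (X) sX' hj => //= S X' h /andP[hj _].
  by rewrite col_cons ltnNge hj /= (sorted_size_col0 h).
have R0 : 0 < size R by case: (R) hR.
have eh : head [::] (transpose (R :: X)) = nth 0 R 0 :: col X 0.
  by rewrite eT; case: (R) R0.
rewrite transposeE eh [size _]/= -[(size _).+1]add1n iotaD map_cat [map _ (iota 0 1)]/= e0.
congr (_ :: _); rewrite -[RHS]IH // [RHS]transposeE.
have -> : size (head [::] (transpose X)) = size (col X 0).
  by case: (X) hX => // S X' /= /andP[hS _]; rewrite transposeE /=; case: (S) hS.
by rewrite -[0 + 1]/(1 + 0) iotaDl -map_comp; apply: eq_map => i /=; rewrite add1n eS.
Qed.

Lemma size_col_anti T j1 j2 : j1 <= j2 -> size (col T j2) <= size (col T j1).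
Proof.
move=> h; rewrite !size_map !size_filter; apply: sub_count => R /=.
exact: leq_ltn_trans.
Qed.

Lemma reshape_columns T v : tableau T -> size v = size (column_word T) ->
  column_word (transpose (map rev (reshape (map size (transpose T)) v))) = v.
Proof.
move=> tT sv; set sz := map size (transpose T).
have ssz : sumn sz = size v.
  rewrite sv /column_word size_flatten /shape /sz -map_comp.
  by congr sumn; apply: eq_map => c /=; rewrite size_rev.
have sh1 : map size (reshape sz v) = sz by apply: reshapeKl; rewrite ssz.
have srev (X : seq (seq nat)) : map size (map rev X) = map size X.
  by rewrite -map_comp; apply: eq_map => c /=; rewrite size_rev.
rewrite /column_word transposeK; first last.
- rewrite all_map; have : all (fun k => k != 0) (map size (reshape sz v)).
    rewrite sh1 /sz transposeE all_map all_map; apply/allP => j; rewrite mem_iota /= => hj.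
    case: (T) tT hj => // R T' tT hj.
    by rewrite col_cons; have -> : j < size R by exact: hj.
  by rewrite all_map; apply: sub_all => c /=; rewrite -!size_eq0 size_rev.
- rewrite srev sh1 /sz transposeE -map_comp; apply/(sortedP 0) => i.
  rewrite size_map size_iota => hi.
  rewrite !(nth_map 0) ?size_iota ?nth_iota; try lia.
  exact: size_col_anti.
rewrite -map_comp (eq_map (g := id)) ?map_id; last by move=> c /=; rewrite revK.
by apply: reshapeKr; rewrite ssz.
Qed.

(** The chosen tableau has the same filling as [schensted v], hence by [ssaf_inj] a Knuth equivalent
    column word, hence is the same tableau. *)
Lemma Psi_inv_ssaf n v : all (letter n) v -> Psi_inv n (ssaf n v) = schensted v.
Proof.
move=> lv; rewrite /Psi_inv.
have lc P : is_ssyt n P -> all (letter n) (column_word P).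
  rewrite is_ssytE => /andP[_ lP]; rewrite /column_word transposeE.
  apply/allP => x /flattenP[_ /mapP[_ /mapP[j _ ->] ->]].
  by rewrite mem_rev => hx; apply: (allP (col_letter j lP)).
have h : is_ssyt n (schensted v) /\ Psi n (schensted v) = ssaf n v.
  have sv := schensted_ssyt lv; split=> //; rewrite Psi_ssaf.
  by apply: ssaf_knuth (knuth_column_word v); apply: lc.
have [P1 P2] := classical_sets.xgetPex [::]
  (ex_intro (fun P => is_ssyt n P /\ Psi n P = ssaf n v) _ h).
move: P1 P2; set P := classical_sets.xget _ _ => P1 P2.
have tP : tableau P by move: P1; rewrite is_ssytE => /andP[].
rewrite -(schensted_column_word tP); apply: insert_knuth.
by apply: ssaf_inj P2 => //; apply: lc.
Qed.

Lemma Upsilon_ssaf n r v : 0 < r < n -> all (letter n) v ->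
  Upsilon_SSAF n r (ssaf n v) = ssaf n (ups r v).
Proof.
move=> rn lv; rewrite /Upsilon_SSAF Psi_inv_ssaf // Psi_ssaf /Upsilon_tableau.
rewrite change_unmatchedE reshape_columns ?schensted_tableau ?size_ups //.
apply/esym; apply: ssaf_knuth; first exact: ups_letter.
exact/knuth_ups/knuth_sym/knuth_column_word.
Qed.

(** * Recording tableaux and the map Phi on words *)

Lemma sizes_insert T x : map size (insert T x) = incr_nth (map size T) (new_row T x).
Proof.
elim: T x => // R T IH x; rewrite insert_cons new_row_cons /= row_insert_size.
have [[e [_ eR]]|[b e _]] := bumpedP R x; rewrite e /=.
  by rewrite -row_insert_size eR size_rcons.
rewrite IH; congr (_ :: _); move: e; rewrite /bumped; by case: ifP.
Qed.

Lemma incr_nth_inj s i j : incr_nth s i = incr_nth s j -> i = j.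
Proof.
by move/(congr1 (fun u => nth 0 u i)); rewrite !nth_incr_nth eqxx; case: eqP => // _; lia.
Qed.

(** The row of each new cell is where consecutive shapes differ, so the upper row and the shapes of
    all prefixes determine the recording tableau. *)
Lemma RSK_recording w1 w2 : unzip1 w1 = unzip1 w2 ->
  (forall m, map size (schensted (take m (unzip2 w1))) =
             map size (schensted (take m (unzip2 w2)))) ->
  (RSK w1).2 = (RSK w2).2.
Proof.
elim/last_ind: w1 w2 => [|w1 [a1 b1] IH] w2; first by case: w2.
case/lastP: w2 => [|w2 [a2 b2]]; first by rewrite /unzip1 map_rcons; case: (map _ _).
rewrite /unzip1 /unzip2 !map_rcons => /rcons_inj[e1 ea] h.
rewrite /= in ea; subst a2.
have sz : size w1 = size w2 by have := congr1 size e1; rewrite !size_map.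
have eQ : (RSK w1).2 = (RSK w2).2.
  apply: IH => // m; have [le|gt] := leqP m (size w1).
    by have := h m; rewrite -!cats1 !takel_cat ?size_map -?sz.
  rewrite !take_oversize ?size_map -?sz //; try exact: ltnW.
  by have := h (size w1); rewrite -!cats1 !takel_cat ?size_map -?sz // !take_oversize ?size_map -?sz.
rewrite !RSK_rcons /= eQ; congr (addcell _ _ _).
have := h (size w1).+1; rewrite !take_oversize ?size_rcons ?size_map -?sz //.
rewrite /schensted !foldl_rcons -!/(schensted _) !sizes_insert !RSK1.
have := h (size w1); rewrite -!cats1 !take_size_cat ?size_map // => <-.
exact: incr_nth_inj.
Qed.

Lemma unzip2_star n w : unzip2 (star n w) = starw n (unzip2 w).
Proof. by rewrite /unzip2 /star /starw map_rev -!map_comp. Qed.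

Lemma sizes_ups n r v : 0 < r < n -> all (letter n) v ->
  map size (Ptilde n (ups r v)) = map size (Ptilde n v).
Proof.
move=> rn lv; rewrite /Ptilde schensted_starw_ups // /ups_rows -map_comp.
by apply: eq_map => R /=; rewrite size_mkseq.
Qed.

Lemma take_starw n m v : take m (starw n v) = starw n (drop (size v - m) v).
Proof. by rewrite /starw take_rev size_map -map_drop. Qed.

Lemma RSK2_ups n r w : 0 < r < n -> all (letter n) (unzip2 w) ->
  (RSK (star n (zip (unzip1 w) (ups r (unzip2 w))))).2 = (RSK (star n w)).2.
Proof.
move=> rn lv; apply: RSK_recording.
  rewrite /unzip1 /star !map_rev; congr rev; rewrite -!map_comp.
  have e (u : seq (nat * nat)) : [seq (fun b => b.1) ((fun b => (compl n b.1, compl n b.2)) b) | b <- u]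
     = map (compl n) (unzip1 u) by rewrite /unzip1 -map_comp.
  rewrite [LHS]e [RHS]e unzip1_zip // size_ups !size_map //.
move=> m; rewrite !unzip2_star unzip2_zip; last by rewrite size_ups !size_map.
(* Prefixes of the starred word come from suffixes of the word, and changing unmatched letters
   commutes with passing to a suffix. *)
rewrite !take_starw size_ups drop_ups.
by apply: sizes_ups => //; apply: all_drop.
Qed.

Lemma bar_letter n w : is_biword n w -> is_biword n (bar w).
Proof.
case/andP=> _ lw; rewrite /is_biword /bar sort_sorted /=; last exact: biletter_le_total.
apply/allP => b; rewrite mem_sort => /mapP[c hc ->] /=.
by rewrite andbC; apply: (allP lw).
Qed.

Lemma bar_perm w : perm_eq (bar w) [seq (b.2, b.1) | b <- w].
Proof. by rewrite perm_sort. Qed.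

Lemma barK w : sorted biletter_le w -> bar (bar w) = w.
Proof.
move=> s; apply: (sorted_eq biletter_le_trans biletter_le_anti) => //.
  by apply: sort_sorted; exact: biletter_le_total.
rewrite (permPl (bar_perm _)) (permPl (perm_map _ (bar_perm _))) -map_comp.
by rewrite (eq_map (g := id)) ?map_id // => -[].
Qed.

Lemma star_sorted n w : is_biword n w -> sorted biletter_le (star n w).
Proof.
case/andP=> s lw; rewrite /star rev_sorted.
apply: (@homo_sorted_in _ _ (fun b => letter n b.1 && letter n b.2) _ biletter_le) => //.
move=> [a b] [c d]; rewrite !unfold_in /letter /biletter_le /compl /=; lia.
Qed.

Lemma bar_star n w : is_biword n w -> bar (star n w) = star n (bar w).
Proof.
move=> bw; apply: (sorted_eq biletter_le_trans biletter_le_anti).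
- by apply: sort_sorted; exact: biletter_le_total.
- by apply: star_sorted; apply: bar_letter.
rewrite (permPl (bar_perm _)) /star map_rev perm_rev perm_sym perm_rev -map_comp.
by rewrite (permPl (perm_map _ (bar_perm _))) -map_comp.
Qed.

Lemma biword_letters n w : is_biword n w -> all (letter n) (unzip2 w).
Proof. by case/andP=> _; rewrite all_map; apply: sub_all => b /andP[]. Qed.

Lemma PhiE n w : is_biword n w -> Phi n w = (ssaf n (unzip2 w), ssaf n (unzip2 (bar w))).
Proof.
move=> bw; rewrite /Phi /reverse_RSK RSK1 unzip2_star.
have := RSK_symmetry (star_sorted bw); rewrite bar_star // => /(congr1 fst) /=.
by rewrite RSK1 unzip2_star => <-.
Qed.

Lemma Phi_Upsilon n r w : 0 < r < n -> is_biword n w ->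
  Phi n (Upsilon_biword r w) =
  (Upsilon_SSAF n r (ssaf n (unzip2 w)), ssaf n (unzip2 (bar w))).
Proof.
move=> rn bw; have lw := biword_letters bw; have := PhiE bw.
rewrite Upsilon_biwordE Upsilon_ssaf // /Phi /reverse_RSK => -[_ <-].
by rewrite RSK2_ups // RSK1 unzip2_star unzip2_zip // size_ups !size_map.
Qed.

(** * Shapes, corners and cells *)

Lemma count_lt (P Q : pred nat) s x : x \in s -> Q x -> ~~ P x ->
  (forall y, P y -> Q y) -> count P s < count Q s.
Proof.
move=> xs qx px sub; elim: s xs => //= y s IH; rewrite inE => /orP[/eqP<-|/IH h].
  by rewrite qx (negbTE px) add0n add1n ltnS; apply: sub_count.
by have := sub y; case: (P y) => [/(_ isT)->|_]; case: (Q y); lia.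
Qed.

Lemma entry_map_iota (h : nat -> nat) n c : 0 < c ->
  entry [seq h i | i <- iota 1 n] c = if c <= n then h c else 0.
Proof.
move=> c0; rewrite /entry; case: leqP => cn.
  by rewrite (nth_map 0) ?size_iota ?nth_iota ?add1n ?prednK //; lia.
by rewrite nth_default // size_map size_iota; lia.
Qed.

Lemma sh_ssaf n v fr : all (letter n) v -> chain_of n fr (Ptilde n v) ->
  sh (ssaf n v) = [seq height fr (size (head [::] (Ptilde n v))) c | c <- iota 1 n].
Proof. by move=> lv cf; apply: sh_rho => //; [apply: Ptilde_letter|apply: Ptilde_tableau]. Qed.

Lemma separatedP n r v fr : 0 < r < n -> all (letter n) v ->
  chain_of n fr (Ptilde n v) ->
  separated fr r <-> entry (sh (ssaf n v)) r < entry (sh (ssaf n v)) r.+1.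
Proof.
move=> rn lv cf; have [ch _] := cf; set m := size (head [::] (Ptilde n v)).
rewrite (sh_ssaf lv cf) -/m !entry_map_iota //; last by case/andP: rn.
have -> : r <= n by lia.
have -> : r < n by lia.
have f0 c : 0 < c <= n -> 0 < fr 0 c.
  by move=> hc; rewrite (proj1 ch) /base_row; case: ifP; lia.
split=> [[i [z p]]|lt].
  have i0 : 0 < i by case: i z p => // z; have := f0 r; lia.
  have im : i <= m.
    case: leqP => // h; have := chain_of_oversize (Ptilde_tableau n v) cf h (c := r.+1).
    by lia.
  apply: (@count_lt _ _ _ i); rewrite ?mem_iota ?z //; first by lia.
  move=> j h; case: (leqP j i) => le; first by have := @chain_le n fr j i r.+1 ch le; lia.
  by have := @chain_le n fr i j r ch (ltnW le); lia.
have : has (fun i => (fr i r == 0) && (0 < fr i r.+1)) (iota 1 m).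
  apply: contraLR lt => /hasPn h; rewrite -leqNgt /height.
  rewrite (@eq_in_count _ _ (fun i => (0 < fr i r.+1) && (0 < fr i r))).
    by apply: sub_count => i /andP[].
  by move=> i /h /=; lia.
by case/hasP=> i _ /andP[/eqP z p]; exists i.
Qed.

Lemma s_swap_map (h : nat -> nat) n r : 0 < r < n ->
  [seq h (transp r c) | c <- iota 1 n] = s_swap r [seq h c | c <- iota 1 n].
Proof.
move=> rn; rewrite /s_swap !entry_map_iota //; last by case/andP: rn.
have -> : r <= n by lia.
have -> : r < n by lia.
apply: (@eq_from_nth _ 0); first by rewrite !size_set_nth !size_map size_iota; lia.
move=> i; rewrite size_map size_iota => hi.
rewrite nth_set_nth /= nth_set_nth /= !(nth_map 0) ?size_iota // nth_iota // add1n.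
have [[e ->]|[e ->]|[n1 n2 ->]] := transpP r i.+1.
- have -> : (i == r) = false by lia.
  by have -> : (i == r.-1) = true by lia.
- by have -> : (i == r) = true by lia.
- have -> : (i == r) = false by lia.
  by have -> : (i == r.-1) = false by lia.
Qed.

Lemma unmatched_rowsE n r fr v i : 0 < r < n -> all (letter n) v ->
  chain_of n fr (Ptilde n v) ->
  unmatched_rows n r fr i = col_closers r (revcol n (Ptilde n v)) i.
Proof.
move=> rn lv [_ pv]; elim: i => //= i ->; rewrite !(perm_mem (pv i)).
have sr := revcol_sorted i (Ptilde_letter lv) (Ptilde_tableau n v).
by rewrite (ups_decreasing _ _ sr).2.
Qed.

Lemma sh_ups n r v : 0 < r < n -> all (letter n) v ->
  entry (sh (ssaf n v)) r < entry (sh (ssaf n v)) r.+1 ->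
  sh (ssaf n (ups r v)) = s_swap r (sh (ssaf n v)).
Proof.
move=> rn lv; have [fr cf] := chain_exists lv.
move/(separatedP rn lv cf) => sep.
have lu := ups_letter rn lv; have [fr' cf'] := chain_exists lu.
have lT := Ptilde_letter lv; have tT := Ptilde_tableau n v.
have eT : Ptilde n (ups r v) = ups_rows n r (Ptilde n v) by apply: schensted_starw_ups.
have supp := separated_swap rn lT tT cf cf' _ sep.
rewrite (sh_ssaf lv cf) (sh_ssaf lu cf').
have -> : size (head [::] (Ptilde n (ups r v))) = size (head [::] (Ptilde n v)).
  by rewrite eT -!nth0 size_nth_ups_rows.
rewrite -s_swap_map //; apply: eq_map => c; apply: eq_count => i; apply: supp => {}i.
rewrite eT (revcol_ups_rows rn tT lT).
have sr := revcol_sorted i lT tT.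
by rewrite (ups_decreasing _ _ sr).1 (unmatched_rowsE _ rn lv cf).
Qed.

(** Changed letters stay in the shape because rows r and r+1 have equal length. An r+1 left in the
    corner would be matched by a later r; the upper entry of that r is at least the one of the
    corner and at most the common length, so both are equal and the r would have to come first. *)
Lemma ups_cells lam r w : 0 < r -> sorted biletter_le w ->
  all (fun b => cells lam (cell_of b)) w ->
  entry lam r = entry lam r.+1 ->
  all (fun b => cells lam (cell_of b) && (cell_of b != (r.+1, entry lam r.+1)))
    (zip (unzip1 w) (ups r (unzip2 w))).
Proof.
move=> r0; elim: w => // -[j i] w IH s /= /andP[hb hw] el.
rewrite IH ?(path_sorted s) // andbT.
move: hb; rewrite /cells /cell_of /= => /and3P[i0 j0 le].
case: ifP => [/andP[/eqP ei _]|nch]; first by rewrite r0 j0 el -{1}ei le /= xpair_eqE ltn_eqF.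
rewrite i0 j0 le /= xpair_eqE; apply/negP => /andP[/eqP ei /eqP ej].
move: nch; rewrite ei eqxx /= => /negbT; rewrite -lt0n => /closers_gt0.
move=> /mapP[[j' i'] hin ei']; rewrite /= in ei'; subst i'.
have := allP hw _ hin; rewrite /cells /cell_of /= => /and3P[_ _ le'].
move: s; rewrite /= (path_sortedE biletter_le_trans) => /andP[/allP/(_ _ hin)].
by rewrite /biletter_le /=; lia.
Qed.

Definition shape_antitone (lam : seq nat) : Prop :=
  forall i j, 0 < i <= j -> entry lam j <= entry lam i.

Lemma corner_separated n r lam w : 0 < r < n -> is_biword n w ->
  all (fun b => cells lam (cell_of b)) w -> shape_antitone lam ->
  (entry lam r.+1, r.+1) \in w ->
  entry lam r = entry lam r.+1 -> entry lam r.+2 < entry lam r.+1 ->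
  entry (sh (ssaf n (unzip2 w))) r < entry (sh (ssaf n (unzip2 w))) r.+1.
Proof.
move=> rn bw cw anti hin e1 e2; have lw := biword_letters bw.
have [s _] := andP bw.
case/splitPr: hin => w1 w2 in cw lw s bw *.
move: lw; rewrite /unzip2 map_cat /= -/(unzip2 w1) -/(unzip2 w2) => lw.
have hv2 : all (fun y => (y == r.+1) || (y < r)) (unzip2 w2).
  apply/allP => y /mapP[[j i] hin ->] /=.
  move: s; rewrite (sorted_pairwise biletter_le_trans) pairwise_cat /=.
  case/and3P=> _ _ /andP[/allP/(_ _ hin)]; rewrite /biletter_le /= => le _.
  have := allP cw (j, i); rewrite mem_cat inE hin !orbT => /(_ isT).
  rewrite /cells /cell_of /= => /and3P[i0 j0 ji].
  (* Rows from r+2 on are too short to reach the column of the corner. A letter r behind the corner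
     would share its upper entry, and then the order requires a lower entry at least r+1. *)
  have a1 := anti r i; have a2 := anti r.+2 i.
  by lia.
have [fr cf sep] := separated_exists rn lw hv2.
exact/(separatedP rn lw cf).
Qed.

Lemma count_geq (lam : seq nat) a b : sorted geq lam -> 0 < a -> 0 < b ->
  (b <= count (fun x => a <= x) lam) = (a <= entry lam b).
Proof.
move=> + a0; rewrite /entry; case: b => // b + _ /=.
elim: lam b => [|x lam IH] b s; first by rewrite nth_nil /=; lia.
have := s; rewrite /= (path_sortedE (rev_trans leq_trans)) => /andP[/allP hx sl].
case: b => [|b] /=; last first.
  case: (leqP a x) => ax; first by rewrite -IH // add1n ltnS.
  rewrite -IH // add0n.
  have -> : count (fun x => a <= x) lam = 0.
    by apply/eqP; rewrite -leqn0 leqNgt -has_count; apply/hasPn => y /hx /=; lia.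
  by [].
case: (leqP a x) => // ax; rewrite add0n.
have -> : count (fun x => a <= x) lam = 0.
  by apply/eqP; rewrite -leqn0 leqNgt -has_count; apply/hasPn => y /hx /=; lia.
by [].
Qed.

Lemma entry_conj n lam a : 0 < a ->
  entry (conj_shape n lam) a = if a <= n then count (fun x => a <= x) lam else 0.
Proof. exact: entry_map_iota. Qed.

Lemma conj_antitone n lam : shape_antitone (conj_shape n lam).
Proof.
move=> i j hij; rewrite !entry_conj; try lia.
case: (leqP j n) => // jn; rewrite (_ : i <= n); last by lia.
by apply: sub_count => x /=; lia.
Qed.

Lemma ferrers_antitone n lam : ferrers n lam -> shape_antitone lam.
Proof.
case/and3P=> _ s _ i j hij.
case: (posnP (entry lam j)) => [->//|p].
have i0 : 0 < i by lia.
rewrite -count_geq //; apply: leq_trans (_ : j <= _); first by lia.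
by rewrite count_geq //; lia.
Qed.

Lemma cells_conj n lam a b : ferrers n lam -> letter n a ->
  cells (conj_shape n lam) (a, b) = cells lam (b, a).
Proof.
case/and3P=> _ s _ /andP[a0 an]; rewrite /cells /= a0 entry_conj // an.
by case: (posnP b) => //= b0; rewrite count_geq.
Qed.

(** In (d) the inequality is asserted when [w] contains the transposed corner (mu_(r+1), r+1); by
    [transposed_corner_needed] the corner (r+1, lambda_(r+1)) alone does not imply it. *)
Theorem theorem2 (n r : nat) (lam : seq nat) (w : seq (nat * nat))
    (F G : seq (seq nat)) (nu beta mu : seq nat) :
  2 <= n -> ferrers n lam -> 1 <= r < n ->
  is_biword n w -> all (fun b => cells lam (cell_of b)) w ->
  Phi n w = (F, G) -> nu = sh F -> beta = sh G -> mu = conj_shape n lam ->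
  ((entry lam r.+1, r.+1) \in w ->
     (entry nu r < entry nu r.+1 -> sh (Upsilon_SSAF n r F) = s_swap r nu)
     /\
     (Phi n (Upsilon_biword r w) = (Upsilon_SSAF n r F, G) /\
      Phi n (Upsilon_biword r (bar w)) = (Upsilon_SSAF n r G, F))
     /\
     (entry lam r = entry lam r.+1 -> entry lam r.+2 < entry lam r.+1 ->
        entry nu r < entry nu r.+1 /\
        sh (Upsilon_SSAF n r F) = s_swap r nu /\
        all (fun b => cells lam (cell_of b) &&
                      (cell_of b != (r.+1, entry lam r.+1)))
            (Upsilon_biword r w)))
  /\
  (entry mu r = entry mu r.+1 -> entry mu r.+2 < entry mu r.+1 ->
     ((r.+1, entry mu r.+1) \in w ->
        entry beta r < entry beta r.+1 /\
        sh (Upsilon_SSAF n r G) = s_swap r beta)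
     /\
     ((entry lam r.+1, r.+1) \in w \/ (r.+1, entry mu r.+1) \in w ->
        all (fun b => cells lam b && (b != (entry mu r.+1, r.+1)))
            (Upsilon_biword r (bar w)))).
Proof.
move=> _ fl rn bw cw phi -> -> em.
have r0 : 0 < r by case/andP: rn.
have [sw _] := andP bw; have lw := biword_letters bw.
have bb := bar_letter bw; have lb := biword_letters bb; have [sb _] := andP bb.
move: phi; rewrite PhiE // => -[<- <-].
have swap v : all (letter n) v -> entry (sh (ssaf n v)) r < entry (sh (ssaf n v)) r.+1 ->
    sh (Upsilon_SSAF n r (ssaf n v)) = s_swap r (sh (ssaf n v)).
  by move=> lv h; rewrite Upsilon_ssaf // sh_ups.
(* [bar w] is a biword in the cells of the conjugate shape, so (d) becomes (c) for [bar w] and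
   [mu]. *)
have cb : all (fun b => cells mu (cell_of b)) (bar w).
  apply/allP => -[a b]; rewrite (perm_mem (bar_perm w)) => /mapP[[c d] hin [-> ->]].
  have := allP (proj2 (andP bw)) _ hin => /andP[lc _].
  by rewrite /cell_of /= em (cells_conj d fl lc); apply: (allP cw _ hin).
split=> [hin|m1 m2].
  split; first exact: swap.
  split.
    rewrite !Phi_Upsilon //; split=> //.
    by rewrite barK.
  move=> l1 l2; have h := corner_separated rn bw cw (ferrers_antitone fl) hin l1 l2.
  by split=> //; split; [exact: swap | rewrite Upsilon_biwordE; apply: ups_cells].
split=> [hin|_].
  have hin' : (entry mu r.+1, r.+1) \in bar w.
    by rewrite (perm_mem (bar_perm w)); apply/mapP; exists (r.+1, entry mu r.+1).
  have anti : shape_antitone mu by rewrite em; apply: conj_antitone.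
  have h := corner_separated rn bb cb anti hin' m1 m2.
  by split=> //; exact: swap.
have := ups_cells r0 sb cb m1; rewrite -Upsilon_biwordE => /allP h.
apply/allP => -[a b] hab; have := h _ hab; rewrite /cell_of /= em.
have lb' : letter n b.
  move: hab; rewrite Upsilon_biwordE => hab.
  have : b \in ups r (unzip2 (bar w)).
    have := map_f (fun p : nat * nat => p.2) hab; rewrite -/(unzip2 _) unzip2_zip //.
    by rewrite size_ups !size_map.
  exact: (allP (ups_letter rn lb)).
rewrite (cells_conj a fl lb') => /andP[-> ne] /=.
by apply: contra ne => /eqP[-> ->].
Qed.
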